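(* Let $\mathcal U$ be a separable Hilbert space and let $F\colon \mathbb D^d\to\mathcal L(\mathcal U)$ be a function. The following are equivalent. (1) $F$ is in the Herglotz--Agler class $\mathcal{HA}(\mathbb D^d,\mathcal L(\mathcal U))$. (2) There exist $\mathcal L(\mathcal U)$-valued positive kernels $K_1,\dots,K_d$ on $\mathbb D^d$ such that $$F(\omega)^*+F(\zeta)=\sum_{k=1}^d(1-\overline{\omega}_k\zeta_k)K_k(\omega,\zeta)\qquad\text{for all }\omega,\zeta\in\mathbb D^d.$$ (3) There exist a Hilbert space $\mathcal X$, a $d$-fold spectral decomposition $(P_1,\dots,P_d)$ of $I_{\mathcal X}$ with associated operator pencil $P(\zeta)=\zeta_1P_1+\cdots+\zeta_dP_d$, and a bounded operator $$\mathbf U=\begin{bmatrix}A&B\\C&D\end{bmatrix}\colon\begin{bmatrix}\mathcal X\\\mathcal U\end{bmatrix}\to\begin{bmatrix}\mathcal X\\\mathcal U\end{bmatrix}$$ whose block entries satisfy $$A^*A=AA^*=I_{\mathcal X},\qquad B=AC^*,\qquad D+D^*=CC^*\ (=B^*B),$$ such that $$F(\zeta)=D+C(I-P(\zeta)A)^{-1}P(\zeta)B\qquad\text{for all }\zeta\in\mathbb D^d.$$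
   Context: $\mathbb D^d=\{\zeta\in\mathbb C^d: |\zeta_k|<1,\ k=1,\dots,d\}$ is the unit polydisk. $\mathcal L(\mathcal U)$ is the space of bounded linear operators on $\mathcal U$. Fix a separable infinite-dimensional Hilbert space $\mathcal K$. For a holomorphic $F\colon\mathbb D^d\to\mathcal L(\mathcal U)$ with Taylor expansion $F(\zeta)=\sum_{n\in\mathbb Z_+^d}F_n\zeta^n$ and a commutative $d$-tuple $T=(T_1,\dots,T_d)$ of strict contractions on $\mathcal K$ ($\|T_k\|<1$), set $F(T)=\sum_{n}F_n\otimes T^n$ (strong operator convergence on $\mathcal U\otimes\mathcal K$), where $T^n=T_1^{n_1}\cdots T_d^{n_d}$. The Herglotz--Agler class $\mathcal{HA}(\mathbb D^d,\mathcal L(\mathcal U))$ consists of all holomorphic $F\colon\mathbb D^d\to\mathcal L(\mathcal U)$ such that $F(T)+F(T)^*\ge0$ for all commutative $d$-tuples $T$ of strict contractions on $\mathcal K$. A function $K\colon\Omega\times\Omega\to\mathcal L(\mathcal U)$ is a positive kernel on $\Omega$ if there are a Hilbert space $\mathcal H$ and a function $H\colon\Omega\to\mathcal L(\mathcal U,\mathcal H)$ with $K(\omega,\zeta)=H(\omega)^*H(\zeta)$ for all $\omega,\zeta\in\Omega$. A $d$-fold spectral decomposition of $I_{\mathcal X}$ is a $d$-tuple $(P_1,\dots,P_d)$ of orthogonal projections on $\mathcal X$ (necessarily with pairwise orthogonal ranges) with $P_1+\cdots+P_d=I_{\mathcal X}$. *)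

(* Defs.v *)
From HB Require Import structures.
From mathcomp Require Import all_boot all_order all_algebra finmap complex.
From mathcomp Require Import all_classical all_reals all_analysis.
From mathcomp Require Import summability.

Set Implicit Arguments.
Unset Strict Implicit.
Unset Printing Implicit Defensive.

Import Order.TTheory GRing.Theory Num.Theory.
Import numFieldNormedType.Exports.

Local Open Scope classical_set_scope.
Local Open Scope ring_scope.

(* real_closed's R[i] comes without a topology; this is the one induced by the
   modulus. *)
HB.instance Definition _ (R : realType) := NormedModule.copy R[i] R[i]^o.

Section BoundedOperators.
Context {R : realType} (U V : normedModType R[i]).

Definition is_bounded_op (f : U -> V) : Prop :=
  linear f /\ exists M : R, forall x, `|f x| <= M%:C%C * `|x|.

Definition bounded_op_pred : {pred U -> V} := [pred f | `[< is_bounded_op f >]].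

Record bounded_op := BoundedOp {
  op_fun :> U -> V;
  op_funP : op_fun \in bounded_op_pred }.

HB.instance Definition _ := [isSub for op_fun].
HB.instance Definition _ := [Choice of bounded_op by <:].

Lemma opP (A : bounded_op) : is_bounded_op A.
Proof. by case: A => f fP; exact/asboolP. Qed.

Lemma op_linear (A : bounded_op) : linear A.
Proof. by case: (opP A). Qed.

HB.instance Definition _ (A : bounded_op) :=
  GRing.isLinear.Build R[i] U V _ A (op_linear A).

Lemma bounded_op_submod_closed : submod_closed bounded_op_pred.
Proof.
split.
  apply/asboolP; split=> [a x y|].
    by rewrite -[LHS]/(0 : V) -[X in _ *: X + _]/(0 : V) scaler0 add0r.
  by exists 0 => x; rewrite -[X in `|X|]/(0 : V) normr0 mul0r.
move=> a f g /asboolP[lf [M bf]] /asboolP[lg [N bg]]; apply/asboolP.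
have fgE x : (a *: f + g) x = a *: f x + g x by [].
split=> [b x y|].
  rewrite !fgE lf lg !scalerDr !scalerA [a * b]mulrC.
  by rewrite addrACA.
exists (complex.Re `|a| * M + N) => x.
rewrite fgE (le_trans (ler_normD _ _))// rmorphD rmorphM/= mulrDl.
rewrite lerD// normrZ -mulrA [X in _ <= X * _](_ : _ = `|a|) ?ler_wpM2l//.
Qed.

HB.instance Definition _ :=
  GRing.isSubmodClosed.Build _ _ bounded_op_pred bounded_op_submod_closed.
HB.instance Definition _ := [SubChoice_isSubLmodule of bounded_op by <:].

Lemma op_addE (A B : bounded_op) x : (A + B) x = A x + B x.
Proof. by []. Qed.

Lemma op_scaleE a (A : bounded_op) x : (a *: A) x = a *: A x.
Proof. by []. Qed.

Definition op_bounds (A : bounded_op) : set R :=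
  [set M | 0 <= M /\ forall x, `|A x| <= M%:C%C * `|x|].

Definition op_norm (A : bounded_op) : R[i] := (inf (op_bounds A))%:C%C.

Lemma op_bounds_neq0 (A : bounded_op) : op_bounds A !=set0.
Proof.
have [_ [M AM]] := opP A; exists `|M|; split=> // x.
by rewrite (le_trans (AM x))// ler_wpM2r// lecR ler_norm.
Qed.

Lemma op_bounds_has_inf (A : bounded_op) : has_inf (op_bounds A).
Proof. by split; [exact: op_bounds_neq0 | exists 0 => M []]. Qed.

Lemma op_normP (A : bounded_op) x : `|A x| <= op_norm A * `|x|.
Proof.
have [->|x0] := eqVneq x 0; first by rewrite linear0 !normr0 mulr0.
have xgt0 : 0 < `|x| by rewrite normr_gt0.
rewrite -ler_pdivrMr// /op_norm.
have /eqP qE : `|A x| / `|x| == (complex.Re (`|A x| / `|x|))%:C%C.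
  by rewrite eq_complex /= eqxx /=; apply/eqP/ger0_Im; rewrite divr_ge0.
rewrite qE lecR; apply: lb_le_inf; first exact: op_bounds_neq0.
move=> M [M0 AM]; rewrite -lecR -qE ler_pdivrMr//; exact: AM.
Qed.

Lemma op_norm_le (A : bounded_op) (M : R) :
  0 <= M -> (forall x, `|A x| <= M%:C%C * `|x|) -> op_norm A <= M%:C%C.
Proof.
by move=> M0 AM; rewrite lecR; apply: ge_inf; [exists 0 => ? []|].
Qed.

Lemma op_norm_ge0 (A : bounded_op) : 0 <= op_norm A.
Proof.
by rewrite ler0c; apply: lb_le_inf => [|? []//]; exact: op_bounds_neq0.
Qed.

Lemma op_normD A B : op_norm (A + B) <= op_norm A + op_norm B.
Proof.
rewrite -rmorphD; apply: op_norm_le => [|x].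
  by rewrite -ler0c rmorphD addr_ge0 ?op_norm_ge0.
by rewrite op_addE (le_trans (ler_normD _ _))// rmorphD mulrDl lerD ?op_normP.
Qed.

Lemma op_normZ_le a (A : bounded_op) : op_norm (a *: A) <= `|a| * op_norm A.
Proof.
have aE : `|a| = (complex.Re `|a|)%:C%C by [].
rewrite aE -rmorphM; apply: op_norm_le => [|x].
  by rewrite -ler0c rmorphM/= -aE mulr_ge0 ?op_norm_ge0.
by rewrite op_scaleE normrZ rmorphM/= -aE -mulrA ler_wpM2l// op_normP.
Qed.

Lemma op_norm0 (A : bounded_op) : op_norm A = 0 -> A = 0.
Proof.
move=> A0; apply/val_inj/funext => x; apply/eqP; rewrite -normr_le0.
by rewrite (le_trans (op_normP A x))// A0 mul0r.
Qed.

Lemma op_normZ a (A : bounded_op) : op_norm (a *: A) = `|a| * op_norm A.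
Proof.
have [->|a0] := eqVneq a 0.
  rewrite scale0r normr0 mul0r; apply/eqP; rewrite eq_le op_norm_ge0 andbT.
  by apply: (@op_norm_le _ 0) => // x; rewrite normr0 mul0r.
apply/eqP; rewrite eq_le op_normZ_le/= -ler_pdivlMl ?normr_gt0// -normfV.
by rewrite -{1}[A]scale1r -(mulVf a0) -scalerA op_normZ_le.
Qed.

HB.instance Definition _ :=
  Lmodule_isNormed.Build R[i] bounded_op op_normD op_normZ op_norm0.

End BoundedOperators.

Lemma op_id_subproof (R : realType) (U : normedModType R[i]) :
  (id : U -> U) \in @bounded_op_pred R U U.
Proof. by apply/asboolP; split=> //; exists 1 => x; rewrite mul1r. Qed.

Definition op_id (R : realType) (U : normedModType R[i]) : bounded_op U U :=
  BoundedOp (op_id_subproof U).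

Lemma op_comp_subproof (R : realType) (U V W : normedModType R[i])
    (A : bounded_op V W) (B : bounded_op U V) :
  A \o B \in @bounded_op_pred R U W.
Proof.
apply/asboolP; split=> [a x y|]; first by rewrite /= !linearP.
have [M [M0 AM]] := op_bounds_neq0 A; have [N [N0 BN]] := op_bounds_neq0 B.
exists (M * N) => x; rewrite (le_trans (AM _))// rmorphM -mulrA.
by rewrite ler_wpM2l ?ler0c.
Qed.

Definition op_comp (R : realType) (U V W : normedModType R[i])
    (A : bounded_op V W) (B : bounded_op U V) : bounded_op U W :=
  BoundedOp (op_comp_subproof A B).

Notation "A *o B" := (op_comp A B) (at level 40, left associativity).

Definition op_exp (R : realType) (U : normedModType R[i])
    (A : bounded_op U U) (n : nat) : bounded_op U U :=
  iter n (op_comp A) (op_id U).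

(* By the bounded inverse theorem, for complete U and V this is the inverse
   in the set-theoretic sense as well; the value at a non-invertible A is 0. *)
Definition op_inv (R : realType) (U V : normedModType R[i])
    (A : bounded_op U V) : bounded_op V U :=
  xget 0 [set B : bounded_op V U | B *o A = op_id U /\ A *o B = op_id V].

(* The inner product is linear in its first argument and conjugate-linear in
   the second one. *)
HB.mixin Record isHilbert (R : realType) V & CompleteNormedModule R[i] V := {
  inner : {hermitian V for false & (@Num.conj R[i])};
  norm_inner : forall x : V, `|x| ^+ 2 = inner x x
}.

#[short(type="hilbertType")]
HB.structure Definition Hilbert (R : realType) :=
  {V of isHilbert R V & CompleteNormedModule R[i] V}.

(* The adjoint exists by the Riesz representation theorem and is unique, so
   the default value 0 is never used. *)
Definition adjoint (R : realType) (U V : hilbertType R)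
    (A : bounded_op U V) : bounded_op V U :=
  xget 0 [set B : bounded_op V U | forall x y, inner (A x) y = inner x (B y)].

Notation "A ^*o" := (adjoint A) (at level 2, format "A ^*o").

Definition op_ge0 (R : realType) (U : hilbertType R) (A : bounded_op U U) :=
  forall x, 0 <= inner (A x) x.

Definition orthogonal_projection (R : realType) (X : hilbertType R)
    (P : bounded_op X X) :=
  P *o P = P /\ P^*o = P.

Definition spectral_decomposition (R : realType) (X : hilbertType R) d
    (P : 'I_d -> bounded_op X X) :=
  (forall k, orthogonal_projection (P k)) /\ \sum_(k < d) P k = op_id X.

Definition separable (T : topologicalType) :=
  exists S : set T, countable S /\ dense S.

Definition finite_dimensional (K : pzRingType) (V : lmodType K) :=
  exists n (e : 'I_n -> V), forall v, exists c : 'I_n -> K,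
    v = \sum_(i < n) c i *: e i.

(* The Hilbert space tensor product, given by the properties that determine it
   up to a unitary isomorphism compatible with the elementary tensors. *)
Record hilbert_tensor (R : realType) (U K : hilbertType R) := HilbertTensor {
  tensor_space :> hilbertType R;
  tensor : {bilinear U -> K -> tensor_space};
  inner_tensor : forall u u' x x',
    inner (tensor u x) (tensor u' x') = inner u u' * inner x x';
  dense_tensor : dense [set w : tensor_space |
    exists s : seq (U * K), w = \sum_(p <- s) tensor p.1 p.2] }.

(* A (x) B exists and is unique for all bounded A and B, so the default value
   0 is never used. *)
Definition tensor_op (R : realType) (U K : hilbertType R)
    (UK : hilbert_tensor U K) (A : bounded_op U U) (B : bounded_op K K) :
    bounded_op UK UK :=
  xget 0 [set Y : bounded_op UK UK | forall u x,
    Y (tensor UK u x) = tensor UK (A u) (B x)].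

Section Polydisk.
Context {R : realType} {d : nat}.

Definition polydisk : set 'rV[R[i]]_d := [set z | forall k, `|z 0 k| < 1].

Definition multiindex : choiceType := {ffun 'I_d -> nat}.

Definition monomial (z : 'rV[R[i]]_d) (n : multiindex) : R[i] :=
  \prod_(k < d) z 0 k ^+ n k.

Definition op_monomial (V : normedModType R[i]) (T : 'I_d -> bounded_op V V)
    (n : multiindex) : bounded_op V V :=
  \big[@op_comp _ V V V / op_id V]_(k < d) op_exp (T k) (n k).

Definition pencil (X : hilbertType R) (P : 'I_d -> bounded_op X X)
    (z : 'rV[R[i]]_d) : bounded_op X X :=
  \sum_(k < d) z 0 k *: P k.

(* Complex Frechet differentiability in the operator norm. *)
Definition holomorphic_on_polydisk (W : normedModType R[i])
    (F : 'rV[R[i]]_d -> W) :=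
  forall z, polydisk z -> differentiable F z.

(* Sums over multi-indices are limits of the net of finite partial sums. *)
Definition is_taylor_expansion (W : normedModType R[i])
    (F : 'rV[R[i]]_d -> W) (c : multiindex -> W) :=
  forall z, polydisk z ->
    partial_sum (fun n => monomial z n *: c n) @ totally --> F z.

Definition commuting_strict_contractions (V : normedModType R[i])
    (T : 'I_d -> bounded_op V V) :=
  (forall j k, T j *o T k = T k *o T j) /\ (forall k, `|T k| < 1).

(* FT is the strongly convergent sum of the c_n (x) T^n. *)
Definition is_functional_calculus (U K : hilbertType R)
    (UK : hilbert_tensor U K) (c : multiindex -> bounded_op U U)
    (T : 'I_d -> bounded_op K K) (FT : bounded_op UK UK) :=
  forall w : UK,
    partial_sum (fun n => tensor_op UK (c n) (op_monomial T n) w) @ totally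
      --> FT w.

Arguments is_functional_calculus {U K} UK c T FT.

Definition herglotz_agler (U K : hilbertType R) (UK : hilbert_tensor U K)
    (F : 'rV[R[i]]_d -> bounded_op U U) :=
  holomorphic_on_polydisk F /\
  exists c, is_taylor_expansion F c /\
    forall T : 'I_d -> bounded_op K K, commuting_strict_contractions T ->
      exists FT, is_functional_calculus UK c T FT /\ op_ge0 (FT + FT^*o).

End Polydisk.

Arguments polydisk {R} d.

Definition positive_kernel (R : realType) (T : Type) (Omega : set T)
    (U : hilbertType R) (k : T -> T -> bounded_op U U) :=
  exists (H : hilbertType R) (h : T -> bounded_op U H),
    forall w z, Omega w -> Omega z -> k w z = (h w)^*o *o h z.

(* Main.v *)
Require Import Defs.
From HB Require Import structures.
From mathcomp Require Import all_boot all_order all_algebra complex finmap.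
From mathcomp Require Import all_classical all_reals all_analysis.
From mathcomp Require Import summability ring lra.

(** Why the three conditions are equivalent. Write [S(z)] for [(I - P(z)A)^-1],
    and [X*] for the adjoint of [X].

    A colligation gives kernels. The relations between the blocks turn the
    realisation formula into [F = D - C C* + C S C* ], and because [A] is isometric
    the Herglotz sum [F(w)* + F(z)] collapses to the sum of the
    [(1 - conj w_k z_k) (P_k A S(w) C* )* (P_k A S(z) C* )] ([transfer_herglotz]).

    Kernels give a colligation, by the lurking isometry argument. If the kernels are
    [H_k(w)* H_k(z)] and [H(z)] is the column of the [H_k(z)], comparing the
    decomposition with its instances at the origin shows that
    [P(z)H(z)u |-> (H(z) - H(0))u] preserves inner products. It extends to a partial
    isometry, which is a corner of a unitary operator [A] on the doubled space
    ([halmos_unitary], [lurking_isometry], [agler_colligation]). The argument works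
    over any set of points that contains the origin.

    A colligation gives membership in the Herglotz-Agler class
    ([transfer_herglotz_agler]). The coefficients [Q_n] of [S(z) = sum_n z^n Q_n] are
    contractions ([rnorm_res_coef]), so that the series of [F(T)] converges
    absolutely for strict contractions. For [w = sum_i u_i (x) x_i], the vector
    [g = sum_n sum_i Q_n C* u_i (x) T^n x_i] satisfies [g = v + E g], where [v] is
    the term [n = 0] and [E = sum_k P_k A (x) T_k] is a contraction; then
    [2 Re <F(T) w, w> = |g|^2 - |E g|^2 >= 0]. The tensor product of the state space
    with [K] is not constructed: countably many of its vectors occur, and a positive
    kernel on a countable set is the Gram kernel of vectors of [K]
    ([psd_factor_countable]), on which operators are defined by [op_extension].

    Membership in the class gives kernels. Fix finitely many points [z_a] and
    vectors [u_a], and let [kappa] be the matrix of the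
    [<F(z_a) u_a, u_b> + <u_a, F(z_b) u_b>]. If [kappa] were not approximable by sums
    of [(1 - z_aj conj z_bj) k_j(a, b)] with positive [k_j], the residual of least norm
    would provide a matrix [G] such that all [(1 - z_aj conj z_bj) G(a, b)] are
    positive and [Re sum kappa G < 0] ([cone_approx]). Such a [G] is itself positive
    ([dual_psd]), hence a Gram matrix of vectors [x_a] of [K], and [T_j x_a = z_aj x_a]
    defines commuting contractions; testing [F] on [rho T] and [sum_a u_a (x) x_a],
    with [rho] tending to [1], gives [Re sum kappa G >= 0] ([dual_test]). An ultralimit
    leads from finite sets to a countable dense set of points and vectors
    ([kernels_nat]). There the kernels are factored by operators
    ([agler_operators]), so that a colligation realises [F] on the dense set of points;
    its transfer function and [F] are continuous, hence equal on the polydisk, and the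
    kernels of the colligation decompose [F]. *)

Set Implicit Arguments.
Unset Strict Implicit.
Unset Printing Implicit Defensive.

Import Order.TTheory GRing.Theory Num.Theory.
Import numFieldNormedType.Exports.

Local Open Scope classical_set_scope.
Local Open Scope ring_scope.

(** * Real norms and inner products *)

Section RealNorm.
Context {R : realType}.
Local Notation C := R[i].

(** Norms take values in [R[i]], where they are real but subject to a partial
    order; the real part is what real arithmetic can handle. *)
Definition rnorm (V : normedModType C) (x : V) : R := complex.Re `|x|.

Section NormedModule.
Context {V : normedModType C}.
Implicit Types x y : V.

Lemma rnormE x : `|x| = (rnorm x)%:C%C.
Proof. by rewrite /rnorm RRe_real// ger0_real. Qed.

Lemma rnorm_ge0 x : 0 <= rnorm x.
Proof. by rewrite -ler0c -rnormE. Qed.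

Lemma rnorm0 : rnorm (0 : V) = 0.
Proof. by rewrite /rnorm normr0. Qed.

Lemma rnorm_eq0 x : rnorm x = 0 -> x = 0.
Proof. by move=> x0; apply/normr0_eq0; rewrite rnormE x0. Qed.

Lemma rnormN x : rnorm (- x) = rnorm x.
Proof. by rewrite /rnorm normrN. Qed.

Lemma rnormB x y : rnorm (x - y) = rnorm (y - x).
Proof. by rewrite -rnormN opprB. Qed.

Lemma rnormD x y : rnorm (x + y) <= rnorm x + rnorm y.
Proof. by rewrite -lecR rmorphD/= -!rnormE ler_normD. Qed.

Lemma rnorm_tri x y z : rnorm (x - z) <= rnorm (x - y) + rnorm (z - y).
Proof. by rewrite (rnormB z) (le_trans _ (rnormD _ _))// addrA subrK. Qed.

Lemma rnormZ (a : C) x : rnorm (a *: x) = rnorm a * rnorm x.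
Proof. by apply: complexI; rewrite rmorphM/= -!rnormE normrZ. Qed.

Lemma rnorm_sum (I : Type) (r : seq I) (P : pred I) (F : I -> V) :
  rnorm (\sum_(i <- r | P i) F i) <= \sum_(i <- r | P i) rnorm (F i).
Proof.
elim/big_ind2 : _ => //; first by rewrite rnorm0.
by move=> x1 x2 y1 y2 h1 h2; rewrite (le_trans (rnormD _ _))// lerD.
Qed.

Lemma rcvgP (T : Type) (F : set_system T) (FF : Filter F) (f : T -> V) (l : V) :
  f @ F --> l <-> forall e : R, 0 < e -> \forall t \near F, rnorm (l - f t) < e.
Proof.
split=> [/cvgrPdist_lt fl e e0|fl].
  by have := fl e%:C%C; rewrite ltcR => /(_ e0); apply: filterS => t;
    rewrite rnormE ltcR.
apply/cvgrPdist_lt => e e0.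
have eE : e = (complex.Re e)%:C%C by rewrite RRe_real// gtr0_real.
rewrite eE in e0 *; rewrite ltcR in e0.
by apply: filterS (fl _ e0) => t; rewrite rnormE ltcR.
Qed.

Lemma rcvg_le (T : Type) (F : set_system T) (FF : ProperFilter F) (f : T -> V)
    (l : V) (M : R) :
  f @ F --> l -> (\forall t \near F, rnorm (f t) <= M) -> rnorm l <= M.
Proof.
move=> /rcvgP fl fM; rewrite leNgt; apply/negP => Ml.
have e0 : 0 < rnorm l - M by rewrite subr_gt0.
near F => t.
have h1 : rnorm (l - f t) < rnorm l - M by near: t; exact: fl.
have h2 : rnorm (f t) <= M by near: t.
have := rnormD (l - f t) (f t); rewrite subrK; lra.
Unshelve. all: by end_near. Qed.

Lemma rcvg_uniq (T : Type) (F : set_system T) (FF : ProperFilter F) (f : T -> V)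
    (l l' : V) : f @ F --> l -> f @ F --> l' -> l = l'.
Proof.
move=> /rcvgP fl /rcvgP fl'; apply/eqP; rewrite -subr_eq0; apply/eqP/rnorm_eq0.
apply/eqP; rewrite eq_le rnorm_ge0 andbT leNgt; apply/negP => e0.
have e1 : 0 < rnorm (l - l') / 2 by rewrite divr_gt0.
near F => t.
have h1 : rnorm (l - f t) < rnorm (l - l') / 2 by near: t; exact: fl.
have h2 : rnorm (l' - f t) < rnorm (l - l') / 2 by near: t; exact: fl'.
have := rnormD (l - f t) (f t - l'); rewrite addrA subrK [rnorm (f t - l')]rnormB.
lra.
Unshelve. all: by end_near. Qed.

End NormedModule.

Section Operators.
Context {V W : normedModType C}.
Implicit Types x y : V.

Lemma rnorm_op (A : bounded_op V W) x : rnorm (A x) <= rnorm A * rnorm x.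
Proof. by rewrite -lecR rmorphM/= -!rnormE; exact: (op_normP A x). Qed.

Lemma rnorm_op_le (A : bounded_op V W) (M : R) :
  0 <= M -> (forall x, rnorm (A x) <= M * rnorm x) -> rnorm A <= M.
Proof.
move=> M0 AM; rewrite -lecR -rnormE; apply: op_norm_le => // x.
by rewrite !rnormE -rmorphM/= lecR.
Qed.

Lemma op_ext (A B : bounded_op V W) : (forall x, A x = B x) -> A = B.
Proof. by move=> AB; apply/val_inj/funext. Qed.

Lemma op_intro (f : V -> W) (M : R) : linear f ->
  (forall x, rnorm (f x) <= M * rnorm x) ->
  exists A : bounded_op V W, forall x, A x = f x.
Proof.
move=> lf fM; have fP : f \in @bounded_op_pred R V W.
  apply/asboolP; split=> //; exists M => x.
  by rewrite !rnormE -rmorphM/= lecR.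
by exists (BoundedOp fP).
Qed.

Lemma rcvg_op (A : bounded_op V W) (T : Type) (F : set_system T)
    (FF : Filter F) (f : T -> V) (l : V) :
  f @ F --> l -> (fun t => A (f t)) @ F --> A l.
Proof.
move=> /rcvgP fl; apply/rcvgP => e e0.
have e1 : 0 < e / (rnorm A + 1) by rewrite divr_gt0// ltr_wpDl ?rnorm_ge0.
apply: filterS (fl _ e1) => t.
rewrite ltr_pdivlMr ?ltr_wpDl ?rnorm_ge0// => lt_e.
rewrite -linearB; apply: le_lt_trans (rnorm_op _ _) _.
have := rnorm_ge0 (l - f t); nra.
Qed.

End Operators.

Lemma rnorm_real (a : R) : rnorm (a%:C%C : C) = `|a|.
Proof. by apply: complexI; rewrite -rnormE -[LHS]/(`|a%:C%C : C|) normc_def /=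
  expr0n/= addr0 sqrtr_sqr. Qed.

Lemma rnormM (a b : C) : rnorm (a * b) = rnorm a * rnorm b.
Proof. by rewrite -rnormZ. Qed.

Lemma rnorm_conj (a : C) : rnorm (Num.conj a : C) = rnorm a.
Proof. by rewrite /rnorm -[LHS]/(complex.Re `|Num.conj a|) norm_conjC. Qed.

Lemma Re_le_rnorm (a : C) : `|complex.Re a| <= rnorm a.
Proof.
by rewrite -lecR -rnormE; exact: normc_ge_Re.
Qed.

Lemma sqr_rnorm (a : C) : rnorm a ^+ 2 = complex.Re a ^+ 2 + complex.Im a ^+ 2.
Proof.
apply: complexI; rewrite rmorphXn/= -rnormE.
by rewrite add_Re2_Im2.
Qed.

Lemma rnorm_le_ReIm (a : C) : rnorm a <= `|complex.Re a| + `|complex.Im a|.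
Proof.
rewrite -(@ler_pXn2r _ 2)// ?nnegrE ?rnorm_ge0 ?addr_ge0//.
rewrite sqr_rnorm sqrrD !real_normK ?num_real// -addrA lerD2l lerDr.
by rewrite mulrn_wge0// mulr_ge0.
Qed.

(** The order of [R[i]] is partial, so that real and imaginary parts of the limit
    are treated separately. *)
Lemma ge0_cvg (T : Type) (G : set_system T) (FG : ProperFilter G) (f : T -> C) (l : C) :
  f @ G --> l -> (forall t, 0 <= f t) -> 0 <= l.
Proof.
move=> /rcvgP fl f0.
have close e : 0 < e -> - e < complex.Re l /\ `|complex.Im l| < e.
  move=> e0; have [t /= lt_t] := filter_ex (fl e e0).
  have h1 := le_lt_trans (Re_le_rnorm _) lt_t.
  have h2 : `|complex.Im (l - f t)| < e.
    apply: le_lt_trans lt_t; rewrite -(@ler_pXn2r _ 2)// ?nnegrE ?rnorm_ge0//.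
    by rewrite sqr_rnorm real_normK ?num_real// lerDr sqr_ge0.
  have := f0 t; move: h1 h2; case: (f t) => a b; case: (l) => x y.
  rewrite /= lecE /= => h1 h2 /andP[/eqP b0 a0]; rewrite b0 subr0 in h2; split=> //.
  by move: h1; rewrite ltr_norml => /andP[h _]; lra.
rewrite lecE /=; apply/andP; split.
  rewrite -normr_le0 leNgt; apply/negP => h.
  by have [_] := close _ h; rewrite ltxx.
rewrite leNgt; apply/negP => h.
have h' : 0 < - complex.Re l by rewrite oppr_gt0.
by have [] := close _ h'; rewrite opprK ltxx.
Qed.

(** Completeness in the form used below: the real radius avoids handling
    positive complex numbers. *)
Lemma rcauchy_cvg (V : completeNormedModType C) (T : Type) (F : set_system T)
    (FF : ProperFilter F) (f : T -> V) :
  (forall e : R, 0 < e -> exists A : set T, F A /\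
    forall s t, A s -> A t -> rnorm (f s - f t) < e) ->
  exists l : V, f @ F --> l.
Proof.
move=> fF; suff : cvg (f @ F) by move=> /cvg_ex[l fl]; exists l.
apply: cauchy_cvg; apply/cauchyP => e e0.
have eE : e = (complex.Re e)%:C%C by rewrite RRe_real// gtr0_real.
rewrite eE in e0 *; rewrite ltcR in e0.
have [A [FA fA]] := fF _ e0.
have [s As] := filter_ex FA.
exists (f s); rewrite /fmap /=; change (F (f @^-1` ball (f s) (complex.Re e)%:C%C)).
apply: filterS FA => t At /=.
rewrite -ball_normE /ball_/= rnormE ltcR; exact: fA.
Qed.

End RealNorm.

Section InnerProduct.
Context {R : realType} {V : hilbertType R}.
Local Notation C := R[i].
Implicit Types x y z : V.

Lemma ipDl x y z : inner (x + y) z = inner x z + inner y z.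
Proof. by rewrite linearDl. Qed.
Lemma ipDr x y z : inner x (y + z) = inner x y + inner x z.
Proof. by rewrite linearDr. Qed.
Lemma ipNl x y : inner (- x) y = - inner x y.
Proof. by rewrite linearNl. Qed.
Lemma ipNr x y : inner x (- y) = - inner x y.
Proof. by rewrite linearNr. Qed.
Lemma ipBl x y z : inner (x - y) z = inner x z - inner y z.
Proof. by rewrite ipDl ipNl. Qed.
Lemma ipBr x y z : inner x (y - z) = inner x y - inner x z.
Proof. by rewrite ipDr ipNr. Qed.
Lemma ipZl (a : C) x y : inner (a *: x) y = a * inner x y.
Proof. by rewrite linearZl_LR. Qed.
Lemma ipZr (a : C) x y : inner x (a *: y) = Num.conj a * inner x y.
Proof. by rewrite linearZr_LR. Qed.
Lemma ip0l x : inner 0 x = 0.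
Proof. by rewrite linear0l. Qed.
Lemma ip0r x : inner x 0 = 0.
Proof. by rewrite linear0r. Qed.
Lemma ipC x y : inner x y = Num.conj (inner y x).
Proof. by rewrite hermC expr0 mul1r. Qed.
Lemma ip_suml (I : Type) (r : seq I) (P : pred I) (F : I -> V) x :
  inner (\sum_(i <- r | P i) F i) x = \sum_(i <- r | P i) inner (F i) x.
Proof. by elim/big_ind2: _ => [|? ? ? ? <- <-|//]; rewrite ?ip0l ?ipDl. Qed.
Lemma ip_sumr (I : Type) (r : seq I) (P : pred I) (F : I -> V) x :
  inner x (\sum_(i <- r | P i) F i) = \sum_(i <- r | P i) inner x (F i).
Proof. by elim/big_ind2: _ => [|? ? ? ? <- <-|//]; rewrite ?ip0r ?ipDr. Qed.

Definition ipE := (ipDl, ipDr, ipNl, ipNr, ipZl, ipZr, ip0l, ip0r).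

Definition rip x y : R := complex.Re (inner x y).

Lemma cRe_conj (a : C) : complex.Re (Num.conj a) = complex.Re a.
Proof. by case: a. Qed.
Lemma cReD (a b : C) : complex.Re (a + b) = complex.Re a + complex.Re b.
Proof. by case: a b => ? ? []. Qed.
Lemma cReN (a : C) : complex.Re (- a) = - complex.Re a.
Proof. by case: a. Qed.
Lemma cReZ (a : R) (b : C) : complex.Re (a%:C%C * b) = a * complex.Re b.
Proof. by case: b => b1 b2 /=; rewrite mul0r subr0. Qed.

Lemma ripC x y : rip x y = rip y x.
Proof. by rewrite /rip ipC cRe_conj. Qed.
Lemma ripDl x y z : rip (x + y) z = rip x z + rip y z.
Proof. by rewrite /rip ipDl cReD. Qed.
Lemma ripDr x y z : rip x (y + z) = rip x y + rip x z.
Proof. by rewrite /rip ipDr cReD. Qed.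
Lemma ripNl x y : rip (- x) y = - rip x y.
Proof. by rewrite /rip ipNl cReN. Qed.
Lemma ripNr x y : rip x (- y) = - rip x y.
Proof. by rewrite /rip ipNr cReN. Qed.
Lemma ripZl (a : R) x y : rip (a%:C%C *: x) y = a * rip x y.
Proof. by rewrite /rip ipZl cReZ. Qed.
Lemma ripZr (a : R) x y : rip x (a%:C%C *: y) = a * rip x y.
Proof. by rewrite ripC ripZl ripC. Qed.

Definition ripE := (ripDl, ripDr, ripNl, ripNr, ripZl, ripZr).

Lemma ip_self x : inner x x = (rnorm x ^+ 2)%:C%C.
Proof. by rewrite -norm_inner rnormE rmorphXn. Qed.

Lemma rip_self x : rip x x = rnorm x ^+ 2.
Proof. by rewrite /rip ip_self. Qed.

Lemma ip_self_eq0 x : inner x x = 0 -> x = 0.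
Proof.
by move/eqP; rewrite -norm_inner expf_eq0/= normr_eq0 => /eqP.
Qed.

Lemma rnorm_sqD x y : rnorm (x + y) ^+ 2 = rnorm x ^+ 2 + 2 * rip x y + rnorm y ^+ 2.
Proof. by rewrite -!rip_self !ripE (ripC y x); lra. Qed.

Lemma ip_CS x y : rnorm (inner x y : C) <= rnorm x * rnorm y.
Proof.
have [->|y0] := eqVneq y 0.
  by rewrite ip0r rnorm0 mulr_ge0 ?rnorm_ge0.
have ny : 0 < rnorm y.
  by rewrite lt_def rnorm_ge0 andbT; apply: contra_neq y0; exact: rnorm_eq0.
rewrite -(@ler_pXn2r _ 2)// ?nnegrE ?mulr_ge0 ?rnorm_ge0//.
set a := inner x y.
pose t := (rnorm y ^+ 2)%:C%C : C.
have h : 0 <= inner (t *: x - a *: y) (t *: x - a *: y).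
  by rewrite ip_self ler0c sqr_ge0.
have tE : Num.conj t = t by apply: conjc_real.
have aa : a * Num.conj a = (rnorm a ^+ 2)%:C%C.
  by rewrite -normCK rmorphXn/= -rnormE.
move: h; rewrite !ipE (ipC y x) -/a !ip_self -/t tE.
have -> : t * (t * (rnorm x ^+ 2)%:C%C - Num.conj a * a) -
  (t * (a * Num.conj a) - a * (Num.conj a * t)) =
  t * (t * (rnorm x ^+ 2)%:C%C - a * Num.conj a) by ring.
rewrite aa -!rmorphM/= -rmorphB/= -rmorphM/= ler0c pmulr_rge0 ?exprn_gt0//.
by rewrite subr_ge0 => /le_trans -> //; rewrite exprMn mulrC.
Qed.

Lemma rip_CS x y : `|rip x y| <= rnorm x * rnorm y.
Proof. exact: le_trans (Re_le_rnorm _) (ip_CS _ _). Qed.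

Lemma ip_eq0 x : (forall y, inner x y = 0) -> x = 0.
Proof. by move=> x0; apply: ip_self_eq0. Qed.

Lemma ip_inj x y : (forall z, inner x z = inner y z) -> x = y.
Proof.
move=> xy; apply/eqP; rewrite -subr_eq0; apply/eqP/ip_eq0 => z.
by rewrite ipBl xy subrr.
Qed.

Lemma ip_injr x y : (forall z, inner z x = inner z y) -> x = y.
Proof. by move=> xy; apply: ip_inj => z; rewrite ipC xy -ipC. Qed.

Lemma rcvg_ipl (T : Type) (F : set_system T) (FF : Filter F) (f : T -> V) l y :
  f @ F --> l -> (fun t => inner (f t) y : C) @ F --> (inner l y : C).
Proof.
move=> /rcvgP fl; apply/rcvgP => e e0.
have e1 : 0 < e / (rnorm y + 1) by rewrite divr_gt0// ltr_wpDl ?rnorm_ge0.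
apply: filterS (fl _ e1) => t.
rewrite ltr_pdivlMr ?ltr_wpDl ?rnorm_ge0// => lt_e.
rewrite -ipBl; apply: le_lt_trans (ip_CS _ _) _.
have := rnorm_ge0 (l - f t); nra.
Qed.

End InnerProduct.

(** * Riesz representation *)

(** First-order condition at the minimum [t = 0] of a quadratic polynomial. *)
Lemma quad_ge0_lin (R : realFieldType) (a b : R) :
  (forall t, 0 <= t ^+ 2 * a + 2 * t * b) -> b = 0.
Proof.
move=> h; have a0 : 0 <= a by have := h 1; have := h (-1); lra.
have a1 : 0 < a + 1 by lra.
have h1 := h (- b / (a + 1)).
have E : (- b / (a + 1)) ^+ 2 * a + 2 * (- b / (a + 1)) * b =
   - ((a + 2) * (b / (a + 1)) ^+ 2) by field; rewrite gt_eqF.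
rewrite E oppr_ge0 in h1.
have := sqr_ge0 (b / (a + 1)).
move=> h2; have h3 : (b / (a + 1)) ^+ 2 = 0 by nra.
move/eqP: h3; rewrite sqrf_eq0 mulf_eq0 invr_eq0 (gt_eqF a1) orbF => /eqP//.
Qed.

(** The contradiction in the first-order condition of [riesz_graph]: moving the
    almost minimiser [u] by [t x] would bring the functional below its infimum. *)
Local Lemma step_contra (R : realFieldType) (t X X2 U d m nu rp ru c E s : R) :
  U - 2 * d <= m + nu -> - (s * X * E) <= t * (rp - ru) ->
  E + 2 * s * X * E = - (t ^+ 2 * X2 + 2 * t * (rp - c)) / 2 -> nu < E ->
  m <= t ^+ 2 * X2 + 2 * (t * ru) + U - 2 * (t * c + d) ->
  t ^+ 2 * X2 + 2 * t * (rp - c) < 0 -> False.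
Proof. lra. Qed.

Section Riesz.
Context {R : realType} {X : hilbertType R}.
Local Notation C := R[i].
Variable S : X -> C -> Prop.
Hypothesis S0 : S 0 0.
Hypothesis SP : forall (a : C) x y c d, S x c -> S y d -> S (a *: x + y) (a * c + d).
Variable N : R.
Hypothesis N0 : 0 <= N.
Hypothesis SN : forall x c, S x c -> rnorm c <= N * rnorm x.

Let J (x : X) (c : C) : R := rnorm x ^+ 2 - 2 * complex.Re c.
Let V : set R := [set r | exists x c, S x c /\ r = J x c].

Let V_inf : has_inf V.
Proof.
split; first by exists (J 0 0), 0, 0.
exists (- N ^+ 2) => _ [x [c [Sxc ->]]]; rewrite /J.
have := Re_le_rnorm c; have := SN Sxc; have := ler_norm (complex.Re c).
have := sqr_ge0 (rnorm x - N); nra.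
Qed.

Let m := inf V.

Let J_ge x c : S x c -> m <= J x c.
Proof. by move=> Sxc; apply: ge_inf; [case: V_inf|exists x, c]. Qed.

(** The parallelogram law makes almost minimisers a Cauchy family. *)
Let J_close (x y : X) (c d : C) e : S x c -> S y d ->
  J x c <= m + e -> J y d <= m + e -> rnorm (x - y) ^+ 2 <= 4 * e.
Proof.
move=> Sx Sy Jx Jy.
have Sh : S ((2^-1)%:C%C *: (x + y)) ((2^-1)%:C%C * (c + d)).
  have := SP (2^-1)%:C%C (SP 1 Sx Sy) S0.
  by rewrite !scale1r !mul1r !addr0.
have := J_ge Sh; rewrite /J rnormZ rnorm_real exprMn cReZ cReD real_normK ?num_real//.
move: Jx Jy; rewrite /J (rnorm_sqD x y) (rnorm_sqD x (- y)) rnormN ripNr.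
lra.
Qed.

(** The representing vector of a bounded functional given by its graph on a
    subspace; minimising the quadratic functional [J] needs no closedness of
    that subspace, and locates the vector in its double orthogonal. *)
Lemma riesz_graph : exists p : X,
  [/\ forall x c, S x c -> c = inner x p,
      forall g, (forall x c, S x c -> inner x g = 0) -> inner p g = 0
    & rnorm p <= N].
Proof.
have seqP n : exists xc : X * C, S xc.1 xc.2 /\ J xc.1 xc.2 <= m + n.+1%:R^-1.
  have [_ [x [c [Sxc ->]]] lt_m] : exists2 r, V r & r < m + n.+1%:R^-1.
    by apply: inf_adherent => //; rewrite invr_gt0.
  by exists (x, c); split=> //; exact: ltW.
have [u uP] := choice seqP.
have [p up] : exists p : X, (fun n => (u n).1) @ \oo --> p.
  apply: rcauchy_cvg => e e0.
  have e4 : 0 < e ^+ 2 / 8 by rewrite divr_gt0 ?exprn_gt0.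
  exists [set n | (n.+1%:R^-1 : R) < e ^+ 2 / 8]; split.
    exact: (near_infty_natSinv_lt (PosNum e4)).
  move=> i j /= ie je.
  rewrite -(@ltr_pXn2r _ 2)// ?nnegrE ?rnorm_ge0 ?(ltW e0)//.
  have [Si Ji] := uP i; have [Sj Jj] := uP j.
  have h := @J_close _ _ _ _ (e ^+ 2 / 8) Si Sj.
  have : rnorm ((u i).1 - (u j).1) ^+ 2 <= 4 * (e ^+ 2 / 8).
    by apply: h; [apply: le_trans Ji _|apply: le_trans Jj _]; rewrite lerD2l ltW.
  have : 0 < e ^+ 2 by rewrite exprn_gt0.
  lra.
have near_p (e : R) : 0 < e -> exists n, rnorm (p - (u n).1) < e /\
    (n.+1%:R^-1 : R) < e.
  move=> e0; near \oo => n; exists n; split; near: n.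
    by move/rcvgP : up; apply.
  exact: (near_infty_natSinv_lt (PosNum e0)).
(* The real part first: [t] is real here, and the case of complex [c] follows by
   replacing [x] with [i x]. *)
have repr_re x c : S x c -> complex.Re c = rip x p.
  move=> Sxc.
  have h0 : rip p x - complex.Re c = 0.
    apply: (@quad_ge0_lin _ (rnorm x ^+ 2)) => t.
    rewrite leNgt; apply/negP => lt0.
    set D := _ + _ in lt0.
    pose K := 1 + 2 * `|t| * rnorm x.
    have K0 : 0 < K by rewrite /K ltr_wpDr// !mulr_ge0 ?rnorm_ge0.
    have e0 : 0 < - D / (2 * K) by rewrite divr_gt0 ?oppr_gt0// mulr_gt0.
    have [n [n1 n2]] := near_p _ e0.
    have [Sn Jn] := uP n.
    have := J_ge (SP t%:C%C Sxc Sn).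
    rewrite /J rnorm_sqD rnormZ rnorm_real exprMn real_normK ?num_real//.
    rewrite cReD !cReZ ripZl.
    have pn : `|rip x p - rip x (u n).1| <= rnorm x * rnorm (p - (u n).1).
      by have := rip_CS x (p - (u n).1); rewrite !ripE.
    have tpn : `|t * (rip x p - rip x (u n).1)| <=
       `|t| * rnorm x * (- D / (2 * K)).
      rewrite normrM -mulrA ler_wpM2l// (le_trans pn)// ler_wpM2l ?rnorm_ge0//.
      exact: ltW.
    have KD : K * (- D / (2 * K)) = - D / 2 by field; rewrite gt_eqF.
    move: Jn tpn KD n2; rewrite /J /K ler_norml => Jn /andP[tpn _].
    move: tpn; move: (- D / (2 * K) : R) => E tpn; rewrite mulrDl mul1r => KD n2 h.
    rewrite /D (ripC p x) in lt0 KD.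
    exact: (step_contra Jn tpn KD n2 h lt0).
  by rewrite ripC; apply/eqP; rewrite eq_sym -subr_eq0 h0.
have repr x c : S x c -> c = inner x p.
  move=> Sxc; have h1 := repr_re _ _ Sxc.
  have h2 : complex.Re ('i%C * c) = rip ('i%C *: x) p.
    by apply: repr_re; have := SP 'i%C Sxc S0; rewrite !addr0.
  move: h1 h2; rewrite /rip ipZl.
  case: c {Sxc} => c1 c2; case: (inner x p) => d1 d2 /=.
  by rewrite !mul0r !mul1r !sub0r => -> /oppr_inj ->.
(* [p] is a limit of vectors of the domain of [S]. *)
have orth g : (forall x c, S x c -> inner x g = 0) -> inner p g = 0.
  move=> gS; apply/eqP; rewrite -[_ == _]negbK; apply/negP => /eqP pg.
  have pg0 : 0 < rnorm (inner p g : C).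
    by rewrite lt_def rnorm_ge0 andbT; apply/eqP => /rnorm_eq0.
  have e0 : 0 < rnorm (inner p g : C) / (rnorm g + 1).
    by rewrite divr_gt0// ltr_wpDl ?rnorm_ge0.
  have [n [n1 _]] := near_p _ e0.
  have := ip_CS (p - (u n).1) g; rewrite ipBl (gS _ _ (uP n).1) subr0.
  move: n1; rewrite ltr_pdivlMr ?ltr_wpDl ?rnorm_ge0//.
  have := rnorm_ge0 (p - (u n).1); nra.
exists p; split=> //.
rewrite leNgt; apply/negP => Np.
have p0 : 0 < rnorm p by exact: le_lt_trans Np.
have e0 : 0 < rnorm p * (rnorm p - N) / (N + rnorm p + 1).
  by rewrite divr_gt0 ?mulr_gt0 ?subr_gt0// ltr_wpDl// addr_ge0// rnorm_ge0.
have [n [n1 _]] := near_p _ e0.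
have h1 := SN (uP n).1; rewrite (repr _ _ (uP n).1) in h1.
have h2 := le_trans (ler_norm _) (Re_le_rnorm (inner (u n).1 p : C)).
rewrite -/(rip (u n).1 p) in h2.
have h3 := le_trans (ler_norm _) (rip_CS (p - (u n).1) p).
rewrite ripDl ripNl rip_self in h3.
have h4 := rnormD ((u n).1 - p) p; rewrite subrK rnormB in h4.
have h5 := ler_wpM2l N0 h4.
move: n1; rewrite ltr_pdivlMr; last by rewrite ltr_wpDl// addr_ge0// rnorm_ge0.
have h6 := rnorm_ge0 (p - (u n).1).
move: (rip _ _) (rnorm (inner _ _)) (rnorm (p - _)) (rnorm (u n).1) h1 h2 h3 h5 h6.
move=> r s dl U h1 h2 h3 h5 h6 h7; nra.
Unshelve. all: by end_near. Qed.

End Riesz.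

(** * Adjoints and extension of operators *)

Section Adjoint.
Context {R : realType}.
Local Notation C := R[i].

(** The adjoint is chosen by [xget]; Riesz representation shows that the choice
    is from a nonempty set. *)
Lemma adjP (U V : hilbertType R) (A : bounded_op U V) x y :
  inner (A x) y = inner x (A^*o y).
Proof.
have ex_adj z : exists p : U, (forall u, inner (A u) z = inner u p) /\
    rnorm p <= rnorm A * rnorm z.
  have [|a u v c d -> ->||u c ->|p [pP _ pN]] :=
    @riesz_graph R U (fun u c => c = inner (A u) z) _ _ (rnorm A * rnorm z).
  - by rewrite linear0 ip0l.
  - by rewrite linearP ipDl ipZl.
  - by rewrite mulr_ge0 ?rnorm_ge0.
  - rewrite (le_trans (ip_CS _ _))// mulrAC ler_wpM2r ?rnorm_ge0//.
    exact: rnorm_op.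
  by exists p; split=> // u; exact: (pP u).
have [f fP] := choice ex_adj.
have [|z|B BE] := @op_intro R V U f (rnorm A); last 1 first.
- rewrite /adjoint; case: xgetP => [_ _ -> //|/(_ B)[]].
  by move=> u v; rewrite BE (fP v).1.
- move=> a u v; apply: ip_injr => z.
  by rewrite -(fP _).1 !ipDr !ipZr -!(fP _).1.
- exact: (fP z).2.
Qed.

Section Calculus.
Context {U V : hilbertType R}.
Implicit Types A : bounded_op U V.

Lemma adjPl A x y : inner (A^*o y) x = inner y (A x).
Proof. by rewrite ipC -adjP -ipC. Qed.

Lemma adj_uniq A (B : bounded_op V U) :
  (forall x y, inner (A x) y = inner x (B y)) -> A^*o = B.
Proof. by move=> AB; apply: op_ext => y; apply: ip_injr => x; rewrite -adjP. Qed.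

Lemma adj0 : (0 : bounded_op U V)^*o = 0.
Proof. by apply: adj_uniq => x y; rewrite ip0l ip0r. Qed.

End Calculus.

Lemma adjM (U V W : hilbertType R) (A : bounded_op V W) (B : bounded_op U V) :
  (A *o B)^*o = B^*o *o A^*o.
Proof. by apply: adj_uniq => x y; rewrite /= -!adjP. Qed.

Lemma adjK (U V : hilbertType R) (A : bounded_op U V) : A^*o^*o = A.
Proof. by apply: adj_uniq => x y; rewrite adjPl. Qed.

Lemma rnorm_comp (U V W : normedModType C) (A : bounded_op V W) (B : bounded_op U V) :
  rnorm (A *o B) <= rnorm A * rnorm B.
Proof.
apply: rnorm_op_le => [|x]; first by rewrite mulr_ge0 ?rnorm_ge0.
by rewrite (le_trans (rnorm_op A (B x)))// -mulrA ler_wpM2l ?rnorm_ge0 ?rnorm_op.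
Qed.

Lemma op_sumE (U V : normedModType C) (I : Type) (r : seq I) (P : pred I)
    (F : I -> bounded_op U V) x :
  (\sum_(i <- r | P i) F i) x = \sum_(i <- r | P i) F i x.
Proof. by elim/big_rec2: _ => // i y A _ <-. Qed.

Lemma rnorm_op_id (U : normedModType C) : rnorm (op_id U) <= 1.
Proof. by apply: rnorm_op_le => // x; rewrite mul1r. Qed.

End Adjoint.

Section Extension.
Context {R : realType}.
Local Notation C := R[i].

Definition lcomb (X : lmodType C) (I : Type) (a : I -> X) (s : seq (C * I)) : X :=
  \sum_(p <- s) p.1 *: a p.2.

Definition scale_comb (I : Type) (c : C) (s : seq (C * I)) :=
  [seq (c * p.1, p.2) | p <- s].

Lemma lcombZ (X : lmodType C) (I : Type) (a : I -> X) c s :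
  lcomb a (scale_comb c s) = c *: lcomb a s.
Proof.
by rewrite /lcomb big_map scaler_sumr; apply: eq_bigr => p _; rewrite scalerA.
Qed.

Lemma lcombD (X : lmodType C) (I : Type) (a : I -> X) s t :
  lcomb a (s ++ t) = lcomb a s + lcomb a t.
Proof. by rewrite /lcomb big_cat. Qed.

Lemma lcomb1 (X : lmodType C) (I : Type) (a : I -> X) c i :
  lcomb a [:: (c, i)] = c *: a i.
Proof. by rewrite /lcomb big_seq1. Qed.

(** The adjoint of the wanted operator is given by Riesz representation on the
    span of [a]; this spares the closure of that span and any well-definedness
    argument. *)
Lemma op_extension (X Y : hilbertType R) (I : Type) (a : I -> X) (b : I -> Y)
    (M : R) : 0 <= M ->
  (forall s, rnorm (lcomb b s) <= M * rnorm (lcomb a s)) ->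
  exists V : bounded_op X Y, [/\ forall i, V (a i) = b i,
    forall g, (forall i, inner (a i) g = 0) -> V g = 0 & rnorm V <= M].
Proof.
move=> M0 ba.
have exW y : exists p : X, [/\ forall i, inner (b i) y = inner (a i) p,
    forall g, (forall i, inner (a i) g = 0) -> inner p g = 0
    & rnorm p <= M * rnorm y].
  pose S x c := exists s, x = lcomb a s /\ c = inner (lcomb b s) y.
  have [|c x x' d d' [s [-> ->]] [s' [-> ->]]||x c [s [-> ->]]|p [p1 p2 p3]] :=
    @riesz_graph R X S _ _ (M * rnorm y).
  - by exists [::]; rewrite /lcomb !big_nil ip0l.
  - exists (scale_comb c s ++ s').
    by rewrite !lcombD !lcombZ ipDl ipZl.
  - by rewrite mulr_ge0 ?rnorm_ge0.
  - by rewrite (le_trans (ip_CS _ _))// mulrAC ler_wpM2r ?rnorm_ge0.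
  exists p; split=> // [i|g ag].
  - by apply: (p1 (a i)); exists [:: (1, i)]; rewrite !lcomb1 !scale1r.
  - apply: p2 => x c [s [-> _]]; rewrite ip_suml big1// => q _.
    by rewrite ipZl ag mulr0.
(* [f] is the adjoint of the wanted operator; its values are uniquely determined
   by their inner products with the [a i] and by membership in the double
   orthogonal of the family, whence linearity. *)
have [f fP] := choice exW.
have [|z|W WE] := @op_intro R Y X f M; last 1 first.
- exists W^*o; split=> [i|g ag|].
  + by apply: ip_inj => y; rewrite adjPl WE; have [<-] := fP y.
  + apply: ip_inj => y; rewrite ip0l adjPl WE ipC.
    by have [_ -> //] := fP y; rewrite conjC0.
  + apply: rnorm_op_le => // x.
    have [->|V0] := eqVneq (W^*o x) 0.
      by rewrite rnorm0 mulr_ge0 ?rnorm_ge0.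
    have n0 : 0 < rnorm (W^*o x).
      by rewrite lt_def rnorm_ge0 andbT; apply: contra_neq V0; exact: rnorm_eq0.
    rewrite -(ler_pM2l n0) -expr2 -rip_self /rip adjPl.
    rewrite (le_trans (ler_norm _))// (le_trans (Re_le_rnorm _))//.
    rewrite (le_trans (ip_CS _ _))// WE.
    have [_ _] := fP (W^*o x); have := rnorm_ge0 x; nra.
- move=> c u v; have h : forall g, (forall i, inner (a i) g = 0) ->
      inner (f (c *: u + v) - (c *: f u + f v)) g = 0.
    move=> g ag; rewrite ipBl ipDl ipZl.
    have [_ -> // _] := fP (c *: u + v); have [_ -> // _] := fP u.
    by have [_ -> // _] := fP v; rewrite mulr0 addr0 subrr.
  apply/eqP; rewrite -subr_eq0; apply/eqP/ip_self_eq0/h => i.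
  rewrite ipBr ipDr ipZr.
  have [<- _ _] := fP (c *: u + v); have [<- _ _] := fP u.
  by have [<- _ _] := fP v; rewrite ipDr ipZr subrr.
- by have [] := fP z.
Qed.

(** A family and its orthogonal complement are jointly total, as is seen on the
    range of the adjoint; this replaces a projection onto the closed span. *)
Lemma op_eq0_total (X Y : hilbertType R) (I : Type) (a : I -> X)
    (A : bounded_op X Y) : (forall i, A (a i) = 0) ->
  (forall g, (forall i, inner (a i) g = 0) -> A g = 0) -> A = 0.
Proof.
move=> Aa Ag; rewrite -[A]adjK; suff -> : A^*o = 0 by rewrite adj0.
apply: op_ext => y; apply: ip_self_eq0; rewrite {1}adjPl Ag ?ip0r// => i.
by rewrite -adjP Aa ip0l.
Qed.

End Extension.

(** * Positive scalar kernels *)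

Section PositiveKernels.
Context {R : realType}.
Local Notation C := R[i].

Definition qform (I : Type) (k : I -> I -> C) (s : seq (C * I)) : C :=
  \sum_(p <- s) \sum_(q <- s) p.1 * Num.conj q.1 * k p.2 q.2.

Definition psd (I : Type) (k : I -> I -> C) : Prop := forall s, 0 <= qform k s.

Lemma inner_lcomb (V : hilbertType R) (I J : Type) (h : I -> V) (g : J -> V) s t :
  inner (lcomb h s) (lcomb g t) =
  \sum_(p <- s) \sum_(q <- t) p.1 * Num.conj q.1 * inner (h p.2) (g q.2).
Proof.
rewrite ip_suml; apply: eq_bigr => p _; rewrite ip_sumr; apply: eq_bigr => q _.
by rewrite ipZl ipZr mulrA.
Qed.

Lemma qform_gram (V : hilbertType R) (I : Type) (h : I -> V) s :
  qform (fun i j => inner (h i) (h j)) s = (rnorm (lcomb h s) ^+ 2)%:C%C.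
Proof. by rewrite -ip_self inner_lcomb. Qed.

Lemma psd_gram (V : hilbertType R) (I : Type) (h : I -> V) :
  psd (fun i j => inner (h i) (h j)).
Proof. by move=> s; rewrite qform_gram ler0c sqr_ge0. Qed.

Lemma eq_psd (I : Type) (k k' : I -> I -> C) : k =2 k' -> psd k -> psd k'.
Proof.
by move=> kk' kP s; rewrite (le_trans (kP s))// /qform;
  under eq_bigr do under eq_bigr do rewrite kk'.
Qed.

Lemma qform_add (I : Type) (k k' : I -> I -> C) s :
  qform (fun i j => k i j + k' i j) s = qform k s + qform k' s.
Proof.
rewrite /qform -big_split/=; apply: eq_bigr => p _.
by rewrite -big_split/=; apply: eq_bigr => q _; rewrite mulrDr.
Qed.

Lemma qform_sub (I : Type) (k k' : I -> I -> C) s :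
  qform (fun i j => k i j - k' i j) s = qform k s - qform k' s.
Proof.
rewrite /qform -sumrB; apply: eq_bigr => p _.
by rewrite -sumrB; apply: eq_bigr => q _; rewrite mulrBr.
Qed.

Lemma qform_scale (I : Type) c (k : I -> I -> C) s :
  qform (fun i j => c * k i j) s = c * qform k s.
Proof.
rewrite /qform mulr_sumr; apply: eq_bigr => p _.
by rewrite mulr_sumr; apply: eq_bigr => q _; rewrite mulrCA.
Qed.

Lemma qform_sum (I J : Type) (r : seq J) (P : pred J) (k : J -> I -> I -> C) s :
  qform (fun a b => \sum_(j <- r | P j) k j a b) s =
  \sum_(j <- r | P j) qform (k j) s.
Proof.
rewrite /qform [RHS]exchange_big/=; apply: eq_bigr => p _.
rewrite [RHS]exchange_big/=; apply: eq_bigr => q _.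
by rewrite mulr_sumr.
Qed.

Lemma psd_add (I : Type) (k k' : I -> I -> C) :
  psd k -> psd k' -> psd (fun i j => k i j + k' i j).
Proof. by move=> kP k'P s; rewrite qform_add addr_ge0. Qed.

Lemma psd_scale (I : Type) c (k : I -> I -> C) :
  0 <= c -> psd k -> psd (fun i j => c * k i j).
Proof. by move=> c0 kP s; rewrite qform_scale mulr_ge0. Qed.

Lemma psd0 (I : Type) : psd (fun _ _ : I => 0 : C).
Proof.
by move=> s; rewrite /qform big1// => p _; rewrite big1// => q _; rewrite mulr0.
Qed.

Lemma psd_reindex (I J : Type) (f : J -> I) (k : I -> I -> C) :
  psd k -> psd (fun i j => k (f i) (f j)).
Proof.
move=> kP s; have := kP [seq (p.1, f p.2) | p <- s].
by rewrite /qform big_map/=; under eq_bigr do rewrite big_map.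
Qed.

Lemma psd_rescale (I : Type) (c : I -> C) (k : I -> I -> C) :
  psd k -> psd (fun i j => c i * Num.conj (c j) * k i j).
Proof.
move=> kP s; have := kP [seq (p.1 * c p.2, p.2) | p <- s].
rewrite /qform big_map/= => /le_trans -> //.
rewrite le_eqVlt; apply/orP; left; apply/eqP; apply: eq_bigr => p _.
by rewrite big_map/=; apply: eq_bigr => q _; rewrite rmorphM/=; ring.
Qed.

Section Basic.
Variables (I : Type) (k : I -> I -> C).
Hypothesis kP : psd k.

Lemma psd_diag i : 0 <= k i i.
Proof. by have := kP [:: (1, i)]; rewrite /qform !big_seq1/= conjC1 !mul1r. Qed.

Lemma psd2 i j (x y : C) : 0 <= x * Num.conj x * k i i + x * Num.conj y * k i j
  + (y * Num.conj x * k j i + y * Num.conj y * k j j).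
Proof. by have := kP [:: (x, i); (y, j)]; rewrite /qform !big_cons !big_nil/= !addr0. Qed.

Lemma conjCi_cplx : Num.conj ('i%C : C) = - 'i%C.
Proof. by apply/eqP; rewrite eq_complex/= oppr0 !eqxx. Qed.

(** A nonnegative element of [R[i]] is real; two values of the form then
    determine the symmetry. *)
Lemma psd_herm i j : k j i = Num.conj (k i j).
Proof.
have h1 := ger0_Im (psd2 i j 1 1); have h2 := ger0_Im (psd2 i j 1 'i%C).
have hi := ger0_Im (psd_diag i); have hj := ger0_Im (psd_diag j).
move: h1 h2; rewrite !conjC1 !mul1r !mulr1 conjCi_cplx.
move: hi hj; case: (k i i) => ai bi /= ->; case: (k j j) => aj bj /= ->.
case: (k i j) => a b; case: (k j i) => a' b' /= h1 h2.
by apply/eqP; rewrite eq_complex/=; apply/andP; split; apply/eqP; lra.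
Qed.

(** The values of the form at [e_i + c e_j], for the four powers [c] of the
    imaginary unit, bound both parts of [k i j]. *)
Lemma psd_bound i j :
  rnorm (k i j) <= complex.Re (k i i) + complex.Re (k j j).
Proof.
apply: le_trans (rnorm_le_ReIm _) _.
have re (c : C) : 0 <= c -> 0 <= complex.Re c by rewrite lecE => /andP[].
have h1 := re _ (psd2 i j 1 1); have h2 := re _ (psd2 i j 1 (-1)).
have h3 := re _ (psd2 i j 1 'i%C); have h4 := re _ (psd2 i j 1 (- 'i%C)).
move: h1 h2 h3 h4.
have conjN (x : C) : Num.conj (- x) = - Num.conj x by rewrite rmorphN.
rewrite !conjN !conjC1 !mul1r !mulr1 conjCi_cplx (psd_herm i j).
case: (k i i) => ai bi; case: (k j j) => aj bj; case: (k i j) => a b /=.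
by case: (ger0P a) => ?; case: (ger0P b) => ?; lra.
Qed.

(** When [k j j = 0] the form at [e_i + c e_j] is affine in [c] and bounded
    below, hence constant. *)
Lemma psd_diag0 i j : k j j = 0 -> k i j = 0.
Proof.
move=> kj; have re (c : C) : 0 <= c -> 0 <= complex.Re c by rewrite lecE => /andP[].
have lin0 (A x : R) : (forall t, 0 <= A + 2 * t * x) -> x = 0.
  move=> h; apply/eqP; rewrite -[_ == _]negbK; apply/negP => x0.
  have := h (- (A + 1) / (2 * x)).
  have -> : A + 2 * (- (A + 1) / (2 * x)) * x = - 1 by field.
  lra.
have h t := re _ (psd2 i j 1 t%:C%C); have h' t := re _ (psd2 i j 1 ('i%C * t%:C%C)).
move: h h'; rewrite kj (psd_herm i j).
case: (k i i) => a b; case: (k i j) => c d h h'.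
apply/eqP; rewrite eq_complex/=; apply/andP; split; apply/eqP.
- apply: (lin0 a) => t; have := h t; rewrite conjC1 /=; lra.
- apply: (lin0 a) => t; have := h' t.
  rewrite conjC1 /=; lra.
Qed.

Definition schur_compl (l i j : I) : C := k i j - k i l * k l j / k l l.

(** The new form at [s] is the old one at [s] plus the multiple of [l] that
    minimises it. *)
Lemma psd_schur_compl l : psd (schur_compl l).
Proof.
have [k0|k0] := eqVneq (k l l) 0.
  by apply: eq_psd kP => i j; rewrite /schur_compl k0 invr0 mulr0 subr0.
move=> s; pose x := \sum_(p <- s) p.1 * k p.2 l.
have xE : \sum_(p <- s) Num.conj p.1 * k l p.2 = Num.conj x.
  rewrite rmorph_sum; apply: eq_bigr => p _.
  by rewrite rmorphM/= (psd_herm p.2 l).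
have := kP ((- x / k l l, l) :: s); rewrite /qform big_cons/= big_cons/=.
have kR : Num.conj (k l l) = k l l by rewrite -psd_herm.
under [\sum_(j <- s) (\sum_(i <- _ :: _) _)]eq_bigr do rewrite big_cons/=.
rewrite big_split/=.
under eq_bigr do rewrite -mulrA.
rewrite -mulr_sumr xE.
under [X in _ + (X + _)]eq_bigr do rewrite mulrAC.
rewrite -mulr_suml -/x.
rewrite rmorphM/= rmorphN/= fmorphV/= kR.
move=> /le_trans -> //; rewrite le_eqVlt; apply/orP; left; apply/eqP.
have -> : \sum_(p <- s) \sum_(q <- s) p.1 * Num.conj q.1 * schur_compl l p.2 q.2 =
   qform k s - x * Num.conj x / k l l.
  rewrite /qform -xE mulr_suml mulr_suml -sumrB; apply: eq_bigr => p _.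
  rewrite mulr_sumr mulr_suml -sumrB; apply: eq_bigr => q _.
  by rewrite /schur_compl; ring.
by rewrite /qform; field.
Qed.

Lemma schur_compl_pivot l i : schur_compl l i l = 0.
Proof.
rewrite /schur_compl; have [k0|k0] := eqVneq (k l l) 0.
  by rewrite k0 invr0 mulr0 subr0 psd_diag0.
by rewrite mulfK// subrr.
Qed.

End Basic.

(** Peeling off rank one kernels by Schur complements reduces the Schur product
    with [k'] to rescalings of [k]. *)
Lemma psd_mul (I : eqType) (k k' : I -> I -> C) :
  psd k -> psd k' -> psd (fun i j => k i j * k' i j).
Proof.
move=> kP k'P s.
have : forall p, p \in s -> p.2 \notin [seq q.2 | q <- s] -> k' p.2 p.2 = 0.
  by move=> p ps; rewrite map_f.
(* The indices of [s] at which [k'] has a nonzero diagonal entry shrink. *)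
elim: [seq q.2 | q <- s] k' k'P => [|l t IH] k' k'P k'0.
  rewrite /qform big_seq big1// => p ps; rewrite big_seq big1// => q qs.
  by rewrite (psd_diag0 k'P) ?mulr0// k'0.
have -> : qform (fun i j => k i j * k' i j) s =
    qform (fun i j => k i j * schur_compl k' l i j) s +
    (k' l l)^-1 * qform (fun i j => k' i l * Num.conj (k' j l) * k i j) s.
  rewrite -qform_scale -qform_add /qform; apply: eq_bigr => p _.
  apply: eq_bigr => q _; congr (_ * _).
  by rewrite /schur_compl -(psd_herm k'P q.2 l); ring.
rewrite addr_ge0// ?mulr_ge0 ?invr_ge0 ?(psd_diag k'P)//; last exact: psd_rescale.
apply: IH; first exact: psd_schur_compl.
move=> p ps pt; have [->|pl] := eqVneq p.2 l; first exact: schur_compl_pivot.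
have k'p : k' p.2 p.2 = 0 by rewrite k'0// inE negb_or pl.
by rewrite /schur_compl k'p (psd_diag0 k'P l k'p) mulr0 mul0r subr0.
Qed.

End PositiveKernels.

(** * Gram realisation of positive kernels *)

Section Embedding.
Context {R : realType} (K : hilbertType R).
Local Notation C := R[i].

Definition orthonormal_seq (e : nat -> K) :=
  forall i j, inner (e i) (e j) = (i == j)%:R :> C.

(** Gram-Schmidt, where infinite dimension provides at each stage a vector outside
    the span of the previous ones. *)
Lemma ex_orthonormal_seq : ~ finite_dimensional K ->
  exists e, orthonormal_seq e.
Proof.
move=> infK.
pose ortho (l : seq K) := forall i j, (i < size l)%N -> (j < size l)%N ->
  inner l`_i l`_j = (i == j)%:R :> C.
have step (l : seq K) : exists x : K, ortho l ->
    inner x x = 1 /\ forall i, (i < size l)%N -> inner x l`_i = 0.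
  have [v vP] : exists v : K, forall c : 'I_(size l) -> C,
      v <> \sum_(i < size l) c i *: l`_i.
    apply: contrapT => /forallNP h; apply: infK.
    exists (size l), (fun i => l`_i) => v.
    by have /existsNP[c /contrapT vE] := h v; exists c.
  pose w := v - \sum_(i < size l) inner v l`_i *: l`_i.
  have w0 : 0 < rnorm w.
    rewrite lt_def rnorm_ge0 andbT; apply/eqP => /rnorm_eq0/eqP.
    by rewrite subr_eq0 => /eqP; exact: vP.
  exists ((rnorm w)^-1%:C%C *: w) => lo; split=> [|i il].
    rewrite ip_self rnormZ rnorm_real gtr0_norm ?invr_gt0//.
    by rewrite mulVf ?gt_eqF// expr1n.
  rewrite ipZl; suff -> : inner w l`_i = 0 by rewrite mulr0.
  rewrite /w ipBl ip_suml (bigD1 (Ordinal il))//= ipZl lo// eqxx mulr1.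
  rewrite big1 ?addr0 ?subrr// => j ji.
  by rewrite ipZl lo// [_ == _](negbTE ji) mulr0.
have [f fP] := choice step.
pose L := fix L n := if n is n.+1 then rcons (L n) (f (L n)) else [::].
have sL n : size (L n) = n by elim: n => //= n IH; rewrite size_rcons IH.
have LE n i : (i < n)%N -> (L n)`_i = f (L i).
  elim: n => // n IH; rewrite ltnS leq_eqVlt => /orP[/eqP ->|lt_in] /=.
    by rewrite nth_rcons sL ltnn eqxx.
  by rewrite nth_rcons sL lt_in IH.
have oL n : ortho (L n).
  elim: n => [i j|n IH i j]; first by rewrite ltn0.
  rewrite !sL !ltnS => ilt jlt.
  have [f1 f2] := fP _ IH.
  have fo m : (m < n)%N -> inner (f (L n)) (f (L m)) = 0.
    by move=> mn; rewrite -(LE n m mn) f2// sL.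
  have [->|in_] := eqVneq i n; have [->|jn] := eqVneq j n.
  - by rewrite LE// f1 eqxx.
  - have jlt' : (j < n)%N by rewrite ltn_neqAle jn.
    by rewrite !LE ?ltnS// fo// gtn_eqF.
  - have ilt' : (i < n)%N by rewrite ltn_neqAle in_.
    by rewrite !LE ?ltnS// ipC fo// conjC0 ltn_eqF.
  - have ilt' : (i < n)%N by rewrite ltn_neqAle in_.
    have jlt' : (j < n)%N by rewrite ltn_neqAle jn.
    by rewrite !LE ?ltnS// -(LE n i)// -(LE n j)// IH ?sL.
exists (fun n => f (L n)) => i j.
have := oL (maxn i j).+1 i j; rewrite !sL !ltnS leq_maxl leq_maxr => /(_ isT isT).
by rewrite !LE ?ltnS ?leq_maxl ?leq_maxr.
Qed.

(** Cholesky factorisation of a positive kernel on the natural numbers; the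
    coefficients vanish above the diagonal, so no series is needed. *)
Lemma psd_factor (k : nat -> nat -> C) (e : nat -> K) :
  orthonormal_seq e -> psd k ->
  exists h : nat -> K, forall i j, inner (h i) (h j) = k i j.
Proof.
move=> eO kP.
(* [kk l] is what remains of [k] once the pivots below [l] are eliminated. *)
pose kk := fix kk l := if l is l.+1 then schur_compl (kk l) l else k.
have kkP l : psd (kk l) by elim: l => //= l IH; exact: psd_schur_compl.
have kk0 l i j : (i < l)%N -> kk l i j = 0.
  elim: l i j => // l IH i j; rewrite ltnS leq_eqVlt => /orP[/eqP ->|il].
    by rewrite /= (psd_herm (psd_schur_compl (kkP l) l) j l) schur_compl_pivot// conjC0.
  by rewrite /= /schur_compl (IH i j il) (IH i l il) !mul0r subrr.
pose v l i := kk l i l / sqrtC (kk l l l).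
have v0 l i : (i < l)%N -> v l i = 0 by move=> il; rewrite /v kk0// mul0r.
have vE l i j : v l i * Num.conj (v l j) = kk l i l * kk l l j / kk l l l.
  rewrite /v rmorphM/= fmorphV/= (psd_herm (kkP l) j l).
  have d0 := psd_diag (kkP l) l.
  have -> : Num.conj (sqrtC (kk l l l)) = sqrtC (kk l l l).
    by apply: CrealP; rewrite ger0_real// sqrtC_ge0.
  by rewrite mulrACA -invfM -expr2 sqrtCK.
have kE L i j : k i j = \sum_(l < L) v l i * Num.conj (v l j) + kk L i j.
  elim: L => [|L ->]; first by rewrite big_ord0 add0r.
  by rewrite big_ord_recr/= vE -addrA; congr (_ + _); rewrite /schur_compl; ring.
have sumE i L : (i < L)%N ->
    \sum_(l < i.+1) v l i *: e l = \sum_(l < L) v l i *: e l.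
  move=> iL; rewrite (big_ord_widen L (fun l => v l i *: e l))//.
  rewrite [RHS](bigID (fun l : 'I_L => (l < i.+1)%N))/= [X in _ = _ + X]big1 ?addr0//.
  by move=> l; rewrite -leqNgt => il; rewrite v0// scale0r.
exists (fun i => \sum_(l < i.+1) v l i *: e l) => i j.
pose L := (maxn i j).+1.
rewrite (sumE i L) ?ltnS ?leq_maxl// (sumE j L) ?ltnS ?leq_maxr//.
rewrite (kE L) kk0 ?ltnS ?leq_maxl// addr0.
rewrite ip_suml; apply: eq_bigr => l _.
rewrite ip_sumr (bigD1 l)//= ipZl ipZr eO eqxx mulr1 big1 ?addr0// => l' ll'.
by rewrite ipZl ipZr eO [_ == _]eq_sym [_ == _](negbTE ll') !mulr0.
Qed.

End Embedding.

(** * Finite direct sums of Hilbert spaces *)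

(** Cauchy-Schwarz for the quadratic form with matrix [[A, - r], [- r, B]]. *)
Lemma quad_ge0_cs (R : rcfType) (A B r : R) : 0 <= A -> 0 <= B ->
  (forall s t, 0 <= s ^+ 2 * A + t ^+ 2 * B - 2 * (s * t * r)) ->
  r <= Num.sqrt A * Num.sqrt B.
Proof.
have zero_case (B' : R) : (forall s t, 0 <= t ^+ 2 * B' - 2 * (s * t * r)) -> r <= 0.
  move=> h; rewrite leNgt; apply/negP => r0.
  have := h ((B' + 1) / (2 * r)) 1.
  have -> : 1 ^+ 2 * B' - 2 * ((B' + 1) / (2 * r) * 1 * r) = - 1.
    by field; rewrite gt_eqF.
  lra.
move=> A0 B0 h.
have [A1|A1] := eqVneq A 0.
  rewrite A1 sqrtr0 mul0r; apply: (zero_case B) => s t.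
  by have := h s t; rewrite A1 mulr0 add0r.
have [B1|B1] := eqVneq B 0.
  rewrite B1 sqrtr0 mulr0; apply: (zero_case A) => s t.
  by have := h t s; rewrite B1 mulr0 addr0 (mulrC t s).
have a0 : 0 < Num.sqrt A by rewrite sqrtr_gt0 lt_def A1.
have b0 : 0 < Num.sqrt B by rewrite sqrtr_gt0 lt_def B1.
have := h (Num.sqrt B) (Num.sqrt A); rewrite !sqr_sqrtr//.
rewrite -{1 2}(sqr_sqrtr A0) -{1 2}(sqr_sqrtr B0).
move: a0 b0; move: (Num.sqrt A) (Num.sqrt B) => a b a0 b0 h1.
have ab : 0 < a * b by rewrite mulr_gt0.
rewrite -subr_ge0 -(pmulr_rge0 _ ab); lra.
Qed.

Section DirectSum.
Context {R : realType} (I : finType) (H : I -> hilbertType R).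
Local Notation C := R[i].

(** A record, so that the Hilbert norm does not meet the product topology that
    the bare function space carries. *)
Record hsum := HSum { hcomp :> forall i, H i }.

Lemma hsum_ext (x y : hsum) : (forall i, x i = y i) -> x = y.
Proof.
case: x y => [f] [g] /= fg; congr HSum; exact: functional_extensionality_dep.
Qed.

HB.instance Definition _ := gen_eqMixin hsum.
HB.instance Definition _ := gen_choiceMixin hsum.

Definition hsum_add (x y : hsum) := HSum (fun i => x i + y i).
Definition hsum_opp (x : hsum) := HSum (fun i => - x i).
Definition hsum_zero := HSum (fun i => 0).
Definition hsum_scale (a : C) (x : hsum) := HSum (fun i => a *: x i).

Lemma hsum_addA : associative hsum_add.
Proof. by move=> x y z; apply: hsum_ext => i /=; rewrite addrA. Qed.
Lemma hsum_addC : commutative hsum_add.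
Proof. by move=> x y; apply: hsum_ext => i /=; rewrite addrC. Qed.
Lemma hsum_add0 : left_id hsum_zero hsum_add.
Proof. by move=> x; apply: hsum_ext => i /=; rewrite add0r. Qed.
Lemma hsum_addN : left_inverse hsum_zero hsum_opp hsum_add.
Proof. by move=> x; apply: hsum_ext => i /=; rewrite addNr. Qed.

HB.instance Definition _ :=
  GRing.isZmodule.Build hsum hsum_addA hsum_addC hsum_add0 hsum_addN.

Lemma hsum_scaleA (a b : C) (x : hsum) :
  hsum_scale a (hsum_scale b x) = hsum_scale (a * b) x.
Proof. by apply: hsum_ext => i /=; rewrite scalerA. Qed.
Lemma hsum_scale1 : left_id 1 hsum_scale.
Proof. by move=> x; apply: hsum_ext => i /=; rewrite scale1r. Qed.
Lemma hsum_scaleDr : right_distributive hsum_scale +%R.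
Proof. by move=> a x y; apply: hsum_ext => i /=; rewrite scalerDr. Qed.
Lemma hsum_scaleDl (x : hsum) : {morph hsum_scale^~ x : a b / a + b}.
Proof. by move=> a b; apply: hsum_ext => i /=; rewrite scalerDl. Qed.

HB.instance Definition _ := GRing.Zmodule_isLmodule.Build C hsum
  hsum_scaleA hsum_scale1 hsum_scaleDr hsum_scaleDl.

Lemma hsumDE (x y : hsum) i : (x + y) i = x i + y i. Proof. by []. Qed.
Lemma hsumBE (x y : hsum) i : (x - y) i = x i - y i. Proof. by []. Qed.
Lemma hsumZE (a : C) (x : hsum) i : (a *: x) i = a *: x i. Proof. by []. Qed.

Lemma hsum_sumE (J : Type) (r : seq J) (Q : pred J) (f : J -> hsum) i :
  (\sum_(j <- r | Q j) f j) i = \sum_(j <- r | Q j) f j i.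
Proof. by elim/big_rec2: _ => // j x y _ <-. Qed.

Definition hsum_inner (x y : hsum) : C := \sum_i inner (x i) (y i).

Let sq (x : hsum) : R := \sum_i rnorm (x i) ^+ 2.

Let sq_ge0 x : 0 <= sq x.
Proof. by apply: sumr_ge0 => i _; rewrite sqr_ge0. Qed.

Definition hsum_norm (x : hsum) : C := (Num.sqrt (sq x))%:C%C.

Lemma hsum_normD (x y : hsum) : hsum_norm (x + y) <= hsum_norm x + hsum_norm y.
Proof.
rewrite -rmorphD/= lecR -(@ler_pXn2r _ 2)// ?nnegrE ?addr_ge0 ?sqrtr_ge0//.
rewrite sqrrD !sqr_sqrtr//.
pose r : R := \sum_i rip (x i) (y i).
have -> : sq (x + y) = sq x + 2 * r + sq y.
  rewrite /sq /r mulr_sumr -!big_split/=; apply: eq_bigr => i _.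
  by rewrite rnorm_sqD.
rewrite lerD2r lerD2l mulr2n; have -> : 2 * r = r + r by lra.
suff : r <= Num.sqrt (sq x) * Num.sqrt (sq y) by move=> h; rewrite lerD.
apply: quad_ge0_cs => // s t.
have -> : s ^+ 2 * sq x + t ^+ 2 * sq y - 2 * (s * t * r) =
    sq (s%:C%C *: x - t%:C%C *: y).
  rewrite /sq /r !mulr_sumr -big_split -sumrB/=; apply: eq_bigr => i _.
  rewrite rnorm_sqD rnormN !rnormZ !rnorm_real !exprMn !real_normK ?num_real//.
  by rewrite !ripE; ring.
exact: sq_ge0.
Qed.

Lemma hsum_normZ (a : C) (x : hsum) : hsum_norm (a *: x) = `|a| * hsum_norm x.
Proof.
rewrite /hsum_norm rnormE -rmorphM/=; congr (_%:C%C).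
have -> : sq (a *: x) = rnorm a ^+ 2 * sq x.
  by rewrite /sq mulr_sumr; apply: eq_bigr => i _; rewrite rnormZ exprMn.
by rewrite sqrtrM ?sqr_ge0// sqrtr_sqr ger0_norm ?rnorm_ge0.
Qed.

Lemma hsum_norm0_eq0 (x : hsum) : hsum_norm x = 0 -> x = 0.
Proof.
move=> [/eqP]; rewrite sqrtr_eq0 => x0.
have {}x0 : sq x = 0 by apply/eqP; rewrite eq_le x0 sq_ge0.
apply: hsum_ext => i; apply: rnorm_eq0.
have /eqP := x0; rewrite psumr_eq0 => [/allP/(_ i)|j _]; last exact: sqr_ge0.
by rewrite mem_index_enum => /(_ isT); rewrite sqrf_eq0 => /eqP.
Qed.

HB.instance Definition _ :=
  Lmodule_isNormed.Build C hsum hsum_normD hsum_normZ hsum_norm0_eq0.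

Lemma rnorm_hsum (x : hsum) : rnorm x ^+ 2 = \sum_i rnorm (x i) ^+ 2.
Proof. by rewrite -[rnorm x]/(Num.sqrt (sq x)) sqr_sqrtr. Qed.

Lemma rnorm_hcomp (x : hsum) i : rnorm (x i) <= rnorm x.
Proof.
rewrite -(@ler_pXn2r _ 2)// ?nnegrE ?rnorm_ge0// rnorm_hsum (bigD1 i)//= lerDl.
by apply: sumr_ge0 => j _; rewrite sqr_ge0.
Qed.

Lemma rnorm_hsum_le (x : hsum) : rnorm x <= \sum_i rnorm (x i).
Proof.
have S0 : 0 <= \sum_i rnorm (x i) by apply: sumr_ge0 => i _; rewrite rnorm_ge0.
rewrite -(@ler_pXn2r _ 2)// ?nnegrE ?rnorm_ge0// rnorm_hsum.
suff [] : \sum_i rnorm (x i) ^+ 2 <= (\sum_i rnorm (x i)) ^+ 2 /\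
  0 <= \sum_i rnorm (x i) by [].
elim/big_ind2 : _ => [|a b c d [h1 h2] [h3 h4]|i _]; last by rewrite rnorm_ge0.
  by rewrite expr0n.
by split; [nra|rewrite addr_ge0].
Qed.

Lemma hsum_complete (F : set_system hsum) : ProperFilter F -> cauchy F -> cvg F.
Proof.
move=> FF /cauchyP cF.
have cvi i : exists l : H i, (fun x : hsum => x i) @ F --> l.
  apply: rcauchy_cvg => e e0.
  have e2 : 0 < (e / 2)%:C%C :> C by rewrite ltcR divr_gt0.
  have [x Fx] := cF _ e2.
  exists (ball x (e / 2)%:C%C); split=> // s t.
  rewrite -ball_normE /ball_/= !rnormE !ltcR => xs xt.
  rewrite -hsumBE (le_lt_trans (rnorm_hcomp _ _))//.
  by have := rnormD (s - x) (x - t); rewrite addrA subrK (rnormB s x); lra.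
pose l := HSum (fun i => projT1 (cid (cvi i))).
have lP i : (fun x : hsum => x i) @ F --> l i by rewrite /=; case: cid.
apply/cvg_ex; exists l; apply/(@rcvgP _ _ _ F FF id) => e e0.
have e1 : 0 < e / (#|I|%:R + 1) by rewrite divr_gt0// ltr_wpDl.
have : \forall x \near F, forall i, i \in enum I -> rnorm (l i - hcomp x i) < e / (#|I|%:R + 1).
  elim: (enum I) => [|i r IH]; first by apply: nearW.
  have hi : \forall x \near F, rnorm (l i - hcomp x i) < e / (#|I|%:R + 1).
    by have /rcvgP := lP i; apply.
  apply: filterS2 hi IH => x xi IH j; rewrite inE => /orP[/eqP ->//|]; exact: IH.
apply: filterS => x xl; apply: le_lt_trans (rnorm_hsum_le _) _.
apply: le_lt_trans (_ : \sum_(i : I) e / (#|I|%:R + 1) < e).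
  by apply: ler_sum => i _; rewrite hsumBE ltW// xl ?mem_enum.
rewrite sumr_const -[X in X < _]mulr_natr -mulrA gtr_pMr//.
by rewrite mulrC ltr_pdivrMr ?ltr_wpDl// mul1r ltrDl.
Qed.

HB.instance Definition _ := Uniform_isComplete.Build hsum hsum_complete.

Lemma hsum_inner_bilinear : bilinear_for
  (GRing.Scale.Law.clone _ _ *%R _)
  (GRing.Scale.Law.clone _ _ (@Num.conj C \; *%R) _) hsum_inner.
Proof.
split=> [y|x] a u v; rewrite /hsum_inner/= mulr_sumr -big_split/=;
  apply: eq_bigr => i _.
- by rewrite ?hsumDE ?hsumZE ipDl ipZl.
- by rewrite ?hsumDE ?hsumZE ipDr ipZr.
Qed.

HB.instance Definition _ :=
  bilinear_isBilinear.Build C hsum hsum C _ _ hsum_inner hsum_inner_bilinear.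

Lemma hsum_inner_herm (x y : hsum) :
  hsum_inner x y = (-1) ^+ false * Num.conj (hsum_inner y x).
Proof.
rewrite expr0 mul1r rmorph_sum; apply: eq_bigr => i _; exact: ipC.
Qed.

HB.instance Definition _ :=
  isHermitianSesquilinear.Build C hsum false (@Num.conj C) hsum_inner hsum_inner_herm.

Lemma hsum_norm_inner (x : hsum) : `|x| ^+ 2 = hsum_inner x x.
Proof.
rewrite rnormE -rmorphXn/= rnorm_hsum rmorph_sum; apply: eq_bigr => i _.
by rewrite ip_self.
Qed.

HB.instance Definition _ := isHilbert.Build R hsum hsum_norm_inner.

Lemma inner_hsum (x y : hsum) : inner x y = \sum_i inner (x i) (y i).
Proof. by []. Qed.

Definition hsum_single i (v : H i) : hsum :=
  HSum (fun j => if i =P j is ReflectT ij then ecast k (H k) ij v else 0).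

Lemma hsum_single_same i (v : H i) : hsum_single v i = v.
Proof. by rewrite /=; case: eqP => // e; rewrite (eq_axiomK e). Qed.

Lemma hsum_single_other i j (v : H i) : i != j -> hsum_single v j = 0.
Proof. by rewrite /=; case: eqP. Qed.

Lemma ex_hsum_proj i : exists p : bounded_op hsum (H i), forall x, p x = x i.
Proof.
apply: (@op_intro _ _ _ (fun x : hsum => x i) 1) => [a x y //|x].
by rewrite mul1r rnorm_hcomp.
Qed.

Definition hsum_proj i : bounded_op hsum (H i) := projT1 (cid (ex_hsum_proj i)).

Lemma hsum_projE i x : hsum_proj i x = x i.
Proof. by rewrite /hsum_proj; case: cid. Qed.

Lemma hsum_inj_E i v : (hsum_proj i)^*o v = hsum_single v.
Proof.
apply: ip_inj => x; rewrite adjPl hsum_projE inner_hsum (bigD1 i)//.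
rewrite big1 => [|j ij]; first by rewrite hsum_single_same; exact: (esym (addr0 _)).
by rewrite hsum_single_other ?ip0l// eq_sym.
Qed.

Lemma hsum_proj_inj i : hsum_proj i *o (hsum_proj i)^*o = op_id (H i).
Proof.
by apply: op_ext => v; rewrite /= hsum_projE hsum_inj_E hsum_single_same.
Qed.

Lemma hsum_proj_inj0 i j : i != j -> hsum_proj j *o (hsum_proj i)^*o = 0.
Proof.
by move=> ij; apply: op_ext => v; rewrite /= hsum_projE hsum_inj_E hsum_single_other.
Qed.

End DirectSum.

(** * Unitary dilation of a partial isometry *)

Section OperatorAlgebra.
Context {R : realType}.
Local Notation C := R[i].

Lemma op_subE (U V : normedModType C) (A B : bounded_op U V) x :
  (A - B) x = A x - B x.
Proof. by []. Qed.

Lemma op_compE (U V W : normedModType C) (A : bounded_op V W) (B : bounded_op U V) x :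
  (A *o B) x = A (B x).
Proof. by []. Qed.

Lemma op_idE (U : normedModType C) (x : U) : op_id U x = x.
Proof. by []. Qed.

Lemma op_oppE (U V : normedModType C) (A : bounded_op U V) x : (- A) x = - A x.
Proof. by []. Qed.

Lemma op_zeroE (U V : normedModType C) x : (0 : bounded_op U V) x = 0.
Proof. by []. Qed.

Definition opE := (@op_subE, @op_compE, @op_idE, @op_oppE, @op_zeroE,
  @op_addE, @op_scaleE).

Lemma op_eqP (U V : normedModType C) (A B : bounded_op U V) x : A = B -> A x = B x.
Proof. by move=> ->. Qed.

Lemma pencilE d (X : hilbertType R) (P : 'I_d -> bounded_op X X) z x :
  pencil P z x = \sum_(k < d) z 0 k *: P k x.
Proof. by rewrite /pencil op_sumE. Qed.

Lemma rnorm_isometry (X : hilbertType R) (A : bounded_op X X) :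
  A^*o *o A = op_id X -> forall x, rnorm (A x) = rnorm x.
Proof.
move=> Aiso x; apply/eqP; rewrite -(@eqrXn2 _ 2)// ?rnorm_ge0//; apply/eqP/complexI.
rewrite -!ip_self adjP; congr (inner _ _).
by have := op_eqP x Aiso; rewrite !opE.
Qed.

Lemma op_mapZ (V W : normedModType C) (A : bounded_op V W) a x :
  A (a *: x) = a *: A x.
Proof. exact: linearZ. Qed.

End OperatorAlgebra.

Section Halmos.
Context {R : realType} (X : hilbertType R).
Local Notation X2 := (hsum (fun _ : bool => X)).

(** The block matrix [[V, I - V V*], [I - V* V, V*]] on [X + X]. *)
Lemma ex_halmos (V : bounded_op X X) : exists A : bounded_op X2 X2, forall x,
  A x true = V (x true) + (x false - V (V^*o (x false))) /\
  A x false = x true - V^*o (V (x true)) + V^*o (x false).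
Proof.
pose p b := hsum_proj (fun _ : bool => X) b.
exists ((p true)^*o *o (V *o p true + (p false - V *o V^*o *o p false)) +
        (p false)^*o *o (p true - V^*o *o V *o p true + V^*o *o p false)) => x.
rewrite !opE !hsum_inj_E !hsum_projE.
by rewrite !hsumDE !hsum_single_same !hsum_single_other// addr0 add0r.
Qed.

Definition halmos V := projT1 (cid (ex_halmos V)).

Lemma halmosE V x : halmos V x true = V (x true) + (x false - V (V^*o (x false))) /\
  halmos V x false = x true - V^*o (V (x true)) + V^*o (x false).
Proof. by rewrite /halmos; case: cid. Qed.

Lemma halmos_adj V : (halmos V)^*o = halmos V^*o.
Proof.
apply: adj_uniq => x y; rewrite !inner_hsum !big_bool/=.
have [-> ->] := halmosE V x; have [-> ->] := halmosE V^*o y; rewrite adjK.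
rewrite !ipE !adjP !adjK; ring.
Qed.

Lemma halmos_isometry V : V *o V^*o *o V = V -> halmos V^*o *o halmos V = op_id X2.
Proof.
move=> VV; have VVE x : V (V^*o (V x)) = V x by exact: op_eqP VV.
have VVE' x : V^*o (V (V^*o x)) = V^*o x.
  by have := op_eqP x (congr1 (@adjoint _ _ _) VV); rewrite !adjM !opE adjK.
apply: op_ext => x; apply: hsum_ext => -[]; rewrite opE.
- have [-> _] := halmosE V^*o (halmos V x); have [-> ->] := halmosE V x.
  rewrite adjK !(linearD, linearN, linearB)/= !(VVE, VVE').
  by apply: ip_inj => z; rewrite !ipE; ring.
- have [_ ->] := halmosE V^*o (halmos V x); have [-> ->] := halmosE V x.
  rewrite adjK !(linearD, linearN, linearB)/= !(VVE, VVE').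
  by apply: ip_inj => z; rewrite !ipE; ring.
Qed.

End Halmos.

(** For a partial isometry, [V V*] and [V* V] are projections and the blocks
    multiply to the identity. Doubling the space dispenses with comparing the
    dimensions of the two defect spaces. *)
Lemma halmos_unitary (R : realType) (X : hilbertType R) (V : bounded_op X X) :
  V *o V^*o *o V = V ->
  (halmos V)^*o *o halmos V = op_id _ /\ halmos V *o (halmos V)^*o = op_id _.
Proof.
move=> VV; rewrite halmos_adj; split; first exact: halmos_isometry.
rewrite -[in X in X *o _](adjK V); apply: halmos_isometry.
have := congr1 (@adjoint _ _ _) VV; rewrite !adjM adjK => VV'.
by apply: op_ext => x; rewrite !opE; have := op_eqP x VV'; rewrite !opE.
Qed.

(** * The lurking isometry *)

Section IsometryExtension.
Context {R : realType} (X : hilbertType R) (I : Type) (a b : I -> X).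
Hypothesis gram_ab : forall i j, inner (a i) (a j) = inner (b i) (b j).

(** [V] is isometric between the spans of the two families and vanishes on the
    orthogonal complement of the first. *)
Lemma partial_isometry_extension : exists V : bounded_op X X,
  [/\ forall i, V (a i) = b i, forall i, V^*o (V (a i)) = a i
    & V *o V^*o *o V = V].
Proof.
have [s|V [Va Vg _]] := @op_extension R X X I a b 1 ler01.
  rewrite mul1r -(@ler_pXn2r _ 2)// ?nnegrE ?rnorm_ge0//.
  by rewrite -!rip_self /rip !inner_lcomb; under eq_bigr do
    under eq_bigr do rewrite -gram_ab.
have VVa i : V^*o (V (a i)) = a i.
  rewrite Va; pose g := V^*o (b i) - a i.
  have ag j : inner (a j) g = 0.
    by rewrite ipBr -adjP Va gram_ab subrr.
  apply/eqP; rewrite -subr_eq0 -/g; apply/eqP/ip_self_eq0.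
  by rewrite {1}/g ipBl adjPl (Vg g ag) ip0r ag subrr.
exists V; split=> //.
apply/eqP; rewrite -subr_eq0; apply/eqP.
apply: (@op_eq0_total _ _ _ _ a) => [i|g ag].
  by rewrite !opE VVa subrr.
by rewrite !opE (Vg g ag) !linear0 ?addr0.
Qed.

End IsometryExtension.

Section LurkingIsometry.
Context {R : realType} {d : nat} {U : hilbertType R}.
Local Notation C := R[i].
Variables (I : Type) (z : I -> 'rV[C]_d) (i0 : I).
Variables (H : 'I_d -> hilbertType R) (h : forall k, I -> bounded_op U (H k)).
Variable F : I -> bounded_op U U.
Hypothesis z0 : z i0 = 0.
Hypothesis agler : forall i j, (F i)^*o + F j =
  \sum_(k < d) (1 - Num.conj (z i 0 k) * z j 0 k) *: ((h k i)^*o *o h k j).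

Let X := hsum H.
Let pr k : bounded_op X (H k) := hsum_proj H k.
Let P0 k : bounded_op X X := (pr k)^*o *o pr k.
Let G0 i : bounded_op U X := \sum_(k < d) (pr k)^*o *o h k i.
Let X2 := hsum (fun _ : bool => X).
Let qr b : bounded_op X2 X := hsum_proj (fun _ : bool => X) b.

Let pr_G0 k i u : G0 i u k = h k i u.
Proof.
rewrite -hsum_projE /G0 op_sumE linear_sum (bigD1 k)//= big1 => [|j jk].
  rewrite addr0; have := op_eqP (h k i u) (hsum_proj_inj H k).
  by rewrite !opE.
have := op_eqP (h j i u) (hsum_proj_inj0 H jk).
by rewrite !opE.
Qed.

Let ip_G0 i j u v : inner (G0 i u) (G0 j v) =
  \sum_(k < d) inner (h k i u) (h k j v).
Proof. by rewrite inner_hsum; apply: eq_bigr => k _; rewrite !pr_G0. Qed.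

Let P0E k (x : X) j : P0 k x j = if j == k then x j else 0.
Proof.
rewrite /P0 opE hsum_inj_E hsum_projE; case: eqVneq => [->|jk].
  by rewrite hsum_single_same.
by rewrite hsum_single_other// eq_sym.
Qed.

Let pencil_P0E w (x : X) j : pencil P0 w x j = w 0 j *: x j.
Proof.
rewrite pencilE -hsum_projE linear_sum (bigD1 j)//= big1 ?addr0 => [|k kj].
  by rewrite hsum_projE hsumZE P0E eqxx.
by rewrite hsum_projE hsumZE P0E eq_sym (negbTE kj) scaler0.
Qed.

Let kappa i j u v : inner (F i u) v + inner u (F j v) =
  \sum_(k < d) (1 - Num.conj (z j 0 k) * z i 0 k) * inner (h k i u) (h k j v).
Proof.
rewrite addrC -adjPl -ipDl -op_addE agler op_sumE ip_suml.
by apply: eq_bigr => k _; rewrite !opE ipZl adjPl.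
Qed.

Let kappa0 i u v : inner (F i u) v + inner u (F i0 v) = inner (G0 i u) (G0 i0 v).
Proof.
rewrite kappa ip_G0; apply: eq_bigr => k _.
by rewrite z0 mxE conjC0 mul0r subr0 mul1r.
Qed.

Let kappa0l j u v : inner (F i0 u) v + inner u (F j v) = inner (G0 i0 u) (G0 j v).
Proof.
rewrite kappa ip_G0; apply: eq_bigr => k _.
by rewrite z0 mxE mulr0 subr0 mul1r.
Qed.

Let gram_shift i j u v :
  inner (pencil P0 (z i) (G0 i u)) (pencil P0 (z j) (G0 j v)) =
  inner (G0 i u - G0 i0 u) (G0 j v - G0 i0 v).
Proof.
have -> : inner (pencil P0 (z i) (G0 i u)) (pencil P0 (z j) (G0 j v)) =
    inner (G0 i u) (G0 j v) - (inner (F i u) v + inner u (F j v)).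
  rewrite kappa ip_G0 inner_hsum -sumrB; apply: eq_bigr => k _.
  by rewrite !pencil_P0E !pr_G0 ipZl ipZr; ring.
rewrite !ipBl !ipBr -kappa0 -kappa0l -kappa0; ring.
Qed.

Let ex_P k : exists Q : bounded_op X2 X2, forall x b, Q x b = P0 k (x b).
Proof.
exists (\sum_b (qr b)^*o *o P0 k *o qr b) => x b.
rewrite op_sumE hsum_sumE (bigD1 b)//= big1 => [|c cb].
  by rewrite addr0 /qr hsum_inj_E hsum_single_same !hsum_projE.
by rewrite /qr hsum_inj_E hsum_single_other.
Qed.

Let P k := projT1 (cid (ex_P k)).

Let PE k x b : P k x b = P0 k (x b).
Proof. by rewrite /P; case: cid. Qed.

Let P_spectral : spectral_decomposition P.
Proof.
split=> [k|].
  split.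
    apply: op_ext => x; apply: hsum_ext => b; rewrite opE !PE.
    by apply: hsum_ext => j; rewrite !P0E; case: eqP.
  apply: adj_uniq => x y; rewrite !inner_hsum; apply: eq_bigr => b _.
  rewrite !PE !inner_hsum; apply: eq_bigr => j _; rewrite !P0E.
  by case: eqP; rewrite ?ip0l ?ip0r.
apply: op_ext => x; apply: hsum_ext => b; apply: hsum_ext => j.
rewrite op_sumE !hsum_sumE (bigD1 j)//= big1 => [|k kj]; rewrite PE P0E.
  by rewrite eqxx addr0.
by rewrite eq_sym (negbTE kj).
Qed.

(** The two factorisations of [F i^* + F j] given by the hypothesis have equal
    Gram kernels, so that [P(z_i) G_i u |-> G_i u - G_0 u] is isometric. *)
Lemma lurking_isometry : exists (Y : hilbertType R) (Q : 'I_d -> bounded_op Y Y)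
    (A : bounded_op Y Y) (B : bounded_op U Y),
  [/\ spectral_decomposition Q,
      A^*o *o A = op_id Y /\ A *o A^*o = op_id Y,
      F i0 + (F i0)^*o = B^*o *o B
    & forall i, exists G : bounded_op U Y,
        G - A *o pencil Q (z i) *o G = B /\ F i = F i0 + B^*o *o (G - B)].
Proof.
have [|V [Va VVa /halmos_unitary AA]] := @partial_isometry_extension R X (I * U)
  (fun p => pencil P0 (z p.1) (G0 p.1 p.2)) (fun p => G0 p.1 p.2 - G0 i0 p.2).
  by move=> p q; exact: gram_shift.
have qqE x : qr true ((qr true)^*o x) = x.
  by have := op_eqP x (hsum_proj_inj (fun _ : bool => X) true); rewrite !opE.
exists X2, P, (halmos V), ((qr true)^*o *o G0 i0); split=> //.
- apply: op_ext => u; apply: ip_inj => v.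
  by rewrite !opE ipDl !adjPl !opE qqE kappa0.
- move=> i; exists ((qr true)^*o *o G0 i); split; apply: op_ext => u.
  + rewrite !opE; apply/eqP; rewrite subr_eq; apply/eqP.
    pose single (x : X) : X2 := hsum_single (H := fun _ : bool => X) (i := true) x.
    have gE x : (qr true)^*o x = single x by exact: hsum_inj_E.
    have gT x : single x true = x by exact: hsum_single_same.
    have gF x : single x false = 0 by exact: hsum_single_other.
    have pE b : pencil P (z i) (single (G0 i u)) b =
        pencil P0 (z i) (single (G0 i u) b).
      by rewrite !pencilE hsum_sumE; apply: eq_bigr => k _; rewrite hsumZE PE.
    rewrite !gE; apply: hsum_ext => b; rewrite hsumDE.
    have [hT hF] := halmosE V (pencil P (z i) (single (G0 i u))).
    case: b; rewrite ?hT ?hF !pE ?gT ?gF !linear0 ?subr0 ?addr0.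
      by rewrite (Va (i, u)) addrC subrK.
    by rewrite (VVa (i, u)) subrr addr0.
  + apply: ip_inj => v; rewrite !opE adjM adjK !opE linearB/= !qqE.
    rewrite ipDl adjPl ipBl -!kappa0; ring.
Qed.

End LurkingIsometry.

(** * Absolutely summable families and multi-indices *)

Section Summation.
Context {R : realType}.
Local Notation C := R[i].

Lemma ler_sum_uniq_sub (I : eqType) (s1 s2 : seq I) (f : I -> R) :
  uniq s1 -> {subset s1 <= s2} -> (forall i, 0 <= f i) ->
  \sum_(i <- s1) f i <= \sum_(i <- s2) f i.
Proof.
move=> u1 s12 f0; elim: s1 s2 u1 s12 => [|i s1 IH] s2 /=.
  by rewrite big_nil sumr_ge0.
move=> /andP[is1 u1] s12.
have is2 : i \in s2 by apply: s12; rewrite inE eqxx.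
rewrite big_cons (perm_big _ (perm_to_rem is2)) big_cons lerD2l; apply: IH => // j js.
have := s12 j; rewrite inE js orbT => /(_ isT).
rewrite (perm_mem (perm_to_rem is2)) inE => /orP[/eqP ji|//].
by rewrite -ji js in is1.
Qed.

Lemma partial_sumE (I : choiceType) (V : zmodType) (a : I -> V) (J : {fset I}) :
  partial_sum a J = \sum_(i <- J) a i.
Proof. by rewrite /partial_sum big_seq_fsetE. Qed.

Lemma sum_fsubset (I : choiceType) (V : zmodType) (a : I -> V) (J J' : {fset I}) :
  (J `<=` J')%fset ->
  \sum_(i <- J') a i = \sum_(i <- J) a i + \sum_(i <- (J' `\` J)%fset) a i.
Proof.
move=> JJ'; rewrite -big_cat/=; apply: perm_big; apply: uniq_perm => [//||i].
  rewrite cat_uniq !fset_uniq/= andbT; apply/hasPn => i /=.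
  by rewrite in_fsetD => /andP[].
rewrite mem_cat in_fsetD; have := fsubsetP JJ' i.
by case: (i \in J) => //= /(_ isT).
Qed.

(** The supremum of the finite partial sums is almost attained at [J0], which
    leaves little for the indices outside. *)
Lemma sum_tail_small (I : choiceType) (b : I -> R) (M e : R) :
  (forall i, 0 <= b i) -> (forall J : {fset I}, \sum_(i <- J) b i <= M) -> 0 < e ->
  exists J0 : {fset I}, forall J : {fset I}, [disjoint J & J0]%fset ->
    \sum_(i <- J) b i < e.
Proof.
move=> b0 bM e0.
pose A : set R := [set r | exists J : {fset I}, r = \sum_(i <- J) b i].
have Asup : has_sup A.
  split; first by exists (\sum_(i <- fset0) b i), fset0.
  by exists M => _ [J ->].
have [_ [J0 ->] lt0] := sup_adherent e0 Asup.
exists J0 => J JJ0.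
have JE : \sum_(i <- (J0 `|` J)%fset) b i = \sum_(i <- J0) b i + \sum_(i <- J) b i.
  have : ((J0 `|` J) `\` J0 = J)%fset.
    by rewrite fsetDUl fsetDv fset0U; apply/fsetDidPl.
  by move=> {2}<-; rewrite -sum_fsubset ?fsubsetUl.
have h : \sum_(i <- J0) b i + \sum_(i <- J) b i <= sup A.
  by rewrite -JE; apply: ub_le_sup; [exact: Asup.2|exists (J0 `|` J)%fset].
lra.
Qed.

(** Pointwise limits exist by completeness of [W], and the operator norm estimates
    pass to them. *)
Lemma op_cauchy_cvg (V : normedModType C) (W : completeNormedModType C) (T : Type)
    (F : set_system T) (FF : ProperFilter F) (f : T -> bounded_op V W) :
  (forall e : R, 0 < e -> exists A : set T, F A /\
    forall s t, A s -> A t -> rnorm (f s - f t) < e) ->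
  exists l : bounded_op V W, f @ F --> l.
Proof.
move=> fF.
have ptw x : exists y : W, (fun t => f t x) @ F --> y.
  apply: rcauchy_cvg => e e0.
  have e1 : 0 < e / (rnorm x + 1) by rewrite divr_gt0// ltr_wpDl ?rnorm_ge0.
  have [A [FA fA]] := fF _ e1; exists A; split=> // s t As At.
  have := fA s t As At; rewrite ltr_pdivlMr ?ltr_wpDl ?rnorm_ge0// => lt_e.
  have := rnorm_op (f s - f t) x; rewrite -[(f s - f t) x]/(f s x - f t x).
  have := rnorm_ge0 (f s - f t); have := rnorm_ge0 x; nra.
have [g gP] := choice ptw.
have [A1 [FA1 fA1]] := fF 1 ltr01.
have [t1 At1] := filter_ex FA1.
have [||l lE] := @op_intro R V W g (rnorm (f t1) + 1).
- move=> a u v; apply: (rcvg_uniq FF (gP (a *: u + v))).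
  have -> : (fun t => f t (a *: u + v)) = (fun t => a *: f t u + f t v).
    by apply/funext => t; rewrite linearP.
  by apply: cvgD => //; apply: cvgZr.
- move=> x; apply: (rcvg_le FF (gP x)); apply: filterS FA1 => t At.
  rewrite (le_trans (rnorm_op _ _))// ler_wpM2r ?rnorm_ge0//.
  have := rnormD (f t - f t1) (f t1); rewrite subrK.
  by have := fA1 _ _ At At1; lra.
exists l; apply/rcvgP => e e0.
have e2 : 0 < e / 2 by rewrite divr_gt0.
have [A [FA fA]] := fF _ e2.
apply: (filterS _ FA) => s As; apply: le_lt_trans (_ : e / 2 < e); last by lra.
apply: rnorm_op_le => [|x]; first exact: ltW.
rewrite -[(l - f s) x]/(l x - f s x) lE.
have cv : (fun t => f t x - f s x) @ F --> g x - f s x.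
  by apply: cvgB; [exact: gP|exact: cvg_cst].
apply: (rcvg_le FF cv); apply: filterS FA => t At.
rewrite -[f t x - f s x]/((f t - f s) x) (le_trans (rnorm_op _ _))//.
by rewrite ler_wpM2r ?rnorm_ge0// ltW// fA.
Qed.

Lemma partial_sum_cauchy (I : choiceType) (V : normedModType C)
    (a : I -> V) (b : I -> R) (M : R) :
  (forall i, rnorm (a i) <= b i) -> (forall J : {fset I}, \sum_(i <- J) b i <= M) ->
  forall e : R, 0 < e -> exists A : set {fset I}, totally A /\
    forall J J', A J -> A J' -> rnorm (partial_sum a J - partial_sum a J') < e.
Proof.
move=> ab bM e e0; have b0 i : 0 <= b i by exact: le_trans (rnorm_ge0 _) (ab i).
have e2 : 0 < e / 2 by rewrite divr_gt0.
have [J0 J0P] := sum_tail_small b0 bM e2.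
exists [set J | (J0 `<=` J)%fset]; split; first by exists J0.
have tail J : (J0 `<=` J)%fset -> rnorm (partial_sum a J - partial_sum a J0) < e / 2.
  move=> J0J; rewrite !partial_sumE (sum_fsubset _ J0J) addrC addKr.
  rewrite (le_lt_trans (rnorm_sum _ _ _))// (le_lt_trans (ler_sum _ (fun i _ => ab i)))//.
  by apply: J0P; apply/fdisjointP => i; rewrite in_fsetD => /andP[].
move=> J J' /tail h1 /tail h2; rewrite [e]splitr.
exact: le_lt_trans (rnorm_tri _ _ _) (ltrD h1 h2).
Qed.

Lemma vec_summable (I : choiceType) (V : completeNormedModType C)
    (a : I -> V) (b : I -> R) (M : R) :
  (forall i, rnorm (a i) <= b i) -> (forall J : {fset I}, \sum_(i <- J) b i <= M) ->
  exists l : V, partial_sum a @ totally --> l.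
Proof.
by move=> ab bM; apply: (rcauchy_cvg (@totally_filter I)); exact: partial_sum_cauchy bM.
Qed.

Lemma op_summable (I : choiceType) (V : normedModType C) (W : completeNormedModType C)
    (a : I -> bounded_op V W) (b : I -> R) (M : R) :
  (forall i, rnorm (a i) <= b i) -> (forall J : {fset I}, \sum_(i <- J) b i <= M) ->
  exists S : bounded_op V W, partial_sum a @ totally --> S.
Proof.
by move=> ab bM; apply: (op_cauchy_cvg (@totally_filter I)); exact: partial_sum_cauchy bM.
Qed.

End Summation.

Section Multiindices.
Context {R : realType} {d : nat}.
Local Notation C := R[i].
Local Notation midx := (multiindex (d := d)).
Implicit Types n : midx.

Definition mdeg n : nat := \sum_k n k.
Definition mdec n (k : 'I_d) : midx := [ffun j => if j == k then (n j).-1 else n j].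
Definition minc n (k : 'I_d) : midx := [ffun j => if j == k then (n j).+1 else n j].
Definition m0 : midx := [ffun=> 0%N].

Lemma mincK k : cancel (minc^~ k) (mdec^~ k).
Proof. by move=> n; apply/ffunP => j; rewrite !ffunE; case: eqP. Qed.

Lemma mdecK n k : (0 < n k)%N -> minc (mdec n k) k = n.
Proof.
move=> nk; apply/ffunP => j; rewrite !ffunE; case: eqP => // ->.
by rewrite prednK.
Qed.

Lemma mdeg_minc n k : mdeg (minc n k) = (mdeg n).+1.
Proof.
rewrite /mdeg (bigD1 k)//= [in RHS](bigD1 k)//= !ffunE eqxx addSn.
congr (_ + _).+1; apply: eq_bigr => j jk; by rewrite ffunE (negbTE jk).
Qed.

Lemma mdeg_mdec n k : (0 < n k)%N -> mdeg n = (mdeg (mdec n k)).+1.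
Proof. by move=> nk; rewrite -{1}(mdecK nk) mdeg_minc. Qed.

Lemma mdeg0 : mdeg m0 = 0%N.
Proof. by rewrite /mdeg big1// => k _; rewrite ffunE. Qed.

Lemma mdeg_eq0 n : (mdeg n == 0%N) = (n == m0).
Proof.
apply/idP/eqP => [|->]; last by rewrite mdeg0.
rewrite /mdeg sum_nat_eq0 => /forallP h; apply/ffunP => k; rewrite ffunE.
by apply/eqP; exact: h.
Qed.

Lemma monomial_minc (z : 'rV[C]_d) n k : monomial z (minc n k) = z 0 k * monomial z n.
Proof.
rewrite /monomial (bigD1 k)//= [in RHS](bigD1 k)//= !ffunE eqxx exprS mulrA.
by congr (_ * _); apply: eq_bigr => j jk; rewrite ffunE (negbTE jk).
Qed.

Lemma monomial_m0 (z : 'rV[C]_d) : monomial z m0 = 1.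
Proof. by rewrite /monomial big1// => k _; rewrite ffunE expr0. Qed.

Lemma rnormX (a : C) m : rnorm (a ^+ m) = rnorm a ^+ m.
Proof.
elim: m => [|m IH]; first by rewrite !expr0 /rnorm normr1.
by rewrite !exprS rnormM IH.
Qed.

Lemma rnorm_prod (I : Type) (r : seq I) (f : I -> C) :
  rnorm (\prod_(i <- r) f i) = \prod_(i <- r) rnorm (f i).
Proof.
elim: r => [|i r IH]; first by rewrite !big_nil /rnorm normr1.
by rewrite !big_cons rnormM IH.
Qed.

Lemma rnorm_monomial (z : 'rV[C]_d) n (r : R) : (forall k, rnorm (z 0 k) <= r) ->
  rnorm (monomial z n) <= r ^+ mdeg n.
Proof.
move=> zr; rewrite /monomial rnorm_prod /mdeg expr_sum.
apply: ler_prod => k _; rewrite rnorm_ge0 rnormX/=.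
by rewrite lerXn2r// ?nnegrE ?rnorm_ge0// (le_trans (rnorm_ge0 _) (zr k)).
Qed.

(** A finite set of multi-indices lies in a cube, on which the sum is a product of
    geometric sums. *)
Lemma sum_mdeg_bound (r : R) : 0 <= r < 1 -> forall J : {fset midx},
  \sum_(n <- J) r ^+ mdeg n <= (1 - r)^-1 ^+ d.
Proof.
move=> /andP[r0 r1] J.
have [N NP] : exists N, forall n, n \in J -> forall k, (n k < N)%N.
  exists (\sum_(n <- J) mdeg n).+1 => n nJ k; rewrite ltnS.
  rewrite (big_rem n)//= (leq_trans _ (leq_addr _ _))//.
  by rewrite /mdeg (bigD1 k)//= leq_addr.
pose up (f : {ffun 'I_d -> 'I_N}) : midx := [ffun k => f k : nat].
apply: le_trans (_ : \sum_(n <- map up (enum {ffun 'I_d -> 'I_N})) r ^+ mdeg n <= _).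
  apply: ler_sum_uniq_sub; first exact: fset_uniq.
    move=> n nJ; apply/mapP; exists [ffun k => Ordinal (NP n nJ k)].
      by rewrite mem_enum.
    by apply/ffunP => k; rewrite !ffunE.
  by move=> n; rewrite exprn_ge0.
rewrite big_map big_enum/=.
have -> : \sum_(f : {ffun 'I_d -> 'I_N}) r ^+ mdeg (up f) =
    \prod_(k < d) \sum_(i < N) r ^+ i.
  rewrite bigA_distr_bigA/=; apply: eq_bigr => f _.
  by rewrite /mdeg expr_sum; apply: eq_bigr => k _; rewrite ffunE.
rewrite prodr_const card_ord; apply: lerXn2r; rewrite ?nnegrE.
- by apply: sumr_ge0 => i _; rewrite exprn_ge0.
- by rewrite invr_ge0 subr_ge0 ltW.
- have r10 : 0 < 1 - r by rewrite subr_gt0.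
  rewrite -[X in _ <= X]div1r ler_pdivlMr//.
  have := subrX1 r N; have : 0 <= r ^+ N by rewrite exprn_ge0.
  move: (\sum_(i < N) _) (r ^+ N) => s t; lra.
Qed.

End Multiindices.

(** * Spectral decompositions and the power series of the resolvent *)

Section SpectralDecomposition.
Context {R : realType} {d : nat} {X : hilbertType R}.
Local Notation C := R[i].
Variable P : 'I_d -> bounded_op X X.
Hypothesis Pspec : spectral_decomposition P.

Lemma spectral_idem k x : P k (P k x) = P k x.
Proof. by have [PP _] := Pspec.1 k; exact: (op_eqP x PP). Qed.

Lemma spectral_sa k x y : inner (P k x) y = inner x (P k y).
Proof. by rewrite adjP; case: (Pspec.1 k) => _ ->. Qed.

Lemma spectral_sum x : \sum_k P k x = x.
Proof. by rewrite -op_sumE Pspec.2. Qed.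

Lemma rnorm_spectral x : rnorm x ^+ 2 = \sum_k rnorm (P k x) ^+ 2.
Proof.
apply: complexI; rewrite -ip_self -{1}[x]spectral_sum ip_suml rmorph_sum/=.
by apply: eq_bigr => k _; rewrite -ip_self -[in LHS]spectral_idem spectral_sa.
Qed.

(** Orthogonality of the ranges is forced by Pythagoras: all the length of
    [P k x] is already in its [k]-th component. *)
Lemma spectral_orth j k x : j != k -> P j (P k x) = 0.
Proof.
move=> jk; apply: rnorm_eq0; apply/eqP; rewrite -sqrf_eq0; apply/eqP.
have := rnorm_spectral (P k x); rewrite (bigD1 k)//= spectral_idem.
rewrite (bigD1 j)//= => h.
have : 0 <= \sum_(i | (i != k) && (i != j)) rnorm (P i (P k x)) ^+ 2.
  by apply: sumr_ge0 => i _; rewrite sqr_ge0.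
have := sqr_ge0 (rnorm (P j (P k x))).
move: h; move: (rnorm (P j _) ^+ 2) (rnorm (P k x) ^+ 2) (\sum_(i | _) _) => a b c.
lra.
Qed.

Lemma rnorm_spectral_sum (y : 'I_d -> X) :
  rnorm (\sum_k P k (y k)) ^+ 2 = \sum_k rnorm (P k (y k)) ^+ 2.
Proof.
rewrite rnorm_spectral; apply: eq_bigr => k _; congr (rnorm _ ^+ 2).
rewrite linear_sum (bigD1 k)//= spectral_idem big1 ?addr0// => j jk.
by rewrite spectral_orth// eq_sym.
Qed.

(** Orthogonality of the ranges bounds the pencil by the largest coefficient, where
    the triangle inequality would give the sum of the coefficients. *)
Lemma rnorm_pencil (z : 'rV[C]_d) (r : R) x : (forall k, rnorm (z 0 k) <= r) ->
  rnorm (pencil P z x) <= r * rnorm x.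
Proof.
move=> zr; have [->|x0] := eqVneq x 0; first by rewrite linear0 !rnorm0 mulr0.
have [d0|d0] := posnP d.
  move: x0; rewrite -(spectral_sum x) big1 ?eqxx// => -[k] kd.
  by exfalso; move: kd; rewrite d0.
have r0 : 0 <= r by exact: le_trans (rnorm_ge0 _) (zr (Ordinal d0)).
rewrite -(@ler_pXn2r _ 2)// ?nnegrE ?mulr_ge0 ?rnorm_ge0//.
rewrite pencilE; under eq_bigr do rewrite -linearZ.
rewrite rnorm_spectral_sum exprMn (rnorm_spectral x) mulr_sumr; apply: ler_sum => k _.
rewrite linearZ rnormZ exprMn ler_wpM2r ?sqr_ge0// lerXn2r// nnegrE rnorm_ge0//.
Qed.

End SpectralDecomposition.

Section PowerSeries.
Context {R : realType} {d : nat} {X : hilbertType R}.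
Local Notation C := R[i].
Local Notation midx := (multiindex (d := d)).
Variables (P : 'I_d -> bounded_op X X) (A : bounded_op X X).
Hypothesis Pspec : spectral_decomposition P.
Hypothesis Aiso : A^*o *o A = op_id X.

(** The part of degree [l] of [(I - P(z)A)^-1] is [(P(z)A)^l]; the coefficient at
    [n] collects the words [P_k1 A ... P_kl A] in which [k] occurs [n k] times,
    and the recursion is on the first letter. *)
Fixpoint hom_coef (l : nat) (n : midx) : bounded_op X X :=
  if l is l.+1 then
    \sum_k if (0 < n k)%N then P k *o A *o hom_coef l (mdec n k) else 0
  else if n == m0 then op_id X else 0.

Definition res_coef (n : midx) := hom_coef (mdeg n) n.

Lemma res_coef_rec n : res_coef n = (if n == m0 then op_id X else 0) +
  \sum_k if (0 < n k)%N then P k *o A *o res_coef (mdec n k) else 0.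
Proof.
have [->|n0] := eqVneq n m0.
  rewrite /res_coef mdeg0/= eqxx big1 ?addr0// => k _.
  by rewrite ffunE ltnn.
rewrite add0r /res_coef; case E : (mdeg n) => [|l].
  by move/eqP : E; rewrite mdeg_eq0 (negbTE n0).
apply: eq_bigr => k _; case: ifP => // nk; congr (_ *o hom_coef _ _).
by move: E; rewrite (mdeg_mdec nk) => -[].
Qed.

Lemma spectral_isometry_ip x y :
  inner x y = \sum_k inner (P k (A x)) (P k (A y)).
Proof.
have -> : inner x y = inner (A x) (A y).
  by rewrite adjP; have := op_eqP y Aiso; rewrite !opE => ->.
rewrite -{1}(spectral_sum Pspec (A x)) ip_suml; apply: eq_bigr => k _.
by rewrite -[in LHS](spectral_idem Pspec) (spectral_sa Pspec).
Qed.

(** The coefficients of degree [l] form a row of length at most one: this is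
    where the exponential number of words of length [l] is compensated. *)
Lemma hom_coef_row l (s : seq midx) x : uniq s ->
  \sum_(n <- s) rnorm (hom_coef l n x) ^+ 2 <= rnorm x ^+ 2.
Proof.
elim: l s x => [|l IH] s x us.
  apply: le_trans (_ : \sum_(n <- m0 :: rem m0 s) rnorm (hom_coef 0 n x) ^+ 2 <= _).
    apply: ler_sum_uniq_sub => // [n ns|n]; last by rewrite sqr_ge0.
    by rewrite inE (mem_rem_uniq _ us) inE ns; case: eqP.
  rewrite big_cons big_seq big1 ?addr0 /= ?eqxx// => n.
  by rewrite (mem_rem_uniq _ us) inE => /andP[/negbTE -> _]; rewrite opE rnorm0 expr0n.
pose f k (m : midx) := rnorm (P k (A (hom_coef l m x))) ^+ 2.
have f0 k m : 0 <= f k m by rewrite sqr_ge0.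
have step n : rnorm (hom_coef l.+1 n x) ^+ 2 =
    \sum_k if (0 < n k)%N then f k (mdec n k) else 0.
  rewrite /= op_sumE.
  have -> : \sum_k (if (0 < n k)%N then P k *o A *o hom_coef l (mdec n k) else 0) x =
     \sum_k P k (if (0 < n k)%N then A (hom_coef l (mdec n k) x) else 0).
    by apply: eq_bigr => k _; case: ifP => _; rewrite !opE ?linear0.
  rewrite (rnorm_spectral_sum Pspec); apply: eq_bigr => k _.
  by case: ifP => // _; rewrite linear0 rnorm0 expr0n.
under eq_bigr do rewrite step.
rewrite exchange_big/=.
pose sk k := map (mdec^~ k) [seq n : midx <- s | (0 < n k)%N].
pose s' := undup (flatten [seq sk k | k <- enum 'I_d]).
apply: le_trans (_ : \sum_k \sum_(m <- s') f k m <= _).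
  apply: ler_sum => k _; rewrite -big_mkcond -big_filter -(big_map (mdec^~ k) xpredT (f k)).
  apply: ler_sum_uniq_sub => //.
    rewrite map_inj_in_uniq ?filter_uniq// => n n'.
    rewrite !mem_filter => /andP[nk _] /andP[n'k _] E.
    by rewrite -(mdecK nk) E mdecK.
  move=> m mk; rewrite mem_undup; apply/flattenP.
  by exists (sk k) => //; apply: map_f; rewrite mem_enum.
rewrite exchange_big/=; apply: le_trans (IH s' x (undup_uniq _)).
by apply: ler_sum => m _; rewrite -(rnorm_spectral Pspec) (rnorm_isometry Aiso).
Qed.

Lemma rnorm_res_coef n : rnorm (res_coef n) <= 1.
Proof.
apply: rnorm_op_le => // x; rewrite mul1r.
rewrite -(@ler_pXn2r _ 2)// ?nnegrE ?rnorm_ge0//.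
by have := @hom_coef_row (mdeg n) [:: n] x isT; rewrite big_seq1.
Qed.

End PowerSeries.

Section Shift.
Context {d : nat}.
Local Notation midx := (multiindex (d := d)).

(** The recursion of [res_coef] expresses the partial sum over [J] by the partial
    sums over the sets [mdown k J]. *)
Definition mdown (k : 'I_d) (J : {fset midx}) : {fset midx} :=
  [fset m in [seq mdec n k | n : midx <- [seq n : midx <- J | (0 < n k)%N]]]%fset.

Lemma mem_mdown k J m : (m \in mdown k J) = (minc m k \in J).
Proof.
rewrite inE/=; apply/mapP/idP => [[n]|mJ].
  by rewrite mem_filter => /andP[nk nJ] ->; rewrite mdecK.
by exists (minc m k); rewrite ?mincK// mem_filter mJ andbT ffunE eqxx.
Qed.

Lemma sum_mdown (V : zmodType) k (J : {fset midx}) (f : midx -> V) :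
  \sum_(m <- mdown k J) f m = \sum_(n <- J | (0 < n k)%N) f (mdec n k).
Proof.
rewrite -[RHS]big_filter -(big_map (mdec^~ k) xpredT f); apply: perm_big.
apply: uniq_perm; first exact: fset_uniq.
  rewrite map_inj_in_uniq ?filter_uniq ?fset_uniq// => n n'.
  rewrite !mem_filter => /andP[nk _] /andP[n'k _] E.
  by rewrite -(mdecK nk) E mdecK.
by move=> m; rewrite inE.
Qed.

Lemma mdown_totally k : mdown k @ totally --> totally.
Proof.
move=> A [J0 _ J0A]; exists [fset minc m k | m in J0]%fset => // J J0J; apply: J0A.
apply/fsubsetP => m mJ0; rewrite mem_mdown; apply: (fsubsetP J0J).
exact: in_imfset.
Qed.

Lemma totally_mem (I : choiceType) (i : I) : \forall J \near totally, i \in J.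
Proof. by exists [fset i]%fset => // J /=; rewrite fsub1set. Qed.

End Shift.

Lemma ex_radius (R : realFieldType) d (f : 'I_d -> R) :
  (forall k, f k < 1) -> exists r, 0 <= r < 1 /\ forall k, f k <= r.
Proof.
move=> f1; exists (\big[Num.max/0]_k f k); split=> [|k]; last exact: le_bigmax.
by rewrite bigmax_ge_id/= bigmax_lt// => k _; exact: f1.
Qed.

Lemma rcvg_sum (R : realType) (V : normedModType R[i]) (T I : Type)
    (F : set_system T) (FF : Filter F) (r : seq I) (f : I -> T -> V) (l : I -> V) :
  (forall i, f i @ F --> l i) ->
  (fun t => \sum_(i <- r) f i t) @ F --> \sum_(i <- r) l i.
Proof.
move=> fl; elim: r => [|i r IH].
  rewrite big_nil; have -> : (fun t => \sum_(i <- [::]) f i t) = cst 0.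
    by apply/funext => t; rewrite big_nil.
  exact: cvg_cst.
rewrite big_cons; have -> : (fun t => \sum_(i <- i :: r) f i t) =
    (fun t => f i t + \sum_(i <- r) f i t).
  by apply/funext => t; rewrite big_cons.
exact: cvgD.
Qed.

Lemma rcvg_eval (R : realType) (V W : normedModType R[i]) (T : Type)
    (F : set_system T) (FF : Filter F) (f : T -> bounded_op V W) (l : bounded_op V W) x :
  f @ F --> l -> (fun t => f t x) @ F --> l x.
Proof.
move=> /rcvgP fl; apply/rcvgP => e e0.
have e1 : 0 < e / (rnorm x + 1) by rewrite divr_gt0// ltr_wpDl ?rnorm_ge0.
apply: filterS (fl _ e1) => t.
rewrite ltr_pdivlMr ?ltr_wpDl ?rnorm_ge0// => lt_e.
apply: le_lt_trans (rnorm_op (l - f t) x) _.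
have := rnorm_ge0 (l - f t); have := rnorm_ge0 x; nra.
Qed.

Section Resolvent.
Context {R : realType} {d : nat} {X : hilbertType R}.
Local Notation C := R[i].
Local Notation midx := (multiindex (d := d)).
Variables (P : 'I_d -> bounded_op X X) (A : bounded_op X X).
Hypothesis Pspec : spectral_decomposition P.
Hypothesis Aiso : A^*o *o A = op_id X.

Lemma polydisk_radius (z : 'rV[C]_d) : polydisk d z ->
  exists r, 0 <= r < 1 /\ forall k, rnorm (z 0 k) <= r.
Proof.
by move=> zD; apply: ex_radius => k; have := zD k; rewrite rnormE ltcR.
Qed.

Let term z n := monomial z n *: res_coef P A n.

Lemma res_series (z : 'rV[C]_d) : polydisk d z ->
  exists S : bounded_op X X, partial_sum (term z) @ totally --> S.
Proof.
move=> /polydisk_radius[r [r01 zr]].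
apply: (op_summable _ (@sum_mdeg_bound R d r r01)) => n.
rewrite rnormZ -[X in _ <= X]mulr1 ler_pM ?rnorm_ge0//.
  exact: rnorm_monomial.
exact: rnorm_res_coef.
Qed.

(** The recursion of the coefficients, summed over [J]; it passes to the limit
    because [mdown k J] is eventually as large as desired. *)
Lemma res_series_fix z (S : bounded_op X X) :
  partial_sum (term z) @ totally --> S -> forall x, S x = x + pencil P z (A (S x)).
Proof.
move=> cvS x; have FF := @totally_filter midx.
have cvx : (fun J => partial_sum (term z) J x) @ totally --> S x.
  exact: (rcvg_eval FF cvS).
apply: (rcvg_uniq FF cvx).
have cvk k : (fun J => z 0 k *: P k (A (partial_sum (term z) (mdown k J) x)))
    @ totally --> z 0 k *: P k (A (S x)).
  apply: cvgZr; apply: (rcvg_op FF); apply: (rcvg_op FF).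
  exact: cvg_comp (@mdown_totally d k) cvx.
have cvR : (fun J => x + \sum_k z 0 k *: P k (A (partial_sum (term z) (mdown k J) x)))
    @ totally --> x + pencil P z (A (S x)).
  apply: cvgD; first exact: cvg_cst.
  by rewrite pencilE; exact: (rcvg_sum FF).
apply: cvg_trans cvR; apply: near_eq_cvg.
apply: filterS (totally_mem (m0 : midx)) => J J0.
rewrite partial_sumE op_sumE.
under [RHS]eq_bigr => n _.
  rewrite /term opE res_coef_rec opE op_sumE scalerDr scaler_sumr.
  over.
rewrite big_split/=; congr (_ + _).
  rewrite (big_rem m0)//= eqxx monomial_m0 scale1r opE big_seq big1 ?addr0// => n.
  by rewrite (mem_rem_uniq _ (fset_uniq _)) inE => /andP[/negbTE -> _]; rewrite opE scaler0.
rewrite exchange_big/=; apply: eq_bigr => k _.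
rewrite partial_sumE op_sumE !linear_sum/= sum_mdown [RHS]big_mkcond/= [LHS]big_mkcond/=.
apply: eq_bigr => n _; case: ifP => nk; last by rewrite opE scaler0.
by rewrite /term !opE !linearZ/= scalerA mulrC -monomial_minc mdecK.
Qed.

Lemma contraction_id_injective (E : bounded_op X X) (r : R) x : r < 1 ->
  (forall y, rnorm (E y) <= r * rnorm y) -> x = E x -> x = 0.
Proof.
move=> r1 Er xE; apply: rnorm_eq0; have := Er x; rewrite -xE.
have := rnorm_ge0 x; nra.
Qed.

(** The series is a right inverse by its fixed point equation, and a left inverse
    because [P(z)A] is a strict contraction. *)
Lemma res_series_inv z (S : bounded_op X X) : polydisk d z ->
  partial_sum (term z) @ totally --> S ->
  op_inv (op_id X - pencil P z *o A) = S /\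
  (op_id X - pencil P z *o A) *o S = op_id X.
Proof.
move=> /polydisk_radius[r [/andP[r0 r1] zr]] /res_series_fix Sfix.
have E1 : (op_id X - pencil P z *o A) *o S = op_id X.
  by apply: op_ext => x; rewrite !opE {1}Sfix addrK.
have E2 : S *o (op_id X - pencil P z *o A) = op_id X.
  apply: op_ext => x; rewrite opE op_idE; apply/eqP; rewrite -subr_eq0; apply/eqP.
  apply: (@contraction_id_injective (pencil P z *o A) r) => // [y|].
    by rewrite opE (le_trans (rnorm_pencil Pspec _ zr))// (rnorm_isometry Aiso).
  have := Sfix ((op_id X - pencil P z *o A) x); rewrite !opE.
  move: (S _) => y yE; rewrite !linearB/= {1}yE.
  by apply: ip_inj => w; rewrite !ipE; ring.
split=> //; rewrite /op_inv; case: xgetP => [B _ [B1 B2]|/(_ S)[]//].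
apply: op_ext => x; have := op_eqP (S x) B1; rewrite !opE => h.
have := op_eqP x E1; rewrite !opE => h'.
by rewrite -[RHS]h -[in LHS]h' linearB.
Qed.

End Resolvent.

(** * Transfer functions of unitary colligations *)

Section Differentiability.
Context {R : realType} {V W : normedModType R[i]}.
Local Notation C := R[i].

Lemma near0_rnorm (r : R) : 0 < r -> \forall h \near (0 : V), rnorm h < r.
Proof.
move=> r0; have /rcvgP/(_ _ r0) : (fun h : V => h) @ (0 : V) --> (0 : V) by [].
by apply: filterS => h; rewrite sub0r rnormN.
Qed.

(** Uniqueness of the differential turns a linear approximation with quadratic
    remainder, as given by the resolvent identity, into differentiability. *)
Lemma differentiable_quadratic (f : V -> W) (x : V) (L : {linear V -> W}) (M r : R) :
  0 < r -> (forall h, rnorm (L h) <= M * rnorm h) ->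
  (forall h, rnorm h < r -> rnorm (f (h + x) - f x - L h) <= M * rnorm h ^+ 2) ->
  differentiable f x.
Proof.
move=> r0 LM fL.
have cL : continuous L.
  move=> y; apply/(@rcvgP _ _ _ (nbhs y)) => e e0.
  have e1 : 0 < e / (`|M| + 1) by rewrite divr_gt0// ltr_wpDl.
  have /rcvgP/(_ _ e1) : (fun h : V => h) @ y --> y by [].
  apply: filterS => h; rewrite ltr_pdivlMr ?ltr_wpDl// => lt_e.
  rewrite -linearB; apply: le_lt_trans (LM _) _.
  have := rnorm_ge0 (y - h); have := ler_norm M; nra.
have dL : f \o shift x = cst (f x) + L +o_ (0 : V) id.
  apply/eqaddoP => e e0.
  have eE : e = (complex.Re e)%:C%C by rewrite RRe_real// gtr0_real.
  rewrite eE in e0 *; rewrite ltcR in e0.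
  have e1 : 0 < complex.Re e / (`|M| + 1) by rewrite divr_gt0// ltr_wpDl.
  apply: filterS2 (near0_rnorm r0) (near0_rnorm e1) => h hr he.
  rewrite -[X in `|X| <= _]/(f (h + x) - (f x + L h)) opprD addrA.
  rewrite !rnormE -rmorphM/= lecR (le_trans (fL _ hr))//.
  move: he; rewrite ltr_pdivlMr ?ltr_wpDl// => he.
  have := rnorm_ge0 h; have := ler_norm M; nra.
have dfE := diff_unique cL dL.
by apply/diff_locallyP; rewrite dfE.
Qed.

End Differentiability.

Lemma rnorm_mx_entry (R : realType) d (h : 'rV[R[i]]_d) k : rnorm (h 0 k) <= rnorm h.
Proof.
rewrite -lecR -!rnormE.
change (`|h 0 k|%:nng%:num <= mx_norm h); rewrite mx_normE num_le.
exact: (le_bigmax _ (fun i : 'I_1 * 'I_d => `|h i.1 i.2|%:nng) (0, k)).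
Qed.

Lemma rnorm_mx_lt (R : realType) d (h : 'rV[R[i]]_d) (e : R) : 0 < e ->
  (forall k, rnorm (h 0 k) < e) -> rnorm h < e.
Proof.
move=> e0 he.
have : ball (0 : 'rV[R[i]]_d) e%:C%C (- h).
  split=> [|i j]; first by rewrite ltcR.
  rewrite -ball_normE /ball_/= !mxE sub0r opprK ord1 rnormE ltcR; exact: he.
by rewrite -ball_normE /ball_/= sub0r opprK rnormE ltcR.
Qed.

Section TransferFunction.
Context {R : realType} {d : nat} {X U : hilbertType R}.
Local Notation C := R[i].
Local Notation midx := (multiindex (d := d)).
Variables (P : 'I_d -> bounded_op X X) (A : bounded_op X X).
Variables (B : bounded_op U X) (Cc : bounded_op X U) (D : bounded_op U U).
Variable F : 'rV[C]_d -> bounded_op U U.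
Hypothesis Pspec : spectral_decomposition P.
Hypothesis Aiso : A^*o *o A = op_id X.
Hypothesis BE : B = A *o Cc^*o.
Hypothesis DE : D + D^*o = Cc *o Cc^*o.
Hypothesis FE : forall z, polydisk d z ->
  F z = D + Cc *o op_inv (op_id X - pencil P z *o A) *o pencil P z *o B.

Definition resolvent (z : 'rV[C]_d) := op_inv (op_id X - pencil P z *o A).

Lemma resolvent_fix z x : polydisk d z ->
  resolvent z x = x + pencil P z (A (resolvent z x)).
Proof.
move=> zD; have [S cvS] := res_series Pspec Aiso zD.
have [SE _] := res_series_inv Pspec Aiso zD cvS.
rewrite /resolvent SE; exact: res_series_fix cvS x.
Qed.

Lemma resolvent_uniq z x y : polydisk d z ->
  y = x + pencil P z (A y) -> y = resolvent z x.
Proof.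
move=> zD yE; have [r [/andP[r0 r1] zr]] := polydisk_radius zD.
apply/eqP; rewrite -subr_eq0; apply/eqP.
apply: (@contraction_id_injective _ _ (pencil P z *o A) r) => // [w|].
  by rewrite opE (le_trans (rnorm_pencil Pspec _ zr))// (rnorm_isometry Aiso).
have := resolvent_fix x zD; move: (resolvent z x) => w wE.
rewrite opE {1}yE {1}wE !linearB/=.
by apply: ip_inj => v; rewrite !ipE; ring.
Qed.

(** Since [S P(z) A = S - I] for the resolvent [S], and [B = A C*], the realisation
    formula reads [D - C C* + C S C*]; this form involves no product with [P(z)]. *)
Lemma transferE z u : polydisk d z ->
  F z u = D u - Cc (Cc^*o u) + Cc (resolvent z (Cc^*o u)).
Proof.
move=> zD; rewrite FE// !opE BE !opE -/(resolvent z).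
have -> : Cc (resolvent z (Cc^*o u)) = Cc (Cc^*o u + resolvent z (pencil P z (A (Cc^*o u)))).
  congr (Cc _); apply/esym/resolvent_uniq => //.
  rewrite {1}resolvent_fix// !linearD/=.
  by apply: ip_inj => v; rewrite !ipE; ring.
by rewrite linearD/= addrA subrK.
Qed.

(** The kernels come from the state space: [A] and the pencil cancel in the
    Herglotz sum up to the factors [1 - conj w_k * z_k]. *)
Lemma transfer_herglotz w z u v : polydisk d w -> polydisk d z ->
  inner (F z u) v + inner u (F w v) =
  \sum_(k < d) (1 - Num.conj (w 0 k) * z 0 k) *
    inner (P k (A (resolvent z (Cc^*o u)))) (P k (A (resolvent w (Cc^*o v)))).
Proof.
move=> wD zD; rewrite !transferE//.
pose x := resolvent z (Cc^*o u); pose y := resolvent w (Cc^*o v).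
rewrite -/x -/y.
have hx : Cc^*o u = x - pencil P z (A x) by rewrite {1}/x resolvent_fix// addrK.
have hy : Cc^*o v = y - pencil P w (A y) by rewrite {1}/y resolvent_fix// addrK.
have hD : inner (D u) v + inner u (D v) = inner (Cc^*o u) (Cc^*o v).
  have := congr1 (fun w => inner w v) (op_eqP u DE).
  by rewrite /= ipDl adjPl (adjP Cc).
have -> : \sum_(k < d) (1 - Num.conj (w 0 k) * z 0 k) *
      inner (P k (A x)) (P k (A y)) =
    inner x y - inner (pencil P z (A x)) (pencil P w (A y)).
  rewrite (spectral_isometry_ip Pspec Aiso) !pencilE ip_suml -sumrB; apply: eq_bigr => k _.
  rewrite ip_sumr (bigD1 k)//= big1 ?addr0 => [|j jk].
    by rewrite ipZl ipZr; ring.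
  rewrite ipZl ipZr -[P k (A x)](spectral_idem Pspec) (spectral_sa Pspec).
  by rewrite (spectral_orth Pspec) ?ip0r ?mulr0// eq_sym.
have -> : inner (D u - Cc (Cc^*o u) + Cc x) v =
    inner (D u) v - inner (Cc^*o u) (Cc^*o v) + inner x (Cc^*o v).
  by rewrite ipDl ipBl !(adjP Cc).
have -> : inner u (D v - Cc (Cc^*o v) + Cc y) =
    inner u (D v) - inner (Cc^*o u) (Cc^*o v) + inner (Cc^*o u) y.
  by rewrite ipDr ipBr -!(adjPl Cc).
move: hD; move: (inner (D u) v) (inner u (D v)) => a b hD.
have -> : a = inner (Cc^*o u) (Cc^*o v) - b by rewrite -hD addrK.
rewrite hx hy !ipE; ring.
Qed.

Lemma transfer_kernels : exists k : 'I_d -> 'rV[C]_d -> 'rV[C]_d -> bounded_op U U,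
  (forall j, positive_kernel (polydisk d) (k j)) /\
  (forall w z, polydisk d w -> polydisk d z ->
    (F w)^*o + F z = \sum_(j < d) (1 - Num.conj (w 0 j) * z 0 j) *: k j w z).
Proof.
pose h j z : bounded_op U X := P j *o A *o resolvent z *o Cc^*o.
exists (fun j w z => (h j w)^*o *o h j z); split=> [j|w z wD zD].
  by exists X, (h j).
apply: op_ext => u; apply: ip_inj => v.
rewrite op_addE ipDl adjPl addrC transfer_herglotz// op_sumE ip_suml.
by apply: eq_bigr => j _; rewrite opE ipZl opE adjPl.
Qed.

Lemma rnorm_resolvent (z : 'rV[C]_d) (r : R) x : 0 <= r < 1 -> (forall k, rnorm (z 0 k) <= r) ->
  rnorm (resolvent z x) <= (1 - r)^-1 * rnorm x.
Proof.
move=> /andP[r0 r1] zr; have zD : polydisk d z.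
  by move=> k; rewrite rnormE ltcR (le_lt_trans (zr k)).
have := rnorm_pencil Pspec (A (resolvent z x)) zr; rewrite (rnorm_isometry Aiso) => h.
have := rnormD x (pencil P z (A (resolvent z x))); rewrite -resolvent_fix//.
move: h; move: (rnorm (pencil _ _ _)) (rnorm (resolvent z x)) (rnorm x) => a b c h h'.
by rewrite mulrC ler_pdivlMr ?subr_gt0//; lra.
Qed.

(** The resolvent identity, obtained from uniqueness in the fixed point equation. *)
Lemma resolvent_diff z w x : polydisk d z -> polydisk d w ->
  resolvent w x - resolvent z x =
  resolvent w (pencil P (w - z) (A (resolvent z x))).
Proof.
move=> zD wD; apply: resolvent_uniq => //.
have pD y : pencil P (w - z) y = pencil P w y - pencil P z y.
  by rewrite !pencilE -sumrB; apply: eq_bigr => k _; rewrite !mxE scalerBl.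
rewrite pD !linearB/= {1}(resolvent_fix x wD) {1}(resolvent_fix x zD).
by apply: ip_inj => v; rewrite !ipE; ring.
Qed.

Lemma pencil_linear : linear (pencil P : 'rV[C]_d -> bounded_op X X).
Proof.
move=> a y y'; rewrite /pencil scaler_sumr -big_split/=; apply: eq_bigr => k _.
by rewrite !mxE scalerDl scalerA.
Qed.

Lemma transfer_holomorphic : holomorphic_on_polydisk F.
Proof.
move=> z zD; have [r [/andP[r0 r1] zr]] := polydisk_radius zD.
pose q := (1 - r) / 2; have q0 : 0 < q by rewrite divr_gt0// subr_gt0.
(* The derivative in the direction [h] is [C S(z) P(h) A S(z) C*]; the radius [q]
   keeps [h + z] in the polydisk of radius [r + q < 1]. *)
pose Lf (h : 'rV[C]_d) : bounded_op U U :=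
  Cc *o resolvent z *o pencil P h *o A *o resolvent z *o Cc^*o.
have Llin : linear Lf.
  move=> a h h'; apply: op_ext => u; rewrite /Lf !opE (op_eqP _ (pencil_linear a h h')).
  by rewrite !opE !linearP.
pose L : {linear 'rV[C]_d -> bounded_op U U} :=
  HB.pack Lf (GRing.isLinear.Build C _ _ _ Lf Llin).
pose t := (1 - r)^-1; pose s := q^-1.
have t0 : 0 <= t by rewrite invr_ge0 subr_ge0 ltW.
have s0 : 0 <= s by rewrite invr_ge0 ltW.
pose c := rnorm Cc; pose c' := rnorm Cc^*o.
have c0 : 0 <= c by exact: rnorm_ge0.
have c0' : 0 <= c' by exact: rnorm_ge0.
pose M := c * (t * (t * c')) + c * (s * (t * (t * c'))).
have ph h x : rnorm (pencil P h x) <= rnorm h * rnorm x.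
  by apply: rnorm_pencil => // k; exact: rnorm_mx_entry.
have zh x : rnorm (resolvent z x) <= t * rnorm x.
  by apply: rnorm_resolvent; rewrite ?r0.
have xu u : rnorm (A (resolvent z (Cc^*o u))) <= t * (c' * rnorm u).
  rewrite (rnorm_isometry Aiso) (le_trans (zh _))//.
  by rewrite ler_wpM2l// rnorm_op.
have nn := @rnorm_ge0 R.
apply: (@differentiable_quadratic _ _ _ F z L M q) => // [h|h hq].
- apply: rnorm_op_le => [|u]; first by rewrite mulr_ge0 ?rnorm_ge0// addr_ge0 ?mulr_ge0.
  apply: (@le_trans _ _ (c * (t * (rnorm h * (t * (c' * rnorm u)))))).
    rewrite (le_trans (rnorm_op Cc _))// ler_wpM2l//.
    rewrite (le_trans (zh _))// ler_wpM2l// (le_trans (ph _ _))// ler_wpM2l//.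
  rewrite [X in _ <= X](_ : _ = c * (t * (rnorm h * (t * (c' * rnorm u)))) +
    c * (s * (t * (t * c'))) * rnorm h * rnorm u); last by rewrite /M; ring.
  by rewrite lerDl !mulr_ge0.
- have hz k : rnorm ((h + z) 0 k) <= r + q.
    rewrite mxE (le_trans (rnormD _ _))// addrC lerD// ltW//.
    exact: le_lt_trans (rnorm_mx_entry _ _) hq.
  have rq : 0 <= r + q < 1.
    by rewrite addr_ge0 ?(ltW q0)//= /q; lra.
  have wD : polydisk d (h + z).
    by move=> k; rewrite rnormE ltcR (le_lt_trans (hz k))//; case/andP: rq.
  apply: rnorm_op_le => [|u]; first by rewrite mulr_ge0 ?sqr_ge0// addr_ge0 ?mulr_ge0.
  have -> : (F (h + z) - F z - L h) u = Cc (resolvent (h + z) (pencil P h (A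
     (resolvent z (pencil P h (A (resolvent z (Cc^*o u)))))))).
    rewrite -[LHS]/(F (h + z) u - F z u -
      Cc (resolvent z (pencil P h (A (resolvent z (Cc^*o u)))))) !transferE//.
    set x := resolvent z (Cc^*o u); set y := pencil P h (A x).
    have h1 := resolvent_diff (Cc^*o u) zD wD; rewrite addrK -/x -/y in h1.
    have h2 := resolvent_diff y zD wD; rewrite addrK in h2.
    rewrite -h2 -h1 !linearB/=.
    by apply: ip_inj => v; rewrite !ipE; ring.
  apply: (@le_trans _ _ (c * (s * (rnorm h * (t * (rnorm h * (t * (c' * rnorm u)))))))).
    rewrite (le_trans (rnorm_op Cc _))// ler_wpM2l//.
    have sE : s = (1 - (r + q))^-1 by rewrite /s; congr (_^-1); rewrite /q; lra.
    rewrite (le_trans (rnorm_resolvent _ rq hz))// -sE ler_wpM2l//.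
    rewrite (le_trans (ph _ _))// ler_wpM2l// (rnorm_isometry Aiso).
    rewrite (le_trans (zh _))// ler_wpM2l// (le_trans (ph _ _))// ler_wpM2l//.
  rewrite [X in _ <= X](_ : _ = c * (s * (rnorm h * (t * (rnorm h * (t * (c' * rnorm u)))))) +
    c * (t * (t * c')) * rnorm h ^+ 2 * rnorm u); last by rewrite /M; ring.
  by rewrite lerDl !mulr_ge0// sqr_ge0.
Qed.

Definition taylor_coef (n : midx) : bounded_op U U :=
  (if n == m0 then D - Cc *o Cc^*o else 0) + Cc *o res_coef P A n *o Cc^*o.

Lemma transfer_taylor : is_taylor_expansion F taylor_coef.
Proof.
move=> z zD; have FF := @totally_filter midx.
have [S cvS] := res_series Pspec Aiso zD.
have [SE _] := res_series_inv Pspec Aiso zD cvS.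
have E (J : {fset midx}) : m0 \in J ->
  partial_sum (fun n => monomial z n *: taylor_coef n) J =
  D - Cc *o Cc^*o + Cc *o partial_sum (fun n => monomial z n *: res_coef P A n) J *o Cc^*o.
  move=> J0; apply: op_ext => u; rewrite !partial_sumE op_sumE !opE op_sumE linear_sum.
  under [LHS]eq_bigr do rewrite op_scaleE op_addE scalerDr.
  rewrite big_split/= (big_rem m0)//= eqxx monomial_m0 scale1r; congr (_ + _).
    rewrite big_seq big1 ?addr0// => n.
    by rewrite (mem_rem_uniq _ (fset_uniq _)) inE => /andP[/negbTE -> _]; rewrite opE scaler0.
  by apply: eq_bigr => n _; rewrite linearZ.
have -> : F z = D - Cc *o Cc^*o + Cc *o S *o Cc^*o.
  by apply: op_ext => u; rewrite transferE// /resolvent SE !opE.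
apply/rcvgP => e e0; pose c := rnorm Cc * rnorm Cc^*o + 1.
have c0 : 0 < c by rewrite ltr_wpDl// mulr_ge0 ?rnorm_ge0.
have /rcvgP/(_ _ (divr_gt0 e0 c0)) cvSe := cvS.
apply: filterS2 (totally_mem (m0 : midx)) cvSe => J J0; rewrite (E J J0).
move: (partial_sum _ J) => SJ; rewrite ltr_pdivlMr// => lt_e.
have -> : D - Cc *o Cc^*o + Cc *o S *o Cc^*o - (D - Cc *o Cc^*o + Cc *o SJ *o Cc^*o) =
    Cc *o (S - SJ) *o Cc^*o.
  by apply: op_ext => u; rewrite !opE linearB/=; apply: ip_inj => v; rewrite !ipE; ring.
rewrite (le_lt_trans (rnorm_comp _ _))//.
have h1 := rnorm_comp Cc (S - SJ).
have := rnorm_ge0 Cc^*o; have := rnorm_ge0 (S - SJ).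
move: h1 lt_e; rewrite /c; move: (rnorm (Cc *o (S - SJ))) (rnorm (S - SJ)).
move: (rnorm Cc) (rnorm Cc^*o) => a a' b b'; nra.
Qed.

Lemma rnorm_taylor_coef n :
  rnorm (taylor_coef n) <= rnorm (D - Cc *o Cc^*o) + rnorm Cc * rnorm Cc^*o.
Proof.
rewrite (le_trans (rnormD _ _))// lerD//.
  by case: eqP => // _; rewrite rnorm0 rnorm_ge0.
rewrite (le_trans (rnorm_comp _ _))// ler_wpM2r ?rnorm_ge0//.
rewrite (le_trans (rnorm_comp _ _))// -[X in _ <= X]mulr1 ler_wpM2l ?rnorm_ge0//.
exact: rnorm_res_coef.
Qed.

End TransferFunction.

(** * Operators on tensor products *)

Section Tensor.
Context {R : realType}.
Local Notation C := R[i].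

Lemma dense_approx (V : normedModType C) (S : set V) (x : V) (e : R) :
  dense S -> 0 < e -> exists s, S s /\ rnorm (x - s) < e.
Proof.
move=> dS e0; have e0' : 0 < e%:C%C :> C by rewrite ltcR.
have [s [/interior_subset xs Ss]] : (ball x e%:C%C)^° `&` S !=set0.
  apply: dS; last exact: open_interior.
  by exists x; exact: nbhsx_ballx.
by exists s; split=> //; move: xs; rewrite -ball_normE /ball_/= rnormE ltcR.
Qed.

Lemma dense_orth (V : hilbertType R) (S : set V) (g : V) : dense S ->
  (forall s, S s -> inner s g = 0) -> g = 0.
Proof.
move=> dS Sg; apply: rnorm_eq0; apply/eqP; rewrite eq_le rnorm_ge0 andbT leNgt.
apply/negP => g0; have [s [Ss gs]] := dense_approx g dS g0.
have := le_trans (ler_norm _) (rip_CS (g - s) g).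
rewrite ripDl ripNl /rip (Sg _ Ss) subr0 -/(rip g g) rip_self.
by rewrite expr2 ler_pM2r// leNgt gs.
Qed.

Lemma psd_op_diff (V W : hilbertType R) (I : Type) (A : bounded_op V W) (M : R)
    (h : I -> V) : 0 <= M -> rnorm A <= M ->
  psd (fun i j => (M ^+ 2)%:C%C * inner (h i) (h j) - inner (A (h i)) (A (h j))).
Proof.
move=> M0 AM s.
rewrite qform_sub qform_scale (qform_gram h) (qform_gram (fun i => A (h i))).
rewrite -rmorphM/= -rmorphB/= ler0c.
have -> : lcomb (fun i => A (h i)) s = A (lcomb h s).
  by rewrite linear_sum; apply: eq_bigr => p _; rewrite linearZ.
rewrite subr_ge0 -exprMn lerXn2r// ?nnegrE ?mulr_ge0 ?rnorm_ge0//.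
by rewrite (le_trans (rnorm_op _ _))// ler_wpM2r ?rnorm_ge0.
Qed.

(** Operators act boundedly on elementary tensors: positivity of the
    difference of Gram kernels, by the Schur product theorem. *)
Lemma psd_tensor_diff (V V' W W' : hilbertType R) (I : eqType)
    (A : bounded_op V V') (B : bounded_op W W') (M N : R) (h : I -> V) (g : I -> W) :
  0 <= M -> 0 <= N -> rnorm A <= M -> rnorm B <= N ->
  psd (fun i j => ((M * N) ^+ 2)%:C%C * (inner (h i) (h j) * inner (g i) (g j)) -
    inner (A (h i)) (A (h j)) * inner (B (g i)) (B (g j))).
Proof.
move=> M0 N0 AM BN.
have p1 := psd_mul (psd_op_diff h M0 AM)
  (psd_scale (c := (N ^+ 2)%:C%C) _ (psd_gram g)).
have p2 := psd_mul (psd_gram (fun i => A (h i))) (psd_op_diff g N0 BN).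
apply: eq_psd (psd_add (p1 _) p2) => [i j|]; last by rewrite ler0c sqr_ge0.
by rewrite exprMn rmorphM/=; ring.
Qed.

Section TensorOp.
Context {U K : hilbertType R} (UK : hilbert_tensor U K).
Local Notation tens := (tensor UK).

Lemma tensor_total (g : UK) : (forall u x, inner (tens u x) g = 0) -> g = 0.
Proof.
move=> h; apply: (@dense_orth _ _ g (@dense_tensor _ _ _ UK)) => _ [s ->].
by rewrite ip_suml big1// => p _; exact: h.
Qed.

(** The operator exists by extension from elementary tensors, and their totality
    determines it, so that it is the one selected by [xget]. *)
Lemma tensor_opP (A : bounded_op U U) (B : bounded_op K K) :
  (forall u x, tensor_op UK A B (tens u x) = tens (A u) (B x)) /\
  rnorm (tensor_op UK A B) <= rnorm A * rnorm B.
Proof.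
have MN0 : 0 <= rnorm A * rnorm B by rewrite mulr_ge0 ?rnorm_ge0.
have [s|Y [Yt _ YN]] := @op_extension R UK UK (U * K)%type
  (fun p => tens p.1 p.2) (fun p => tens (A p.1) (B p.2)) (rnorm A * rnorm B) MN0.
  have hp := psd_tensor_diff (fun p : U * K => p.1) (fun p : U * K => p.2)
    (rnorm_ge0 A) (rnorm_ge0 B) (lexx _) (lexx _) s.
  have : 0 <= ((rnorm A * rnorm B) ^+ 2)%:C%C *
      qform (fun p q : U * K => inner (tens p.1 p.2) (tens q.1 q.2)) s -
      qform (fun p q : U * K => inner (tens (A p.1) (B p.2)) (tens (A q.1) (B q.2))) s.
    apply: le_trans hp _; rewrite le_eqVlt; apply/orP; left; apply/eqP.
    rewrite -qform_scale -qform_sub; apply: eq_bigr => p _; apply: eq_bigr => q _.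
    by rewrite !inner_tensor.
  rewrite (qform_gram (fun p : U * K => tens p.1 p.2)).
  rewrite (qform_gram (fun p : U * K => tens (A p.1) (B p.2))).
  rewrite -rmorphM/= -rmorphB/= ler0c subr_ge0 -exprMn.
  by rewrite ler_pXn2r// nnegrE ?mulr_ge0 ?rnorm_ge0.
have uniq (Z : bounded_op UK UK) :
    (forall u x, Z (tens u x) = tens (A u) (B x)) -> Z = Y.
  move=> Zt; apply/eqP; rewrite -subr_eq0; apply/eqP.
  apply: (@op_eq0_total _ _ _ _ (fun p : U * K => tens p.1 p.2)) => [p|g hg].
    by rewrite opE Zt (Yt p) subrr.
  by rewrite (@tensor_total g) ?linear0// => u x; exact: (hg (u, x)).
have YP : forall u x, Y (tens u x) = tens (A u) (B x) by move=> u x; exact: (Yt (u, x)).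
rewrite /tensor_op; case: xgetP => [Z _ ZP|/(_ Y)//].
by split=> //; rewrite (uniq Z ZP).
Qed.

Lemma tensor_opE A B u x : tensor_op UK A B (tens u x) = tens (A u) (B x).
Proof. exact: (tensor_opP A B).1. Qed.

Lemma rnorm_tensor_op A B : rnorm (tensor_op UK A B) <= rnorm A * rnorm B.
Proof. exact: (tensor_opP A B).2. Qed.

End TensorOp.

(** Quantitative continuity of [x |-> Re <A x, x>] on a ball around [x]. *)
Lemma dense_rip_ge0 (V : hilbertType R) (S : set V) (A : bounded_op V V) :
  dense S -> (forall s, S s -> 0 <= rip (A s) s) -> forall x, 0 <= rip (A x) x.
Proof.
move=> dS AS x; rewrite leNgt; apply/negP => lt0.
pose M := rnorm A * (2 * rnorm x + 1) + 1.
have M0 : 0 < M by rewrite ltr_wpDl// mulr_ge0 ?addr_ge0 ?mulr_ge0 ?rnorm_ge0.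
pose e := Num.min 1 (- rip (A x) x / M).
have e0 : 0 < e by rewrite lt_min ltr01 divr_gt0// oppr_gt0.
have e1 : e <= 1 by rewrite ge_min lexx.
have eM : e * M <= - rip (A x) x.
  by rewrite -ler_pdivlMr// ge_min lexx orbT.
have [s [Ss xs]] := dense_approx x dS e0.
have h1 := le_trans (ler_norm _) (rip_CS (A (x - s)) (- s)).
have h2 := le_trans (ler_norm _) (rip_CS (A x) (s - x)).
have h3 := AS s Ss.
have h4 : rnorm s <= rnorm x + e.
  by have := rnormD x (s - x); rewrite addrCA subrr addr0 (rnormB s); lra.
have h5 := rnorm_op A (x - s); have h6 := rnorm_op A x.
rewrite rnormN {1}linearB ripNr ripDl ripNl in h1.
rewrite ripDr ripNr (rnormB s) in h2.
have nx := rnorm_ge0 x; have ns := rnorm_ge0 s; have nA := rnorm_ge0 A.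
have nd := rnorm_ge0 (x - s).
have b1 : rnorm (A (x - s)) * rnorm s <= rnorm A * e * (rnorm x + 1).
  apply: ler_pM => //; first exact: rnorm_ge0.
    by apply: le_trans h5 _; rewrite ler_wpM2l// ltW.
  by apply: le_trans h4 _; rewrite lerD2l.
have b2 : rnorm (A x) * rnorm (x - s) <= rnorm A * rnorm x * e.
  by apply: ler_pM => //; [exact: rnorm_ge0|exact: ltW].
move: h1 h2 h3 b1 b2 eM lt0; rewrite /M.
move: (rip (A x) x) (rip (A x) s) (rip (A s) s) (rnorm (A (x - s)) * _) (rnorm (A x) * _).
move=> a b c f f' h1 h2 h3 b1 b2 eM lt0.
have : e * (rnorm A * (2 * rnorm x + 1) + 1) =
  rnorm A * e * (rnorm x + 1) + rnorm A * rnorm x * e + e by ring.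
lra.
Qed.

End Tensor.

(** * Accretivity of the functional calculus of a transfer function *)

Lemma psd_factor_countable (R : realType) (K : hilbertType R) (T : countType) (t0 : T)
    (k : T -> T -> R[i]) : ~ finite_dimensional K -> psd k ->
  exists h : T -> K, forall s t, inner (h s) (h t) = k s t.
Proof.
move=> infK kP; have [e eO] := ex_orthonormal_seq infK.
pose dec (n : nat) : T := odflt t0 (choice.unpickle n).
have [h hE] := psd_factor eO (psd_reindex dec kP).
by exists (fun t => h (choice.pickle t)) => s t; rewrite hE /dec !choice.pickleK.
Qed.

Section OperatorMonomials.
Context {R : realType} {d : nat} {V : normedModType R[i]}.
Local Notation midx := (multiindex (d := d)).
Variable T : 'I_d -> bounded_op V V.

Lemma rnorm_op_exp (A : bounded_op V V) m : rnorm (op_exp A m) <= rnorm A ^+ m.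
Proof.
elim: m => [|m IH]; first by rewrite expr0; exact: rnorm_op_id.
by rewrite exprS (le_trans (rnorm_comp _ _))// ler_wpM2l ?rnorm_ge0.
Qed.

Lemma rnorm_op_monomial (r : R) (n : midx) : (forall k, rnorm (T k) <= r) ->
  rnorm (op_monomial T n) <= r ^+ mdeg n.
Proof.
move=> Tr; rewrite /op_monomial /mdeg expr_sum; elim: (index_enum _) => [|k s IH].
  by rewrite !big_nil; exact: rnorm_op_id.
rewrite !big_cons (le_trans (rnorm_comp _ _))// ler_pM ?rnorm_ge0//.
rewrite (le_trans (rnorm_op_exp _ _))// lerXn2r// ?nnegrE ?rnorm_ge0//.
exact: le_trans (rnorm_ge0 _) (Tr k).
Qed.

Lemma op_monomial_m0 x : op_monomial T m0 x = x.
Proof.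
rewrite /op_monomial; elim: (index_enum _) => [|k s IH]; first by rewrite big_nil.
by rewrite big_cons ffunE opE IH.
Qed.

Lemma op_monomial_minc (n : midx) k x :
  (forall i j, T i *o T j = T j *o T i) ->
  op_monomial T (minc n k) x = T k (op_monomial T n x).
Proof.
move=> Tcomm.
have comm j m y : op_exp (T j) m (T k y) = T k (op_exp (T j) m y).
  elim: m => // m IH; rewrite /op_exp iterS -/(op_exp _ m) opE IH.
  by have := op_eqP (op_exp (T j) m y) (Tcomm j k); rewrite !opE.
suff h (s : seq 'I_d) : uniq s ->
    (\big[@op_comp _ V V V / op_id V]_(j <- s) op_exp (T j) (minc n k j)) x =
    (if k \in s then T k ((\big[@op_comp _ V V V / op_id V]_(j <- s) op_exp (T j) (n j)) x)
     else (\big[@op_comp _ V V V / op_id V]_(j <- s) op_exp (T j) (n j)) x).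
  by rewrite /op_monomial h ?index_enum_uniq// mem_index_enum.
elim: s => [|j s IH] /=; first by rewrite !big_nil.
move=> /andP[js us]; rewrite !big_cons !opE IH// inE ffunE.
have [->|kj] := eqVneq k j.
  by rewrite ?eqxx (negbTE js).
by move=> /=; case: ifP => // _; rewrite comm.
Qed.

End OperatorMonomials.

Lemma lcomb_dom (R : realType) (V W : hilbertType R) (I : Type) (a : I -> V) (b : I -> W) :
  psd (fun i j => inner (a i) (a j) - inner (b i) (b j)) ->
  forall s, rnorm (lcomb b s) <= 1 * rnorm (lcomb a s).
Proof.
move=> abP s; have := abP s.
rewrite qform_sub !qform_gram -rmorphB/= ler0c subr_ge0 mul1r.
by rewrite ler_pXn2r// nnegrE rnorm_ge0.
Qed.

Section Positivity.
Context {R : realType} {d : nat} {X U K : hilbertType R} (UK : hilbert_tensor U K).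
Local Notation C := R[i].
Local Notation midx := (multiindex (d := d)).
Local Notation tens := (tensor UK).
Variables (P : 'I_d -> bounded_op X X) (A : bounded_op X X).
Variables (Cc : bounded_op X U) (D : bounded_op U U).
Hypothesis Pspec : spectral_decomposition P.
Hypothesis Aiso : A^*o *o A = op_id X.
Hypothesis DE : D + D^*o = Cc *o Cc^*o.
Hypothesis infK : ~ finite_dimensional K.
Variable T : 'I_d -> bounded_op K K.
Hypothesis Tcsc : commuting_strict_contractions T.

Let c := taylor_coef P A Cc D.
Let term n := tensor_op UK (c n) (op_monomial T n).

Let T_radius : exists r, 0 <= r < 1 /\ forall k, rnorm (T k) <= r.
Proof. by apply: ex_radius => k; have := Tcsc.2 k; rewrite rnormE ltcR. Qed.

Let M := rnorm (D - Cc *o Cc^*o) + rnorm Cc * rnorm Cc^*o.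

(** The Taylor coefficients are bounded and [|T^n| <= r ^ |n|] with [r < 1], hence
    the series converges even in operator norm. *)
Lemma functional_calculus_cvg : exists FT : bounded_op UK UK, partial_sum term @ totally --> FT.
Proof.
have [r [r01 Tr]] := T_radius; have r0 : 0 <= r by case/andP: r01.
have M0 : 0 <= M by rewrite addr_ge0 ?mulr_ge0 ?rnorm_ge0.
apply: (@op_summable _ _ _ _ _ (fun n => M * r ^+ mdeg n) (M * (1 - r)^-1 ^+ d)).
  move=> n; rewrite (le_trans (rnorm_tensor_op _ _ _))// ler_pM ?rnorm_ge0//.
    exact: rnorm_taylor_coef.
  exact: rnorm_op_monomial.
by move=> J; rewrite -mulr_sumr ler_wpM2l// sum_mdeg_bound.
Qed.

Section Vector.
Variables (m : nat) (u : 'I_m -> U) (x : 'I_m -> K).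

(** The elementary tensors [Q_n C^* u_i (x) T^n x_i], and their images under
    [P_k A (x) T_k]. Being countably many, they are realised as vectors of [K]
    with the Gram kernel of [X (x) K]. *)
Let idx := (option 'I_d * {ffun 'I_d -> nat} * 'I_m)%type.
Let fst_leg (t : idx) : X :=
  let: (o, n, i) := t in let y := res_coef P A n (Cc^*o (u i)) in
  if o is Some k then P k (A y) else y.
Let snd_leg (t : idx) : K :=
  let: (o, n, i) := t in let y := op_monomial T n (x i) in
  if o is Some k then T k y else y.

Let w : UK := \sum_i tens (u i) (x i).

Let ex_theta (i0 : 'I_m) : exists th : idx -> K, forall s t,
  inner (th s) (th t) = inner (fst_leg s) (fst_leg t) * inner (snd_leg s) (snd_leg t).
Proof.
apply: psd_factor_countable => //; first exact: (None, [ffun=> 0%N], i0).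
by apply: psd_mul; exact: psd_gram.
Qed.

Let P1 k : rnorm (P k *o A) <= 1.
Proof.
apply: rnorm_op_le => // y; rewrite mul1r opE -(rnorm_isometry Aiso y).
rewrite -(@ler_pXn2r _ 2)// ?nnegrE ?rnorm_ge0// (rnorm_spectral Pspec (A y)).
by rewrite (bigD1 k)//= lerDl sumr_ge0// => j _; rewrite sqr_ge0.
Qed.

Let T1 k : rnorm (T k) <= 1.
Proof. by have := Tcsc.2 k; rewrite rnormE ltcR => /ltW. Qed.

Section Realised.
Variable th : idx -> K.
Hypothesis thE : forall s t,
  inner (th s) (th t) = inner (fst_leg s) (fst_leg t) * inner (snd_leg s) (snd_leg t).

Let sub := ({ffun 'I_d -> nat} * 'I_m)%type.
Let lv (p : sub) : K := th (None, p.1, p.2).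
Let up k (p : sub) : K := th (Some k, p.1, p.2).

(** The operator [P_k A (x) T_k] on the realised vectors. *)
Let ex_E k : exists E : bounded_op K K, [/\ forall p, E (lv p) = up k p,
  forall g, (forall p, inner (lv p) g = 0) -> E g = 0 & rnorm E <= 1].
Proof.
apply: op_extension => // s; apply: lcomb_dom.
have := psd_tensor_diff (fun p : sub => fst_leg (None, p.1, p.2))
  (fun p : sub => snd_leg (None, p.1, p.2)) ler01 ler01 (P1 k) (T1 k).
by apply: eq_psd => p q; rewrite !thE mulr1 expr1n mul1r.
Qed.

(** [sum_k P_k A (x) T_k] is contractive because [sum_k (P_k A)* P_k A] is the
    identity and the defects [I - T_k* T_k] are positive. *)
Let ex_sumE : exists E : bounded_op K K, [/\ forall p, E (lv p) = \sum_k up k p,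
  forall g, (forall p, inner (lv p) g = 0) -> E g = 0 & rnorm E <= 1].
Proof.
apply: op_extension => // s; apply: lcomb_dom.
have hk k : psd (fun p q : sub =>
    inner (P k (A (fst_leg (None, p.1, p.2)))) (P k (A (fst_leg (None, q.1, q.2)))) *
    (inner (snd_leg (None, p.1, p.2)) (snd_leg (None, q.1, q.2)) -
     inner (T k (snd_leg (None, p.1, p.2))) (T k (snd_leg (None, q.1, q.2))))).
  apply: psd_mul; first exact: psd_gram.
  have := psd_op_diff (fun p : sub => snd_leg (None, p.1, p.2)) ler01 (T1 k).
  by apply: eq_psd => p q; rewrite expr1n mul1r.
have : psd (fun p q : sub => \sum_k
    inner (P k (A (fst_leg (None, p.1, p.2)))) (P k (A (fst_leg (None, q.1, q.2)))) *
    (inner (snd_leg (None, p.1, p.2)) (snd_leg (None, q.1, q.2)) -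
     inner (T k (snd_leg (None, p.1, p.2))) (T k (snd_leg (None, q.1, q.2))))).
  by move=> t; rewrite qform_sum sumr_ge0// => k _; exact: hk.
apply: eq_psd => p q; rewrite thE ip_suml.
set y := fst_leg (None, p.1, p.2); set y' := fst_leg (None, q.1, q.2).
rewrite (spectral_isometry_ip Pspec Aiso) mulr_suml -sumrB; apply: eq_bigr => k _.
rewrite mulrBr; congr (_ - _).
rewrite ip_sumr (bigD1 k)//= big1 ?addr0 => [|j jk]; first by rewrite thE.
rewrite thE /= -[P k _](spectral_idem Pspec) (spectral_sa Pspec).
by rewrite (spectral_orth Pspec) ?ip0r ?mul0r// eq_sym.
Qed.

(** The two sides have the same inner products with all realised vectors and lie
    in their span. *)
Let th_rec n i : n != m0 ->
  th (None, n, i) = \sum_k (if (0 < n k)%N then th (Some k, mdec n k, i) else 0).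
Proof.
move=> n0; set rhs := \sum_k _.
have h t : inner (th (None, n, i) - rhs) (th t) = 0.
  rewrite ipBl thE /= res_coef_rec (negbTE n0) add0r op_sumE /rhs !ip_suml.
  rewrite mulr_suml -sumrB big1// => k _; case: ifP => nk.
    have -> : op_monomial T n (x i) = T k (op_monomial T (mdec n k) (x i)).
      by rewrite -op_monomial_minc ?mdecK//; exact: Tcsc.1.
    by rewrite thE/= subrr.
  by rewrite !ip0l mul0r subrr.
apply/eqP; rewrite -subr_eq0; apply/eqP/ip_self_eq0; rewrite {2}/rhs ipBr h.
by rewrite ip_sumr big1 ?subr0// => k _; case: ifP; rewrite ?h ?ip0r.
Qed.

Let a (n : midx) : K := \sum_i th (None, n, i).
Let v : K := a m0.

Let a_summable : exists g : K, partial_sum a @ totally --> g.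
Proof.
have [r [r01 Tr]] := T_radius; have r0 : 0 <= r by case/andP: r01.
pose M' := \sum_i rnorm (Cc^*o (u i)) * rnorm (x i).
have M0 : 0 <= M' by apply: sumr_ge0 => i _; rewrite mulr_ge0 ?rnorm_ge0.
apply: (@vec_summable _ _ _ _ (fun n => M' * r ^+ mdeg n) (M' * (1 - r)^-1 ^+ d)).
  move=> n; rewrite (le_trans (rnorm_sum _ _ _))// mulr_suml; apply: ler_sum => i _.
  have -> : rnorm (th (None, n, i)) =
      rnorm (res_coef P A n (Cc^*o (u i))) * rnorm (op_monomial T n (x i)).
    apply/eqP; rewrite -(@eqrXn2 _ 2)// ?mulr_ge0 ?rnorm_ge0//; apply/eqP/complexI.
    by rewrite -ip_self thE exprMn rmorphM/= -!ip_self.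
  rewrite -mulrA ler_pM ?rnorm_ge0//.
    rewrite (le_trans (rnorm_op _ _))// ler_piMl ?rnorm_ge0//.
    exact: rnorm_res_coef.
  rewrite (le_trans (rnorm_op _ _))// mulrC ler_wpM2l ?rnorm_ge0//.
  exact: rnorm_op_monomial.
by move=> J; rewrite -mulr_sumr ler_wpM2l// sum_mdeg_bound.
Qed.

(** The realised series solves the resolvent equation with a contraction. *)
Let ex_fix : exists (g : K) (E : bounded_op K K),
  [/\ partial_sum a @ totally --> g, g = v + E g & rnorm E <= 1].
Proof.
have FF := @totally_filter midx.
have [g ag] := a_summable; have [E [El E0 E1]] := ex_sumE.
have [Ek EkP] := choice ex_E.
have EE : E = \sum_k Ek k.
  apply/eqP; rewrite -subr_eq0; apply/eqP; apply: (@op_eq0_total _ _ _ _ lv) => [p|y hy].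
    rewrite opE El op_sumE -sumrB big1// => k _.
    by have [h _ _] := EkP k; rewrite h subrr.
  rewrite opE E0// op_sumE big1 ?subr0// => k _.
  by have [_ h _] := EkP k; rewrite h.
exists g, E; split=> //; apply: (rcvg_uniq FF ag).
have cvk k : (fun J => Ek k (partial_sum a (mdown k J))) @ totally --> Ek k g.
  apply: (rcvg_op FF); exact: cvg_comp (@mdown_totally d k) ag.
have cvR : (fun J => v + \sum_k Ek k (partial_sum a (mdown k J))) @ totally --> v + E g.
  apply: cvgD; first exact: cvg_cst.
  by rewrite EE op_sumE; exact: (rcvg_sum FF).
apply: cvg_trans cvR; apply: near_eq_cvg.
apply: filterS (totally_mem (m0 : midx)) => J J0.
rewrite partial_sumE [RHS](big_rem m0)//=; congr (_ + _).
have -> : \sum_(n <- rem m0 J) a n =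
    \sum_(n <- J) \sum_k (if (0 < n k)%N then Ek k (a (mdec n k)) else 0).
  rewrite [RHS](big_rem m0)//= [X in _ = X + _]big1 ?add0r; last first.
    by move=> k _; rewrite ffunE.
  rewrite big_seq [RHS]big_seq; apply: eq_bigr => n.
  rewrite (mem_rem_uniq _ (fset_uniq _)) inE => /andP[n0 _].
  rewrite {1}/a; under [LHS]eq_bigr => i _ do rewrite (th_rec i n0).
  rewrite exchange_big/=; apply: eq_bigr => k _; case: ifP => nk; last by rewrite big1.
  rewrite linear_sum; apply: eq_bigr => i _.
  by have [h _ _] := EkP k; exact: (esym (h (mdec n k, i))).
rewrite exchange_big/=; apply: eq_bigr => k _.
by rewrite partial_sumE sum_mdown linear_sum big_mkcond.
Qed.

Let s0 : C := \sum_i \sum_j inner ((D - Cc *o Cc^*o) (u i)) (u j) * inner (x i) (x j).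

Let res_coef_m0 y : res_coef P A m0 y = y.
Proof.
rewrite res_coef_rec eqxx big1 ?addr0// => k _.
by rewrite ffunE.
Qed.

Let v_inner (y : 'I_m -> X) (z : 'I_m -> K) (g : 'I_m -> K) :
  (forall i j, inner (g i) (th (None, m0, j)) = inner (y i) (Cc^*o (u j)) * inner (z i) (x j)) ->
  inner (\sum_i g i) v = \sum_i \sum_j inner (y i) (Cc^*o (u j)) * inner (z i) (x j).
Proof.
move=> h; rewrite ip_suml; apply: eq_bigr => i _; rewrite ip_sumr.
by apply: eq_bigr => j _.
Qed.

Let a_v n : inner (a n) v = \sum_i \sum_j
  inner (res_coef P A n (Cc^*o (u i))) (Cc^*o (u j)) * inner (op_monomial T n (x i)) (x j).
Proof. by apply: v_inner => i j; rewrite thE/= res_coef_m0 op_monomial_m0. Qed.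

Let term_w n : inner (term n w) w = (if n == m0 then s0 else 0) + inner (a n) v.
Proof.
rewrite a_v.
have -> : inner (term n w) w =
    \sum_i \sum_j inner (c n (u i)) (u j) * inner (op_monomial T n (x i)) (x j).
  have -> : term n w = \sum_i tens (c n (u i)) (op_monomial T n (x i)).
    by rewrite /w linear_sum; apply: eq_bigr => i _; exact: tensor_opE.
  rewrite ip_suml; apply: eq_bigr => i _.
  by rewrite ip_sumr; apply: eq_bigr => j _; rewrite inner_tensor.
have -> : (if n == m0 then s0 else 0) = \sum_i \sum_j
    inner ((if n == m0 then D - Cc *o Cc^*o else 0) (u i)) (u j) *
    inner (op_monomial T n (x i)) (x j).
  case: eqP => [->|_].
    by apply: eq_bigr => i _; apply: eq_bigr => j _; rewrite op_monomial_m0.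
  by rewrite big1// => i _; rewrite big1// => j _; rewrite opE ip0l mul0r.
rewrite -big_split/=; apply: eq_bigr => i _; rewrite -big_split/=; apply: eq_bigr => j _.
by rewrite -mulrDl; congr (_ * _); rewrite -(adjP Cc) -ipDl.
Qed.

Let s0_re : s0 + Num.conj s0 = - inner v v.
Proof.
have -> : Num.conj s0 = \sum_i \sum_j
    inner (u i) ((D - Cc *o Cc^*o) (u j)) * inner (x i) (x j).
  rewrite rmorph_sum exchange_big/=; apply: eq_bigr => i _.
  rewrite rmorph_sum; apply: eq_bigr => j _.
  by rewrite rmorphM/= -!ipC.
rewrite {2}/v /a (v_inner (y := fun i => Cc^*o (u i)) (z := x)); last first.
  by move=> i j; rewrite thE/= !res_coef_m0 !op_monomial_m0.
rewrite -sumrN -big_split/=; apply: eq_bigr => i _.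
rewrite -sumrN -big_split/=; apply: eq_bigr => j _.
rewrite -mulrDl -mulNr; congr (_ * _).
have h : inner (D (u i)) (u j) + inner (u i) (D (u j)) =
    inner (Cc^*o (u i)) (Cc^*o (u j)).
  have := congr1 (fun y => inner y (u j)) (op_eqP (u i) DE).
  by rewrite /= ipDl adjPl (adjP Cc).
have hl : inner ((D - Cc *o Cc^*o) (u i)) (u j) =
    inner (D (u i)) (u j) - inner (Cc^*o (u i)) (Cc^*o (u j)).
  by rewrite op_subE ipBl op_compE (adjP Cc).
have hr : inner (u i) ((D - Cc *o Cc^*o) (u j)) =
    inner (u i) (D (u j)) - inner (Cc^*o (u i)) (Cc^*o (u j)).
  by rewrite op_subE ipBr op_compE -(adjPl Cc).
move: hl hr => /= -> ->; rewrite -h; ring.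
Qed.

(** With [w = sum_i u_i (x) x_i] and [v = g - E g] one finds
    [2 Re <F(T) w, w> = |g|^2 - |E g|^2], because [2 Re s0 = - |v|^2]. *)
Lemma positivity_realised (FT : bounded_op UK UK) :
  partial_sum term @ totally --> FT -> 0 <= rip (FT w) w.
Proof.
have FF := @totally_filter midx.
move=> cvT; have [g [E [ag gE E1]]] := ex_fix.
have FTw : inner (FT w) w = s0 + inner g v.
  have c1 : (fun J => inner (partial_sum term J w) w : C) @ totally --> (inner (FT w) w : C).
    by apply: (rcvg_ipl FF); exact: (rcvg_eval FF cvT).
  apply: (rcvg_uniq FF c1).
  have c2 : (fun J => s0 + inner (partial_sum a J) v : C) @ totally --> (s0 + inner g v : C).
    by apply: cvgD; [exact: cvg_cst|exact: (rcvg_ipl FF ag)].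
  apply: cvg_trans c2; apply: near_eq_cvg.
  apply: filterS (totally_mem (m0 : midx)) => J J0.
  rewrite !partial_sumE op_sumE !ip_suml; under [RHS]eq_bigr do rewrite term_w.
  rewrite big_split/=; congr (_ + _); rewrite (big_rem m0)//= eqxx big_seq big1 ?addr0// => n.
  by rewrite (mem_rem_uniq _ (fset_uniq _)) inE => /andP[/negbTE ->].
have h1 : 2 * complex.Re s0 = - rnorm v ^+ 2.
  have := congr1 (@complex.Re R) s0_re; rewrite cReD cRe_conj cReN -/(rip v v) rip_self; lra.
have vE : v = g - E g by rewrite {1}gE addrK.
have h2 : rnorm (E g) <= rnorm g.
  by rewrite (le_trans (rnorm_op _ _))// ler_piMl ?rnorm_ge0.
have h3 : rnorm (E g) ^+ 2 <= rnorm g ^+ 2 by rewrite lerXn2r// nnegrE rnorm_ge0.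
rewrite /rip FTw cReD -/(rip g v).
move: h1; rewrite vE rnorm_sqD rnormN ripNr ripDr ripNr rip_self => h1.
move: h3 h1; move: (rnorm (E g) ^+ 2) (rnorm g ^+ 2) (rip g (E g)) (complex.Re s0).
move=> p q r s; lra.
Qed.

End Realised.

Lemma positivity_vector (FT : bounded_op UK UK) :
  partial_sum term @ totally --> FT -> 0 <= rip (FT w) w.
Proof.
move=> cvT; have [m_0|m_gt0] := posnP m.
  have -> : w = 0 by rewrite /w big1// => -[i im]; exfalso; move: im; rewrite m_0.
  by rewrite /rip ip0r.
by have [th thE] := ex_theta (Ordinal m_gt0); exact: positivity_realised thE _ cvT.
Qed.

End Vector.

Lemma calculus_accretive : exists FT : bounded_op UK UK,
  is_functional_calculus c T FT /\ op_ge0 (FT + FT^*o).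
Proof.
have FF := @totally_filter midx.
have [FT cvT] := functional_calculus_cvg; exists FT; split=> [y|y].
  have := @rcvg_eval _ _ _ _ _ FF _ _ y cvT.
  have -> : (fun J => partial_sum term J y) = partial_sum (fun n => term n y).
    by apply/funext => J; rewrite !partial_sumE op_sumE.
  by [].
rewrite op_addE ipDl adjPl [inner y _]ipC.
have -> (t : C) : t + Num.conj t = (2 * complex.Re t)%:C%C.
  case: t => t1 t2; apply/eqP.
  by rewrite eq_complex/= subrr eqxx andbT mulr2n mulrDl mul1r.
rewrite ler0c mulr_ge0// -/(rip (FT y) y).
apply: (@dense_rip_ge0 _ _ _ FT (@dense_tensor _ _ _ UK)) => _ [s ->].
rewrite (big_nth (0, 0)) big_mkord.
exact: (positivity_vector (fun i => (nth (0, 0) s i).1) (fun i => (nth (0, 0) s i).2) cvT).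
Qed.

End Positivity.

Lemma transfer_herglotz_agler (R : realType) (d : nat) (U K X : hilbertType R)
    (UK : hilbert_tensor U K) (F : 'rV[R[i]]_d -> bounded_op U U)
    (P : 'I_d -> bounded_op X X) (A : bounded_op X X) (B : bounded_op U X)
    (C : bounded_op X U) (D : bounded_op U U) :
  ~ finite_dimensional K -> spectral_decomposition P -> A^*o *o A = op_id X ->
  B = A *o C^*o -> D + D^*o = C *o C^*o ->
  (forall z, polydisk d z ->
    F z = D + C *o op_inv (op_id X - pencil P z *o A) *o pencil P z *o B) ->
  herglotz_agler UK F.
Proof.
move=> infK Pspec Aiso BE DE FE; split; first exact: transfer_holomorphic FE.
exists (taylor_coef P A C D); split; first exact: transfer_taylor FE.
by move=> T Tcsc; exact: calculus_accretive.
Qed.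

(** * Testing a Herglotz-Agler function against dual kernels *)

Section DualCone.
Context {R : realType} {d : nat} {U K : hilbertType R} (UK : hilbert_tensor U K).
Local Notation C := R[i].
Local Notation midx := (multiindex (d := d)).
Local Notation tens := (tensor UK).
Hypothesis d_gt0 : (0 < d)%N.
Hypothesis infK : ~ finite_dimensional K.
Variable F : 'rV[C]_d -> bounded_op U U.
Hypothesis FHA : herglotz_agler UK F.
Variables (N : nat) (z : 'I_N -> 'rV[C]_d) (u : 'I_N -> U).
Hypothesis zD : forall a, polydisk d (z a).
Variable G : 'I_N -> 'I_N -> C.
Hypothesis GP : forall j, psd (fun a b => (1 - z a 0 j * Num.conj (z b 0 j)) * G a b).

(** Iterating [G >= z_j G conj z_j] makes the right-hand side decay, so that
    [G] itself is positive. *)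
Lemma dual_psd : psd G.
Proof.
move=> s; pose j := Ordinal d_gt0.
have [r [/andP[r0 r1] zr]] : exists r, 0 <= r < 1 /\ forall a, rnorm (z a 0 j) <= r.
  by apply: ex_radius => a; have := zD a j; rewrite rnormE ltcR.
pose sc m := [seq (p.1 * z p.2 0 j ^+ m, p.2) | p <- s].
have scE m : qform G (sc m) = \sum_(p <- s) \sum_(q <- s)
    p.1 * Num.conj q.1 * (z p.2 0 j * Num.conj (z q.2 0 j)) ^+ m * G p.2 q.2.
  rewrite /qform big_map; apply: eq_bigr => p _; rewrite big_map; apply: eq_bigr => q _.
  by rewrite rmorphM/= rmorphXn/= exprMn; ring.
have step m : qform G (sc m.+1) <= qform G (sc m).
  rewrite -subr_ge0; have := GP j (sc m).
  suff -> : qform (fun a b => (1 - z a 0 j * Num.conj (z b 0 j)) * G a b) (sc m) =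
    qform G (sc m) - qform G (sc m.+1) by [].
  rewrite !scE /qform big_map -sumrB; apply: eq_bigr => p _.
  rewrite big_map -sumrB; apply: eq_bigr => q _ /=.
  by rewrite rmorphM/= rmorphXn/= exprS exprMn; ring.
have le0 m : qform G (sc m) <= qform G s.
  elim: m => [|m]; last exact: le_trans (step m).
  have -> : sc 0%N = s by rewrite /sc -[RHS]map_id; apply: eq_map => -[p1 p2]; rewrite expr0 mulr1.
  exact: lexx.
pose M := \sum_(p <- s) \sum_(q <- s) rnorm (p.1 * Num.conj q.1 * G p.2 q.2) + 1.
have M0 : 0 < M.
  rewrite ltr_wpDl// sumr_ge0// => p _; rewrite sumr_ge0// => q _; exact: rnorm_ge0.
have bound m : rnorm (qform G (sc m)) <= r ^+ m * M.
  rewrite scE (le_trans (rnorm_sum _ _ _))//.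
  rewrite (@le_trans _ _ (r ^+ m * (M - 1)))//; last by rewrite ler_wpM2l ?exprn_ge0// gerBl.
  rewrite /M addrK mulr_sumr; apply: ler_sum => p _.
  rewrite (le_trans (rnorm_sum _ _ _))// mulr_sumr; apply: ler_sum => q _.
  set t := z p.2 0 j * Num.conj (z q.2 0 j).
  have -> : p.1 * Num.conj q.1 * t ^+ m * G p.2 q.2 =
    t ^+ m * (p.1 * Num.conj q.1 * G p.2 q.2) by ring.
  rewrite rnormM ler_wpM2r ?rnorm_ge0// /t.
  rewrite rnormX; apply: lerXn2r; rewrite ?nnegrE ?rnorm_ge0//.
  rewrite rnormM rnorm_conj; have := zr p.2; have := zr q.2.
  have := rnorm_ge0 (z p.2 0 j); have := rnorm_ge0 (z q.2 0 j); nra.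
have cv : (fun m => qform G s - qform G (sc m)) @ \oo --> (qform G s : C).
  apply/rcvgP => e e0; have cvr : (fun m => r ^+ m : R) @ \oo --> (0 : R).
    by apply: cvg_expr; rewrite ger0_norm.
  have e1 : 0 < e / M by rewrite divr_gt0.
  have /cvgrPdist_lt/(_ _ e1) := cvr; apply: filterS => m.
  rewrite sub0r normrN ger0_norm ?exprn_ge0// ltr_pdivlMr// => lt_m.
  by rewrite subKr (le_lt_trans (bound m)).
by apply: ge0_cvg cv _ => m; rewrite subr_ge0.
Qed.

Section Vectors.
Variable x : 'I_N -> K.
Hypothesis xG : forall a b, inner (x a) (x b) = G a b.

(** The hypothesis on [G] says that multiplication by the [j]-th coordinates is
    contractive on the vectors [x a]. *)
Let ex_T j : exists T : bounded_op K K, [/\ forall a, T (x a) = z a 0 j *: x a,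
  forall g, (forall a, inner (x a) g = 0) -> T g = 0 & rnorm T <= 1].
Proof.
apply: op_extension => // s; apply: lcomb_dom.
apply: eq_psd (GP j) => a b; rewrite ipZl ipZr xG; ring.
Qed.

Variable rho : R.
Hypothesis rho0 : 0 <= rho.
Hypothesis rho1 : rho < 1.

Let T j : bounded_op K K := rho%:C%C *: projT1 (cid (ex_T j)).

Let T_x j a : T j (x a) = (rho%:C%C *: z a) 0 j *: x a.
Proof. by rewrite /T opE; case: cid => Y [/= -> _ _]; rewrite mxE scalerA. Qed.

Let T_orth j g : (forall a, inner (x a) g = 0) -> T j g = 0.
Proof. by move=> h; rewrite /T opE; case: cid => Y [/= _ -> // _]; rewrite scaler0. Qed.

Let T_csc : commuting_strict_contractions T.
Proof.
split=> [j k|k].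
  apply/eqP; rewrite -subr_eq0; apply/eqP.
  apply: (@op_eq0_total _ _ _ _ x) => [a|g hg].
    by rewrite op_subE !op_compE !T_x !op_mapZ !T_x !scalerA mulrC subrr.
  by rewrite op_subE !op_compE !T_orth// ?linear0 ?addr0// => a; rewrite ip0r.
rewrite rnormE ltcR /T rnormZ rnorm_real ger0_norm//; case: cid => Y [/= _ _ Y1].
by rewrite (le_lt_trans _ rho1)// ler_piMr.
Qed.

Let mono_x (n : midx) a : op_monomial T n (x a) = monomial (rho%:C%C *: z a) n *: x a.
Proof.
have ex m k : op_exp (T k) m (x a) = (rho%:C%C *: z a) 0 k ^+ m *: x a.
  elim: m => [|m IH]; first by rewrite expr0 scale1r.
  by rewrite /op_exp iterS op_compE IH op_mapZ T_x scalerA -exprSr.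
rewrite /op_monomial /monomial; elim: (index_enum _) => [|k s IH].
  by rewrite !big_nil scale1r.
by rewrite !big_cons op_compE IH op_mapZ ex scalerA mulrC.
Qed.

(** The [x a] are joint eigenvectors, so the functional calculus maps
    [u_a (x) x_a] to [F(rho z_a) u_a (x) x_a]. *)
Lemma dual_test_dilated :
  0 <= complex.Re (\sum_a \sum_b inner (F (rho%:C%C *: z a) (u a)) (u b) * G a b).
Proof.
have FF := @totally_filter midx.
have [_ [c [Fc /(_ T T_csc)[FT [FTc FT0]]]]] := FHA.
pose w : UK := \sum_a tens (u a) (x a).
have rzD a : polydisk d (rho%:C%C *: z a).
  move=> k; rewrite mxE rnormE ltcR rnormM rnorm_real ger0_norm//.
  have := zD a k; rewrite rnormE ltcR => /ltW zk.
  by rewrite (le_lt_trans _ rho1)// ler_piMr.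
have tens_cvg a : (fun J =>
    tens (partial_sum (fun n => monomial (rho%:C%C *: z a) n *: c n) J (u a)) (x a))
    @ totally --> tens (F (rho%:C%C *: z a) (u a)) (x a).
  have cv := @rcvg_eval _ _ _ _ _ FF _ _ (u a) (Fc _ (rzD a)).
  apply/rcvgP => e e0.
  have e1 : 0 < e / (rnorm (x a) + 1) by rewrite divr_gt0// ltr_wpDl ?rnorm_ge0.
  have /rcvgP/(_ _ e1) := cv; apply: filterS => J.
  rewrite ltr_pdivlMr ?ltr_wpDl ?rnorm_ge0// => lt_e.
  rewrite -linearBl.
  have tn (v : U) (y : K) : rnorm (tens v y) = rnorm v * rnorm y.
    apply/eqP; rewrite -(@eqrXn2 _ 2)// ?mulr_ge0 ?rnorm_ge0//; apply/eqP/complexI.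
    by rewrite -ip_self inner_tensor exprMn rmorphM/= -!ip_self.
  rewrite tn; have := rnorm_ge0 (x a).
  move: lt_e; move: (_ - _) => y; have := rnorm_ge0 y; nra.
have FTw : FT w = \sum_a tens (F (rho%:C%C *: z a) (u a)) (x a).
  apply: (rcvg_uniq FF (FTc w)).
  apply: cvg_trans (rcvg_sum FF tens_cvg); apply: near_eq_cvg; apply: nearW => J.
  have term_w n : tensor_op UK (c n) (op_monomial T n) w =
      \sum_a tens ((monomial (rho%:C%C *: z a) n *: c n) (u a)) (x a).
    transitivity (\sum_a tensor_op UK (c n) (op_monomial T n) (tens (u a) (x a))).
      exact: linear_sum.
    apply: eq_bigr => a _.
    by rewrite tensor_opE mono_x op_scaleE linearZr_LR linearZl_LR.
  rewrite partial_sumE; under [RHS]eq_bigr => n _ do rewrite term_w.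
  rewrite exchange_big/=; apply: eq_bigr => a _.
  by rewrite partial_sumE op_sumE linear_sumlz.
have := FT0 w; rewrite op_addE ipDl adjPl [inner w _]ipC => h.
have {h} : 0 <= rip (FT w) w.
  move: h; rewrite lecE => /andP[_]; rewrite cReD cRe_conj -/(rip (FT w) w) /=; lra.
rewrite /rip FTw ip_suml; congr (0 <= complex.Re _); apply: eq_bigr => a _.
by rewrite ip_sumr; apply: eq_bigr => b _; rewrite inner_tensor xG.
Qed.

End Vectors.

Definition herglotz_gram a b : C := inner (F (z a) (u a)) (u b) + inner (u a) (F (z b) (u b)).

(** A positive dual kernel is the Gram kernel of joint eigenvectors of strict
    contractions, once these are shrunk by a factor tending to one; testing
    [F] on the contractions evaluates the pairing with [G]. *)
Lemma dual_test : 0 <= complex.Re (\sum_a \sum_b herglotz_gram a b * G a b).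
Proof.
have [N0|N0] := posnP N.
  by rewrite big1// => -[a aN]; exfalso; move: aN; rewrite N0.
have [x xG] := psd_factor_countable (Ordinal N0) infK dual_psd.
(* Collecting the vectors [u b] makes the dependence on [rho] a single evaluation
   of [F] at each point. *)
pose y a := \sum_b Num.conj (G a b) *: u b.
have yE a v : \sum_b inner v (u b) * G a b = inner v (y a).
  by rewrite ip_sumr; apply: eq_bigr => b _; rewrite ipZr conjCK mulrC.
pose rho n : R := 1 - n.+1%:R^-1.
have rhoP n : 0 <= rho n < 1.
  rewrite subr_ge0 invf_le1// ler1n/= gtrBl invr_gt0 ltr0n//.
have cvz a : (fun n => (rho n)%:C%C *: z a) @ \oo --> z a.
  apply/rcvgP => e e0.
  have e1 : 0 < e / (rnorm (z a) + 1) by rewrite divr_gt0// ltr_wpDl ?rnorm_ge0.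
  have := near_infty_natSinv_lt (PosNum e1); apply: filterS => n /=.
  rewrite ltr_pdivlMr ?ltr_wpDl ?rnorm_ge0// => lt_e.
  have -> : z a - (rho n)%:C%C *: z a = (n.+1%:R^-1)%:C%C *: z a.
    by rewrite /rho rmorphB/= scalerBl scale1r opprB addrC subrK.
  rewrite rnormZ rnorm_real ger0_norm ?invr_ge0//.
  have : 0 < (n.+1%:R^-1 : R) by rewrite invr_gt0 ltr0n.
  by have := rnorm_ge0 (z a); move: lt_e; move: (_^-1) (rnorm _) => s t; nra.
have cv : (fun n => \sum_a inner (F ((rho n)%:C%C *: z a) (u a)) (y a) : C) @ \oo -->
    (\sum_a inner (F (z a) (u a)) (y a) : C).
  apply: rcvg_sum => a; apply: rcvg_ipl; apply: rcvg_eval.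
  have := differentiable_continuous (FHA.1 (z a) (zD a)).
  exact: cvg_comp (cvz a).
have pos : 0 <= complex.Re (\sum_a inner (F (z a) (u a)) (y a)).
  rewrite leNgt; apply/negP => lt0.
  have e0 : 0 < - complex.Re (\sum_a inner (F (z a) (u a)) (y a)) by rewrite oppr_gt0.
  have /rcvgP/(_ _ e0)[n _ /(_ n (leqnn n)) /= lt_n] := cv.
  have := dual_test_dilated xG (proj1 (andP (rhoP n))) (proj2 (andP (rhoP n))).
  under eq_bigr do rewrite yE.
  have contra (s t : C) : rnorm (s - t) < - complex.Re s -> 0 <= complex.Re t -> False.
    move=> lt_st t0; have := le_trans (ler_norm _) (Re_le_rnorm (t - s)).
    by rewrite rnormB cReD cReN; lra.
  exact: contra lt_n.
have E1 : \sum_a \sum_b inner (F (z a) (u a)) (u b) * G a b =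
    \sum_a inner (F (z a) (u a)) (y a).
  by apply: eq_bigr => a _; exact: yE.
have E2 : \sum_a \sum_b inner (u a) (F (z b) (u b)) * G a b =
    Num.conj (\sum_a inner (F (z a) (u a)) (y a)).
  rewrite -E1 rmorph_sum exchange_big/=; apply: eq_bigr => a _.
  rewrite rmorph_sum; apply: eq_bigr => b _.
  by rewrite rmorphM/= -(psd_herm dual_psd) -ipC.
have -> : \sum_a \sum_b herglotz_gram a b * G a b =
    \sum_a inner (F (z a) (u a)) (y a) + Num.conj (\sum_a inner (F (z a) (u a)) (y a)).
  rewrite -E2 -E1 -big_split/=; apply: eq_bigr => a _.
  by rewrite -big_split/=; apply: eq_bigr => b _; rewrite -mulrDl.
by rewrite cReD cRe_conj addr_ge0.
Qed.

End DualCone.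

(** * Ultralimits *)

Lemma fmap_ultra (S T : Type) (f : S -> T) (F : set_system S) :
  UltraFilter F -> UltraFilter (f @ F).
Proof.
move=> UF; have FF := ultra_proper; split; first exact: fmap_proper_filter.
move=> G GF FG; rewrite predeqE => A; split=> [GA|/FG//].
have [//|FnA] := in_ultra_setVsetC (f @^-1` A) UF.
have GnA : G (~` A) by apply: FG.
by have [x [Ax nAx]] := filter_ex (filterI GA GnA).
Qed.

Section Ultralimit.
Context {R : realType}.
Local Notation C := R[i].

Lemma ex_ultra_nat : exists F : set_system nat, UltraFilter F /\ \oo `<=` F.
Proof. by have [F [UF oF]] := @ultraFilterLemma nat \oo _; exists F. Qed.

Variable F : set_system nat.
Hypothesis UF : UltraFilter F.
Hypothesis oF : \oo `<=` F.

Lemma ultra_real_cvg (f : nat -> R) (B : R) :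
  (\forall n \near \oo, `|f n| <= B) -> exists l : R, f @ F --> l.
Proof.
move=> fB; have FF := @ultra_proper _ _ UF.
have := @segment_compact R (- B) B; rewrite compact_ultra.
move=> /(_ _ (fmap_ultra f UF)); case.
  rewrite /fmap/=; apply: filterS (oF fB) => n /=.
  by rewrite ler_norml in_itv.
by move=> l [_ fl]; exists l.
Qed.

(** A bounded sequence converges along an ultrafilter; with one ultrafilter for all
    sequences no diagonal extraction is needed. *)
Lemma ultra_cvg (f : nat -> C) (B : R) :
  (\forall n \near \oo, rnorm (f n) <= B) -> exists l : C, f @ F --> l.
Proof.
have FF := @ultra_proper _ _ UF.
move=> fB.
have [|a fa] := @ultra_real_cvg (fun n => complex.Re (f n)) B.
  by apply: filterS fB => n; apply: le_trans (Re_le_rnorm _).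
have [|b fb] := @ultra_real_cvg (fun n => complex.Im (f n)) B.
  apply: filterS fB => n fnB; apply: le_trans fnB.
  rewrite -(@ler_pXn2r _ 2)// ?nnegrE ?rnorm_ge0// sqr_rnorm real_normK ?num_real//.
  by rewrite lerDr sqr_ge0.
exists (a +i* b)%C; apply/(@rcvgP _ _ _ F) => e e0.
have e2 : 0 < e / 2 by rewrite divr_gt0.
have /cvgrPdist_lt/(_ _ e2) ha := fa; have /cvgrPdist_lt/(_ _ e2) hb := fb.
apply: filterS2 ha hb => n h1 h2; apply: le_lt_trans (rnorm_le_ReIm _) _.
by move: h1 h2; case: (f n) => c d /=; lra.
Qed.

End Ultralimit.

(** * Approximation by a cone of kernels *)

(** One-sided first-order condition at [t = 0]. *)
Lemma small_step_ge0 (R : realFieldType) (a b : R) :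
  (forall t, 0 <= t <= 1 -> 0 <= t ^+ 2 * a + 2 * t * b) -> 0 <= b.
Proof.
move=> h; rewrite leNgt; apply/negP => b0.
have c0 : 0 < `|a| + - b + 1 by have := normr_ge0 a; lra.
pose t := - b / (`|a| + - b + 1).
have t0 : 0 < t by rewrite divr_gt0// oppr_gt0.
have t1 : t <= 1 by rewrite ler_pdivrMr// mul1r; have := normr_ge0 a; lra.
have ta : t * a <= - b.
  apply: (@le_trans _ _ (t * `|a|)); first by rewrite ler_wpM2l ?ler_norm// ltW.
  by rewrite /t mulrAC ler_pdivrMr// ler_wpM2l; have := normr_ge0 a; lra.
have := h t; rewrite (ltW t0) t1 => /(_ isT); nra.
Qed.

Section FiniteKernels.
Context {R : realType}.
Local Notation C := R[i].

(** Repeated indices of a list of coefficients are grouped, so that positivity on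
    a finite type is a statement about vectors. *)
Lemma psd_fin (I : finType) (k : I -> I -> C) :
  (forall f : I -> C, 0 <= \sum_a \sum_b f a * Num.conj (f b) * k a b) -> psd k.
Proof.
move=> kP s; pose f a := \sum_(p <- s | p.2 == a) p.1.
suff -> : qform k s = \sum_a \sum_b f a * Num.conj (f b) * k a b by exact: kP.
rewrite /qform (partition_big (fun p : C * I => p.2) xpredT)//=; apply: eq_bigr => a _.
under eq_bigr => p pa do rewrite (partition_big (fun q : C * I => q.2) xpredT)//=.
rewrite exchange_big/=; apply: eq_bigr => b _.
rewrite /f rmorph_sum mulr_suml mulr_suml; apply: eq_bigr => p /eqP <-.
by rewrite mulr_sumr mulr_suml; apply: eq_bigr => q /eqP <-.
Qed.

Lemma psd_rank1 (I : Type) (f : I -> C) : psd (fun a b => f a * Num.conj (f b)).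
Proof.
have one : psd (fun _ _ : I => 1 : C).
  move=> s; have -> : qform (fun _ _ : I => 1) s =
      (\sum_(p <- s) p.1) * Num.conj (\sum_(p <- s) p.1).
    rewrite rmorph_sum mulr_suml; apply: eq_bigr => p _; rewrite mulr_sumr.
    by apply: eq_bigr => q _; rewrite mulr1.
  exact: mul_conjC_ge0.
by apply: eq_psd (psd_rescale f one) => a b; rewrite mulr1.
Qed.

Lemma conj_mul (x y : C) : Num.conj (x * y) = Num.conj x * Num.conj y.
Proof. exact: rmorphM. Qed.

Lemma conj_opp (x : C) : Num.conj (- x) = - Num.conj x.
Proof. exact: rmorphN. Qed.

Lemma conj_sum (I : Type) (r : seq I) (P : pred I) (f : I -> C) :
  Num.conj (\sum_(i <- r | P i) f i) = \sum_(i <- r | P i) Num.conj (f i).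
Proof. exact: rmorph_sum. Qed.

Section Frobenius.
Variable N : nat.
Implicit Types M : 'I_N -> 'I_N -> C.

Definition frob2 M : R := \sum_a \sum_b rnorm (M a b) ^+ 2.
Definition frob_ip M M' : R := complex.Re (\sum_a \sum_b M a b * Num.conj (M' a b)).

Lemma rnorm_sq_addZ (x y : C) (t : R) : rnorm (x + t%:C%C * y) ^+ 2 =
  rnorm x ^+ 2 + 2 * t * complex.Re (x * Num.conj y) + t ^+ 2 * rnorm y ^+ 2.
Proof.
rewrite !sqr_rnorm; case: x y => x1 x2 [y1 y2] /=; ring.
Qed.

Lemma Re_sum (I : Type) (r : seq I) (P : pred I) (f : I -> C) :
  complex.Re (\sum_(i <- r | P i) f i) = \sum_(i <- r | P i) complex.Re (f i).
Proof. by elim/big_rec2: _ => // i y x _ <-; rewrite cReD. Qed.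

Lemma frob2_addZ M M' t : frob2 (fun a b => M a b + t%:C%C * M' a b) =
  frob2 M + 2 * t * frob_ip M M' + t ^+ 2 * frob2 M'.
Proof.
rewrite /frob2 /frob_ip Re_sum !mulr_sumr -!big_split/=; apply: eq_bigr => a _.
rewrite Re_sum !mulr_sumr -!big_split/=; apply: eq_bigr => b _.
exact: rnorm_sq_addZ.
Qed.

Lemma frob_ipC M M' : frob_ip M M' = frob_ip M' M.
Proof.
rewrite /frob_ip -cRe_conj rmorph_sum; congr complex.Re; apply: eq_bigr => a _.
rewrite rmorph_sum; apply: eq_bigr => b _.
by rewrite rmorphM/= conjCK mulrC.
Qed.

Lemma entry_le_frob2 M a b : rnorm (M a b) ^+ 2 <= frob2 M.
Proof.
rewrite /frob2 (bigD1 a)//= (bigD1 b)//= -addrA lerDl addr_ge0//.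
  by apply: sumr_ge0 => c _; rewrite sqr_ge0.
by apply: sumr_ge0 => c _; apply: sumr_ge0 => e _; rewrite sqr_ge0.
Qed.

Lemma frob2_cvg (F : set_system nat) (FF : ProperFilter F)
    (f : nat -> 'I_N -> 'I_N -> C) M :
  (forall a b, (fun n => f n a b) @ F --> (M a b : C)) ->
  (fun n => frob2 (f n)) @ F --> frob2 M.
Proof.
move=> fM.
have sumcv (I : Type) (r : seq I) (g : I -> nat -> R) (l : I -> R) :
    (forall i, g i @ F --> l i) ->
    (fun n => \sum_(i <- r) g i n) @ F --> \sum_(i <- r) l i.
  move=> gl; elim: r => [|i r IH].
    rewrite big_nil; have -> : (fun n => \sum_(i <- [::]) g i n) = cst 0.
      by apply/funext => n; rewrite big_nil.
    exact: cvg_cst.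
  rewrite big_cons; have -> : (fun n => \sum_(i <- i :: r) g i n) =
      (fun n => g i n + \sum_(i <- r) g i n).
    by apply/funext => n; rewrite big_cons.
  exact: cvgD.
apply: (sumcv) => a; apply: sumcv => b.
have cn : (fun n => rnorm (f n a b)) @ F --> rnorm (M a b).
  apply/cvgrPdist_lt => e e0; have /rcvgP/(_ _ e0) := fM a b.
  apply: filterS => n; apply: le_lt_trans; rewrite ler_norml.
  have := rnormD (M a b - f n a b) (f n a b); rewrite subrK.
  have := rnormD (f n a b - M a b) (M a b); rewrite subrK rnormB.
  move: (rnorm _) (rnorm (M a b)) (rnorm (f n a b)) => p q r h1 h2; apply/andP; split; lra.
rewrite expr2; have -> : (fun n => rnorm (f n a b) ^+ 2) =
    (fun n => rnorm (f n a b) * rnorm (f n a b)) by apply/funext => n; rewrite expr2.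
exact: cvgM.
Qed.

End Frobenius.

Section ConeApproximation.
Variables (N : nat) (J : finType).
Variables (s : J -> 'I_N -> 'I_N -> C) (kappa : 'I_N -> 'I_N -> C).
Hypothesis s_herm : forall j a b, s j b a = Num.conj (s j a b).
Hypothesis kappa_herm : forall a b, kappa b a = Num.conj (kappa a b).
Hypothesis dual : forall G, (forall j, psd (fun a b => s j a b * G a b)) ->
  0 <= complex.Re (\sum_a \sum_b kappa a b * G a b).

Let residual (k : J -> 'I_N -> 'I_N -> C) a b := kappa a b - \sum_j s j a b * k j a b.

Let psd_tuple (k : J -> 'I_N -> 'I_N -> C) := forall j, psd (k j).

Section Minimiser.
Variable e : R.
Hypothesis e0 : 0 < e.
Hypothesis far : forall k, psd_tuple k -> e <= frob2 (residual k).

Let V : set R := [set r | exists k, psd_tuple k /\ r = frob2 (residual k)].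

Let V_inf : has_inf V.
Proof.
split; last by exists e => _ [k [kP ->]]; exact: far.
by exists (frob2 (residual (fun _ _ _ => 0))), (fun _ _ _ => 0); split=> // j; exact: psd0.
Qed.

Let m := inf V.

Let m_le k : psd_tuple k -> m <= frob2 (residual k).
Proof. by move=> kP; apply: ge_inf; [case: V_inf|exists k]. Qed.

Let e_le_m : e <= m.
Proof. by apply: lb_le_inf; [case: V_inf|move=> _ [k [kP ->]]; exact: far]. Qed.

Let ex_k n : exists k, psd_tuple k /\ frob2 (residual k) <= m + n.+1%:R^-1.
Proof.
have [_ [k [kP ->]] lt_m] : exists2 r, V r & r < m + n.+1%:R^-1.
  by apply: inf_adherent => //; rewrite invr_gt0.
by exists k; split=> //; exact: ltW.
Qed.

(** The residuals of almost minimisers have a limit [M], nearest to the origin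
    among limits of residuals. Adding [t h] to the [j]-th kernel shows that [M] has
    nonpositive pairing with [s_j h], and shrinking all kernels by [1 - t] that its
    pairing with [kappa] is positive; thus [G = - conj M] contradicts [dual]. *)
Lemma cone_approx_contra : False.
Proof.
have [k /all_and2[kP kM]] := choice ex_k.
have [F [UF oF]] := ex_ultra_nat; have FF := @ultra_proper _ _ UF.
have exM (p : 'I_N * 'I_N) : exists l : C, (fun n => residual (k n) p.1 p.2) @ F --> l.
  apply: (ultra_cvg UF oF (B := m + 2)); apply: nearW => n.
  have := le_trans (entry_le_frob2 (residual (k n)) p.1 p.2) (kM n).
  have : (n.+1%:R^-1 : R) <= 1 by rewrite invf_le1 ?ler1n ?ltr0n.
  have := rnorm_ge0 (residual (k n) p.1 p.2); have := e_le_m.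
  move: (rnorm _) (_^-1) => r i; nra.
have [M' M'P] := choice exM; pose M a b := M' (a, b).
have Mcv a b : (fun n => residual (k n) a b) @ F --> (M a b : C) by exact: (M'P (a, b)).
have Mshift (L : 'I_N -> 'I_N -> C) t :
    (fun n => frob2 (fun a b => residual (k n) a b + t%:C%C * L a b)) @ F -->
    frob2 (fun a b => M a b + t%:C%C * L a b).
  by apply: frob2_cvg => a b; apply: cvgD; [exact: Mcv|exact: cvg_cst].
have Mm : frob2 M <= m.
  have cv := frob2_cvg FF Mcv.
  rewrite leNgt; apply/negP => lt_m.
  have d0 : 0 < (frob2 M - m) / 2 by rewrite divr_gt0// subr_gt0.
  have /cvgrPdist_lt/(_ _ d0) h1 := cv.
  have h2 := oF _ (near_infty_natSinv_lt (PosNum d0)).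
  have [n [/= n1 n2]] := filter_ex (filterI h1 h2).
  have := kM n; have := le_lt_trans (ler_norm _) n1.
  by move: n2; move: (frob2 (residual (k n))) (_^-1) => p q; lra.
have lower (f : nat -> R) (l : R) : f @ F --> l -> (forall n, m <= f n) -> m <= l.
  move=> fl fm; rewrite leNgt; apply/negP => lt_m.
  have d0 : 0 < m - l by rewrite subr_gt0.
  have /cvgrPdist_lt/(_ _ d0) h1 := fl.
  have [n /= n1] := filter_ex h1.
  have := fm n; have := le_lt_trans (ler_norm _) n1.
  rewrite -normrN opprB in n1; have := le_lt_trans (ler_norm _) n1; lra.
(* First variation in the direction of the cone. *)
have test j (h : 'I_N -> 'I_N -> C) : psd h ->
    frob_ip M (fun a b => s j a b * h a b) <= 0.
  move=> hP; rewrite -oppr_ge0.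
  apply: (@small_step_ge0 _ (frob2 (fun a b => s j a b * h a b))) => t /andP[t0 _].
  have : m <= frob2 (fun a b => M a b + (- t)%:C%C * (s j a b * h a b)).
    apply: (lower _ _ (Mshift (fun a b => s j a b * h a b) (- t))) => n.
    pose k' i a b := k n i a b + (if i == j then t%:C%C * h a b else 0).
    have k'P : psd_tuple k'.
      move=> i; apply: psd_add; first exact: kP.
      case: (i == j); last exact: psd0.
      by apply: psd_scale => //; rewrite ler0c.
    apply: le_trans (m_le k'P) _; rewrite le_eqVlt; apply/orP; left; apply/eqP.
    congr frob2; apply/funext => a; apply/funext => b; rewrite /residual /k'.
    under eq_bigr do rewrite mulrDr.
    rewrite big_split/= opprD addrA; congr (_ + _).
    rewrite (bigD1 j)//= eqxx big1 ?addr0; last by move=> i /negbTE ->; rewrite mulr0.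
    by rewrite rmorphN/=; ring.
  by rewrite frob2_addZ; lra.
(* First variation towards the apex of the cone. *)
have scaled : 0 <= frob_ip M (fun a b => kappa a b - M a b).
  apply: (@small_step_ge0 _ (frob2 (fun a b => kappa a b - M a b))) => t /andP[t0 t1].
  have : m <= frob2 (fun a b => M a b + t%:C%C * (kappa a b - M a b)).
    have cv : (fun n => frob2 (fun a b => residual (k n) a b +
        t%:C%C * (kappa a b - residual (k n) a b))) @ F -->
        frob2 (fun a b => M a b + t%:C%C * (kappa a b - M a b)).
      apply: frob2_cvg => a b; apply: cvgD; first exact: Mcv.
      by apply: cvgZr; apply: cvgB; [exact: cvg_cst|exact: Mcv].
    apply: (lower _ _ cv) => n.
    pose k' i a b := (1 - t)%:C%C * k n i a b.
    have k'P : psd_tuple k'.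
      by move=> i; apply: psd_scale; [rewrite ler0c subr_ge0|exact: kP].
    apply: le_trans (m_le k'P) _; rewrite le_eqVlt; apply/orP; left; apply/eqP.
    congr frob2; apply/funext => a; apply/funext => b; rewrite /residual /k'.
    under eq_bigr do rewrite mulrCA.
    by rewrite -mulr_sumr rmorphB/= rmorph1; ring.
  by rewrite frob2_addZ; lra.
have pos : 0 < frob_ip M kappa.
  have split : frob_ip M (fun a b => kappa a b - M a b) = frob_ip M kappa - frob2 M.
    rewrite /frob_ip /frob2 !Re_sum -sumrB; apply: eq_bigr => a _.
    rewrite !Re_sum -sumrB; apply: eq_bigr => b _; rewrite sqr_rnorm.
    by case: (M a b) (kappa a b) => x1 x2 [y1 y2] /=; ring.
  have mM : m <= frob2 M.
    by apply: lower (frob2_cvg FF Mcv) _ => n; exact: m_le.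
  by rewrite split in scaled; have := lt_le_trans e0 e_le_m; lra.
have M_herm a b : M b a = Num.conj (M a b).
  have res_herm n : residual (k n) b a = Num.conj (residual (k n) a b).
    rewrite /residual rmorphB rmorph_sum/= -kappa_herm; congr (_ - _).
    by apply: eq_bigr => j _; rewrite rmorphM/= -s_herm -(psd_herm (kP n j)).
  apply: (rcvg_uniq FF (Mcv b a)); apply/(@rcvgP _ _ _ F) => d d0.
  have /rcvgP/(_ _ d0) := Mcv a b; apply: filterS => n.
  by rewrite res_herm -[rnorm (M a b - _)]rnorm_conj rmorphB.
pose G a b := - Num.conj (M a b).
have GP j : psd (fun a b => s j a b * G a b).
  apply: psd_fin => f; set q := \sum_a _.
  have q_real : Num.conj q = q.
    rewrite /q conj_sum; under eq_bigr do rewrite conj_sum.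
    rewrite exchange_big/=; apply: eq_bigr => b _; apply: eq_bigr => a _.
    rewrite !conj_mul conjCK -s_herm /G conj_opp conjCK (M_herm b a).
    by rewrite [Num.conj _ * f b]mulrC.
  have q_re : complex.Re q = - frob_ip M (fun a b => s j a b * (f a * Num.conj (f b))).
    rewrite -[LHS]cRe_conj /frob_ip -cReN -sumrN; congr complex.Re.
    rewrite /q conj_sum; apply: eq_bigr => a _; rewrite -sumrN conj_sum.
    apply: eq_bigr => b _; rewrite /G !conj_mul conj_opp !conjCK; ring.
  rewrite lecE q_re oppr_ge0 test ?andbT; last exact: psd_rank1.
  move: q_real; case: q {q_re} => q1 q2 [/= h].
  by apply/eqP; lra.
have := dual GP.
have -> : \sum_a \sum_b kappa a b * G a b =
    - \sum_a \sum_b kappa a b * Num.conj (M a b).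
  rewrite -sumrN; apply: eq_bigr => a _; rewrite -sumrN; apply: eq_bigr => b _.
  by rewrite /G mulrN.
rewrite cReN oppr_ge0 -/(frob_ip kappa M) frob_ipC => h.
by move: pos; rewrite ltNge h.
Qed.

End Minimiser.

(** Closedness of the cone is avoided: the minimal distance is approached, and
    only the residuals are passed to the limit. *)
Lemma cone_approx (e : R) : 0 < e ->
  exists k : J -> 'I_N -> 'I_N -> C, (forall j, psd (k j)) /\
    frob2 (fun a b => kappa a b - \sum_j s j a b * k j a b) < e.
Proof.
move=> e0; apply: contrapT => /forallNP h; apply: (@cone_approx_contra e) => // k kP.
by rewrite leNgt; apply/negP => lt_e; apply: (h k).
Qed.

End ConeApproximation.

End FiniteKernels.

(** * Agler decompositions on countably many points *)

Section CountableKernels.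
Context {R : realType} {d : nat} {U K : hilbertType R} (UK : hilbert_tensor U K).
Local Notation C := R[i].
Hypothesis d_gt0 : (0 < d)%N.
Hypothesis infK : ~ finite_dimensional K.
Variable F : 'rV[C]_d -> bounded_op U U.
Hypothesis FHA : herglotz_agler UK F.

Variables (z : nat -> 'rV[C]_d) (u : nat -> U).
Hypothesis zD : forall a, polydisk d (z a).

Let s j a b : C := 1 - z a 0 j * Num.conj (z b 0 j).
Let kappa a b : C := inner (F (z a) (u a)) (u b) + inner (u a) (F (z b) (u b)).

(** Duality applies to the first [n + 1] indices; [1 / (n + 1)] makes the error vanish
    in the limit. *)
Let ex_finite n : exists k : 'I_d -> nat -> nat -> C, (forall j, psd (k j)) /\
  forall a b, (a <= n)%N -> (b <= n)%N ->
    rnorm (kappa a b - \sum_j s j a b * k j a b) <= n.+1%:R^-1.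
Proof.
have e0 : 0 < (n.+1%:R^-1 : R) ^+ 2 by rewrite exprn_gt0// invr_gt0.
have [j a b|a b|G GP|k [kP kE]] := @cone_approx R n.+1 'I_d
    (fun j a b => s j a b) (fun a b => kappa a b) _ _ _ _ e0.
- by rewrite /s rmorphB rmorphM/= conjCK conjC1 mulrC.
- by rewrite /kappa rmorphD/= -!ipC addrC.
- exact: (@dual_test R d U K UK d_gt0 infK F FHA n.+1 (fun a => z a) (fun a => u a)
    (fun a => zD a) G GP).
(* [inord] extends the kernels to all indices and keeps them positive. *)
exists (fun j a b => k j (inord a) (inord b)); split=> [j|a b an bn].
  exact: psd_reindex.
have := entry_le_frob2 (fun a b : 'I_n.+1 =>
  kappa a b - \sum_j s j a b * k j a b) (inord a) (inord b).
rewrite !inordK ?ltnS// => /le_trans/(_ (ltW kE)).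
by rewrite ler_pXn2r// nnegrE ?rnorm_ge0// invr_ge0.
Qed.

(** The factors [1 - |z_j|^2] at a point are bounded below, so the diagonals of the
    approximate kernels are bounded by those of [kappa], and positivity bounds the
    other entries. An ultralimit of the kernels then is exact. *)
Lemma kernels_nat : exists k : 'I_d -> nat -> nat -> C, (forall j, psd (k j)) /\
  forall a b, kappa a b = \sum_j s j a b * k j a b.
Proof.
have [k /all_and2[kP kE]] := choice ex_finite.
have [G [UG oG]] := ex_ultra_nat; have FG := @ultra_proper _ _ UG.
have inv1 n : (n.+1%:R^-1 : R) <= 1 by rewrite invf_le1 ?ler1n ?ltr0n.
have diag a : exists B : R, forall n j, (a <= n)%N -> complex.Re (k n j a a) <= B.
  have [r [/andP[r0 r1] zr]] := polydisk_radius (zD a).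
  have dl0 : 0 < 1 - r ^+ 2 by rewrite subr_gt0 expr_lt1.
  exists ((rnorm (kappa a a) + 1) / (1 - r ^+ 2)) => n j an.
  have sE i : s i a a = (1 - rnorm (z a 0 i) ^+ 2)%:C%C.
    by rewrite /s -[z a 0 i * _]normCK rmorphB rmorphXn/= rmorph1 -rnormE.
  have kR i : 0 <= complex.Re (k n i a a).
    by have := psd_diag (kP n i) a; rewrite lecE => /andP[].
  have s_ge i : 1 - r ^+ 2 <= 1 - rnorm (z a 0 i) ^+ 2.
    by rewrite lerB// lerXn2r// ?nnegrE ?rnorm_ge0.
  have tot : \sum_i (1 - rnorm (z a 0 i) ^+ 2) * complex.Re (k n i a a) <=
      rnorm (kappa a a) + 1.
    have -> : \sum_i (1 - rnorm (z a 0 i) ^+ 2) * complex.Re (k n i a a) =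
        complex.Re (\sum_i s i a a * k n i a a).
      by rewrite Re_sum; apply: eq_bigr => i _; rewrite sE cReZ.
    have h := kE n a a an an; set t := \sum_i _ in h *.
    have := le_trans (ler_norm _) (Re_le_rnorm t).
    have := rnormD (t - kappa a a) (kappa a a); rewrite subrK [rnorm (t - _)]rnormB.
    have := inv1 n; move: h; move: (rnorm (_ - t)) (rnorm t) (_^-1) => x y w; lra.
  rewrite ler_pdivlMr// mulrC; apply: le_trans tot; rewrite (bigD1 j)//=.
  apply: (@le_trans _ _ ((1 - rnorm (z a 0 j) ^+ 2) * complex.Re (k n j a a))).
    by rewrite ler_wpM2r.
  rewrite lerDl sumr_ge0// => i _; rewrite mulr_ge0//.
  exact: le_trans (ltW dl0) (s_ge i).
have [B BP] := choice diag.
have lim (p : 'I_d * (nat * nat)) : exists l : C,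
    (fun n => k n p.1 p.2.1 p.2.2) @ G --> l.
  apply: (ultra_cvg UG oG (B := B p.2.1 + B p.2.2)).
  exists (maxn p.2.1 p.2.2) => // n /=; rewrite geq_max => /andP[n1 n2].
  by rewrite (le_trans (psd_bound (kP n p.1) _ _))// lerD// BP.
have [L LP] := choice lim; pose k' j a b := L (j, (a, b)).
have k'P j a b : (fun n => k n j a b) @ G --> (k' j a b : C) by exact: (LP (j, (a, b))).
exists k'; split=> [j t|a b].
  have cv : (fun n => qform (k n j) t) @ G --> (qform (k' j) t : C).
    apply: rcvg_sum => p; apply: rcvg_sum => q.
    exact: (cvgZr (V := C) (k := p.1 * Num.conj q.1) (k'P j p.2 q.2)).
  by apply: (ge0_cvg FG cv) => n; exact: kP.
have cv : (fun n => kappa a b - \sum_j s j a b * k n j a b) @ G -->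
    (kappa a b - \sum_j s j a b * k' j a b : C).
  apply: cvgB; first exact: cvg_cst.
  apply: rcvg_sum => j; exact: (cvgZr (V := C) (k := s j a b) (k'P j a b)).
apply/eqP; rewrite -subr_eq0; apply/eqP/rnorm_eq0/eqP; rewrite eq_le rnorm_ge0 andbT.
rewrite leNgt; apply/negP => e0.
have e2 : 0 < rnorm (kappa a b - \sum_j s j a b * k' j a b) / 2 by rewrite divr_gt0.
have : rnorm (kappa a b - \sum_j s j a b * k' j a b) <=
    rnorm (kappa a b - \sum_j s j a b * k' j a b) / 2.
  apply: (rcvg_le FG cv); apply: oG.
  have [m _ mP] := near_infty_natSinv_lt (PosNum e2).
  exists (maxn m (maxn a b)) => // n /=; rewrite !geq_max => /and3P[mn an bn].
  by rewrite (le_trans (kE n a b an bn))// ltW// mP.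
move: (rnorm _) e0 {e2} => x; lra.
Qed.

End CountableKernels.

(** * From kernels on a dense set to colligations *)

Section Colligation.
Context {R : realType} {d : nat} {U : hilbertType R}.
Local Notation C := R[i].

(** The colligation has [D = F(0)] and [C = B* A], with [A] and [B] given by the
    lurking isometry. The relation [G - A P(z) G = B] identifies [A* G] with
    [(I - P(z)A)^-1 C*], which yields the transfer function form of [F]. *)
Lemma agler_colligation (I : Type) (z : I -> 'rV[C]_d) (i0 : I)
    (H : 'I_d -> hilbertType R) (h : forall k, I -> bounded_op U (H k))
    (F : I -> bounded_op U U) :
  z i0 = 0 -> (forall i, polydisk d (z i)) ->
  (forall i j, (F i)^*o + F j =
    \sum_(k < d) (1 - Num.conj (z i 0 k) * z j 0 k) *: ((h k i)^*o *o h k j)) ->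
  exists (X : hilbertType R) (P : 'I_d -> bounded_op X X)
      (A : bounded_op X X) (B : bounded_op U X) (Cc : bounded_op X U) (D : bounded_op U U),
      [/\ spectral_decomposition P,
          A^*o *o A = op_id X /\ A *o A^*o = op_id X,
          B = A *o Cc^*o,
          D + D^*o = Cc *o Cc^*o /\ Cc *o Cc^*o = B^*o *o B
        & forall i, F i = D + Cc *o op_inv (op_id X - pencil P (z i) *o A) *o
            pencil P (z i) *o B].
Proof.
move=> z0 zD agler.
have [X [P [A [B [Pspec [AA AA'] DB real]]]]] := lurking_isometry z0 agler.
have AAE x : A (A^*o x) = x by have := op_eqP x AA'; rewrite !opE.
have AAE' x : A^*o (A x) = x by have := op_eqP x AA; rewrite !opE.
pose Cc := B^*o *o A; have CE : Cc^*o = A^*o *o B by rewrite /Cc adjM adjK.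
have BE : B = A *o Cc^*o by rewrite CE; apply: op_ext => u; rewrite !opE AAE.
have CB : Cc *o Cc^*o = B^*o *o B.
  by rewrite CE; apply: op_ext => u; rewrite !opE AAE.
have DE : F i0 + (F i0)^*o = Cc *o Cc^*o by rewrite CB.
exists X, P, A, B, Cc, (F i0); split=> // i.
have [G [GE ->]] := real i.
pose F' w := F i0 + Cc *o op_inv (op_id X - pencil P w *o A) *o pencil P w *o B.
rewrite -[RHS]/(F' (z i)); apply: op_ext => u.
rewrite (@transferE _ _ _ _ P A B Cc (F i0) F' Pspec AA BE _ (z i) u)//.
have rE : resolvent P A (z i) (Cc^*o u) = A^*o (G u).
  apply/esym/(resolvent_uniq Pspec AA) => //; rewrite AAE CE.
  have := op_eqP u GE; rewrite !opE => <-.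
  by rewrite linearB/= AAE' subrK.
rewrite rE /Cc !opE AAE CE !opE AAE linearB/=.
by apply: ip_inj => v; rewrite !ipE; ring.
Qed.

End Colligation.

Section Density.
Context {R : realType}.
Local Notation C := R[i].

Lemma ex_dense_seq (V : normedModType C) : separable V ->
  exists f : nat -> V, forall x (e : R), 0 < e -> exists n, rnorm (x - f n) < e.
Proof.
move=> [S [/countable_injP[g g_inj] dS]].
exists (fun n => xget 0 [set x | S x /\ g x = n]) => x e e0.
have [s [Ss xs]] := dense_approx x dS e0; exists (g s).
case: xgetP => [y _ [Sy gy]|/(_ s)[]//].
by rewrite (g_inj y s)// inE.
Qed.

Lemma dense_seq_orth (V : hilbertType R) (f : nat -> V) (g : V) :
  (forall x (e : R), 0 < e -> exists n, rnorm (x - f n) < e) ->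
  (forall n, inner (f n) g = 0) -> g = 0.
Proof.
move=> fd fg; apply: (@dense_orth _ _ (range f)) => [W [x Wx] Wopen|_ [n _ <-]//].
have /nbhs_ballP[e /= e0 eW] : nbhs x W by exact: open_nbhs_nbhs.
have eE : e = (complex.Re e)%:C%C by rewrite RRe_real// gtr0_real.
rewrite eE in e0 eW; rewrite ltcR in e0.
have [n xn] := fd x _ e0; exists (f n); split; last by exists n.
by apply: eW; rewrite -ball_normE /ball_/= rnormE ltcR.
Qed.

(** Points with coordinates in [Q + iQ], those outside the polydisk being replaced
    by the origin. *)
Lemma ex_dense_polydisk d : exists z : nat -> 'rV[C]_d,
  [/\ forall n, polydisk d (z n), exists n, z n = 0 &
    forall w (e : R), polydisk d w -> 0 < e -> exists n, rnorm (w - z n) < e].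
Proof.
pose pt (q : 'rV[rat * rat]_d) : 'rV[C]_d :=
  \row_k ((ratr (q 0 k).1 : R) +i* ratr (q 0 k).2)%C.
pose z n : 'rV[C]_d := if (choice.unpickle n : option 'rV[rat * rat]_d) is Some q then
  (if `[< polydisk d (pt q) >] then pt q else 0) else 0.
have D0 : polydisk d (0 : 'rV[C]_d) by move=> k; rewrite mxE normr0 ltr01.
exists z; split=> [n||w e wD e0].
- by rewrite /z; case: choice.unpickle => // q; case: asboolP.
- exists (choice.pickle (const_mx (0, 0) : 'rV[rat * rat]_d)); rewrite /z choice.pickleK.
  case: asboolP => // _; apply/rowP => k; rewrite !mxE /= raddf0.
  by apply/eqP; rewrite eq_complex/= !eqxx.
have [r [/andP[r0 r1] wr]] := polydisk_radius wD.
pose dl := Num.min e (1 - r); have dl0 : 0 < dl by rewrite lt_min e0 subr_gt0.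
have dl2 : 0 < dl / 2 by rewrite divr_gt0.
have ex_q (x : R) : exists q : rat, `|x - ratr q| < dl / 2.
  have xd : x - dl / 2 < x + dl / 2 by lra.
  have [q] := rat_in_itvoo xd; rewrite in_itv/= => /andP[q1 q2]; exists q.
  by rewrite ltr_norml; lra.
have ex_k k : exists q : rat * rat, rnorm (w 0 k - (ratr q.1 +i* ratr q.2)%C : C) < dl.
  have [q1 h1] := ex_q (complex.Re (w 0 k)); have [q2 h2] := ex_q (complex.Im (w 0 k)).
  exists (q1, q2); apply: le_lt_trans (rnorm_le_ReIm _) _.
  by move: h1 h2; case: (w 0 k) => a b /=; lra.
have [qk qkP] := choice ex_k; pose q : 'rV[rat * rat]_d := \row_k qk k.
have ptq : polydisk d (pt q).
  move=> k; rewrite !mxE rnormE ltcR; set c := (_ +i* _)%C.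
  have := qkP k; rewrite -/c rnormB => h1.
  have := rnormD (c - w 0 k) (w 0 k); rewrite subrK; have := wr k.
  have : dl <= 1 - r by rewrite ge_min lexx orbT.
  move: h1; move: (rnorm (c - _)) (rnorm (w 0 k)) (rnorm c) => a b c'; lra.
exists (choice.pickle q); rewrite /z choice.pickleK; case: asboolP => // _.
apply: rnorm_mx_lt => // k; rewrite !mxE; apply: lt_le_trans (qkP k) _.
by rewrite ge_min lexx.
Qed.

Lemma eq_on_dense d (W : normedModType C) (F G : 'rV[C]_d -> W) (z : nat -> 'rV[C]_d) :
  (forall w (e : R), polydisk d w -> 0 < e -> exists n, rnorm (w - z n) < e) ->
  (forall n, F (z n) = G (z n)) ->
  holomorphic_on_polydisk F -> holomorphic_on_polydisk G ->
  forall w, polydisk d w -> F w = G w.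
Proof.
move=> zd FG hF hG w wD.
have cF := differentiable_continuous (hF w wD).
have cG := differentiable_continuous (hG w wD).
apply/eqP; rewrite -subr_eq0; apply/eqP/rnorm_eq0/eqP; rewrite eq_le rnorm_ge0 andbT.
rewrite leNgt; apply/negP => e0.
have e2 : 0 < rnorm (F w - G w) / 2 by rewrite divr_gt0.
have /rcvgP/(_ _ e2) h1 := cF; have /rcvgP/(_ _ e2) h2 := cG.
have /nbhs_ballP[e /= e_gt0 eO] : nbhs w [set y |
    rnorm (F w - F y) < rnorm (F w - G w) / 2 /\ rnorm (G w - G y) < rnorm (F w - G w) / 2].
  exact: filterI h1 h2.
have eE : e = (complex.Re e)%:C%C by rewrite RRe_real// gtr0_real.
rewrite eE in e_gt0 eO; rewrite ltcR in e_gt0.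
have [n wn] := zd w _ wD e_gt0.
have [] := eO (z n); first by rewrite -ball_normE /ball_/= rnormE ltcR.
rewrite /= -FG => g1 g2.
have := rnorm_tri (F w) (F (z n)) (G w); move: g1 g2 e0.
move: (rnorm (F w - F (z n))) (rnorm (G w - F (z n))) (rnorm (F w - G w)) => a b c; lra.
Qed.

End Density.

Section AglerOperators.
Context {R : realType} {d : nat} {U K : hilbertType R}.
Local Notation C := R[i].
Variable F : 'rV[C]_d -> bounded_op U U.
Variables (z : nat -> 'rV[C]_d) (u : nat -> U).
Hypothesis zD : forall n, polydisk d (z n).
Hypothesis u_dense : forall x (e : R), 0 < e -> exists n, rnorm (x - u n) < e.
Variable g : 'I_d -> nat -> nat -> K.
Hypothesis gE : forall m n m' n',
  inner (F (z m) (u n)) (u n') + inner (u n) (F (z m') (u n')) =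
  \sum_j (1 - z m 0 j * Num.conj (z m' 0 j)) * inner (g j m n) (g j m' n').

(** At a single point [z m] the identity [gE] bounds the combination of the
    [g j m n] by that of the [u n], since [1 - |z_j|^2 >= 1 - r^2 > 0]. *)
Let ex_op j m : exists H : bounded_op U K, forall n, H (u n) = g j m n.
Proof.
have [r [/andP[r0 r1] zr]] := polydisk_radius (zD m).
have dl0 : 0 < 1 - r ^+ 2 by rewrite subr_gt0 expr_lt1.
pose q := 2 * rnorm (F (z m)) / (1 - r ^+ 2).
have q0 : 0 <= q by rewrite divr_ge0 ?(ltW dl0)// mulr_ge0 ?rnorm_ge0.
have [||H [HE _ _]] := @op_extension R U K nat u (g j m) (Num.sqrt q); last by exists H.
  exact: sqrtr_ge0.
move=> s; rewrite -(@ler_pXn2r _ 2)// ?nnegrE ?mulr_ge0 ?rnorm_ge0 ?sqrtr_ge0//.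
rewrite exprMn sqr_sqrtr//; set v := lcomb u s.
have sE i : 1 - z m 0 i * Num.conj (z m 0 i) = (1 - rnorm (z m 0 i) ^+ 2)%:C%C.
  by rewrite -[z m 0 i * _]normCK rmorphB rmorphXn/= rmorph1 -rnormE.
have tot : \sum_i (1 - rnorm (z m 0 i) ^+ 2) * rnorm (lcomb (g i m) s) ^+ 2 =
    2 * rip (F (z m) v) v.
  have Fv : F (z m) v = lcomb (fun n => F (z m) (u n)) s.
    rewrite linear_sum; apply: eq_bigr => p _; exact: op_mapZ.
  have -> : 2 * rip (F (z m) v) v =
      complex.Re (inner (F (z m) v) v + inner v (F (z m) v)).
    by rewrite cReD [inner v _]ipC cRe_conj -/(rip (F (z m) v) v); lra.
  rewrite Fv !inner_lcomb -big_split/=.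
  under [in RHS]eq_bigr do rewrite -big_split/=.
  under [in RHS]eq_bigr do under eq_bigr do rewrite -mulrDr gE.
  have -> : \sum_(p <- s) \sum_(p' <- s) p.1 * Num.conj p'.1 *
      (\sum_j (1 - z m 0 j * Num.conj (z m 0 j)) * inner (g j m p.2) (g j m p'.2)) =
      qform (fun n n' => \sum_j (1 - z m 0 j * Num.conj (z m 0 j)) *
        inner (g j m n) (g j m n')) s by [].
  rewrite qform_sum Re_sum; apply: eq_bigr => i _.
  by rewrite qform_scale qform_gram sE -rmorphM.
have s_ge i : 1 - r ^+ 2 <= 1 - rnorm (z m 0 i) ^+ 2.
  by rewrite lerB// lerXn2r// ?nnegrE ?rnorm_ge0.
rewrite /q mulrAC ler_pdivlMr//.
apply: (@le_trans _ _ (2 * rip (F (z m) v) v)); last first.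
  rewrite -mulrA ler_wpM2l// (le_trans (ler_norm _))// (le_trans (rip_CS _ _))//.
  by rewrite expr2 mulrA ler_wpM2r ?rnorm_ge0// rnorm_op.
rewrite -tot (bigD1 j)//= mulrC.
apply: (@le_trans _ _ ((1 - rnorm (z m 0 j) ^+ 2) * rnorm (lcomb (g j m) s) ^+ 2)).
  by rewrite ler_wpM2r ?sqr_ge0.
rewrite lerDl sumr_ge0// => i _; rewrite mulr_ge0 ?sqr_ge0//.
exact: le_trans (ltW dl0) (s_ge i).
Qed.

(** Scalar kernels on pairs (point, vector) are turned into operator kernels on
    points. *)
Lemma agler_operators : exists H : 'I_d -> nat -> bounded_op U K, forall m m',
  (F (z m))^*o + F (z m') =
  \sum_(j < d) (1 - Num.conj (z m 0 j) * z m' 0 j) *: ((H j m)^*o *o H j m').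
Proof.
have [H HE] := choice (fun p : 'I_d * nat => ex_op p.1 p.2).
exists (fun j m => H (j, m)) => m m'.
apply/eqP; rewrite -subr_eq0; apply/eqP; set Z := _ - _.
have Zu n n' : inner (Z (u n)) (u n') = 0.
  rewrite /Z op_subE op_addE op_sumE ipBl ipDl adjPl [X in X - _]addrC gE ip_suml.
  rewrite -sumrB big1// => j _; rewrite opE ipZl opE adjPl.
  by rewrite -(HE (j, m') n) -(HE (j, m) n') [Num.conj _ * _]mulrC subrr.
have Zu0 n : Z (u n) = 0.
  apply: (dense_seq_orth u_dense) => n'.
  by rewrite ipC Zu conjC0.
by apply: (op_eq0_total Zu0) => y hy; rewrite (dense_seq_orth u_dense hy) linear0.
Qed.

End AglerOperators.

(** * The three characterisations *)

(** Points of a countable dense subset determine a holomorphic function, so it is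
    enough to realise the restriction of [F] to them; there a decomposition only has
    to be indexed by pairs of a point and a vector of a dense sequence in [U]. *)
Lemma herglotz_agler_kernels (R : realType) (d : nat) (U K : hilbertType R)
    (UK : hilbert_tensor U K) (F : 'rV[R[i]]_d -> bounded_op U U) :
  (0 < d)%N -> separable U -> ~ finite_dimensional K -> herglotz_agler UK F ->
  exists k : 'I_d -> 'rV[R[i]]_d -> 'rV[R[i]]_d -> bounded_op U U,
    (forall j, positive_kernel (polydisk d) (k j)) /\
    (forall w z, polydisk d w -> polydisk d z ->
      (F w)^*o + F z =
      \sum_(j < d) (1 - Num.conj (w 0 j) * z 0 j) *: k j w z).
Proof.
move=> d0 sepU infK FHA.
have [u u_dense] := ex_dense_seq sepU.
have [z [zD [n0 z0] z_dense]] := ex_dense_polydisk (R := R) d.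
pose pr n : nat * nat := odflt (0%N, 0%N) (choice.unpickle n).
have prK m n : pr (choice.pickle (m, n)) = (m, n) by rewrite /pr choice.pickleK.
have [k [kpsd kE]] := @kernels_nat _ _ _ _ UK d0 infK F FHA
  (fun a => z (pr a).1) (fun a => u (pr a).2) (fun a => zD _).
have [h hE] := choice (fun j => @psd_factor_countable R K nat 0%N (k j) infK (kpsd j)).
have [|H HE] := @agler_operators _ _ _ K F z u zD u_dense
    (fun j m n => h j (choice.pickle (m, n))).
  move=> m n m' n'; have := kE (choice.pickle (m, n)) (choice.pickle (m', n')).
  by rewrite !prK => ->; apply: eq_bigr => j _; rewrite hE.
have [X [P [A [B [C [D [Pspec [AA _] BE [DE _] FE]]]]]]] :=
  @agler_colligation _ _ _ nat z n0 (fun=> K) H (fun n => F (z n)) z0 zD HE.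
pose G w := D + C *o op_inv (op_id X - pencil P w *o A) *o pencil P w *o B.
have G_hol : holomorphic_on_polydisk G by apply: (transfer_holomorphic Pspec AA BE).
apply: (transfer_kernels Pspec AA BE DE) => w wD.
exact: eq_on_dense z_dense FE FHA.1 G_hol w wD.
Qed.

(** The kernels are factored separately, and the resulting decomposition is indexed
    by the points of the polydisk, among which is the origin. *)
Lemma kernels_realization (R : realType) (d : nat) (U : hilbertType R)
    (F : 'rV[R[i]]_d -> bounded_op U U)
    (k : 'I_d -> 'rV[R[i]]_d -> 'rV[R[i]]_d -> bounded_op U U) :
  (forall j, positive_kernel (polydisk d) (k j)) ->
  (forall w z, polydisk d w -> polydisk d z ->
    (F w)^*o + F z =
    \sum_(j < d) (1 - Num.conj (w 0 j) * z 0 j) *: k j w z) ->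
  exists (X : hilbertType R) (P : 'I_d -> bounded_op X X)
    (A : bounded_op X X) (B : bounded_op U X)
    (C : bounded_op X U) (D : bounded_op U U),
    [/\ spectral_decomposition P,
        A^*o *o A = op_id X /\ A *o A^*o = op_id X,
        B = A *o C^*o,
        D + D^*o = C *o C^*o /\ C *o C^*o = B^*o *o B
      & forall z, polydisk d z ->
          F z = D + C *o op_inv (op_id X - pencil P z *o A) *o pencil P z *o B].
Proof.
move=> k_pos kE.
have [H hP] := choice k_pos.
pose h j := sval (cid (hP j)); have hE j := svalP (cid (hP j)).
pose I := {z : 'rV[R[i]]_d | polydisk d z}.
have D0 : polydisk d (0 : 'rV[R[i]]_d) by move=> j; rewrite mxE normr0 ltr01.
have [//|i|i j|X [P [A [B [C [D [Pspec AA BE DE FE]]]]]]] :=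
  @agler_colligation R d U I (@sval _ _) (exist _ 0 D0) H (fun j z => h j (sval z))
    (fun z => F (sval z)).
- exact: svalP.
- rewrite kE; [|exact: svalP..]; apply: eq_bigr => l _; congr (_ *: _).
  by apply: hE; exact: svalP.
by exists X, P, A, B, C, D; split=> // z zD; exact: (FE (exist _ z zD)).
Qed.

Unset Implicit Arguments.

Theorem theorem3p1 (R : realType) (d : nat) (d_gt0 : (0 < d)%N)
    (U : hilbertType R) (sepU : separable U)
    (K : hilbertType R) (sepK : separable K) (infK : ~ finite_dimensional K)
    (UK : hilbert_tensor U K)
    (F : 'rV[R[i]]_d -> bounded_op U U) :
  [<->
    herglotz_agler UK F;
    exists k : 'I_d -> 'rV[R[i]]_d -> 'rV[R[i]]_d -> bounded_op U U,
      (forall j, positive_kernel (polydisk d) (k j)) /\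
      (forall w z, polydisk d w -> polydisk d z ->
        (F w)^*o + F z =
        \sum_(j < d) (1 - Num.conj (w 0 j) * z 0 j) *: k j w z);
    exists (X : hilbertType R) (P : 'I_d -> bounded_op X X)
      (A : bounded_op X X) (B : bounded_op U X)
      (C : bounded_op X U) (D : bounded_op U U),
      [/\ spectral_decomposition P,
          A^*o *o A = op_id X /\ A *o A^*o = op_id X,
          B = A *o C^*o,
          D + D^*o = C *o C^*o /\ C *o C^*o = B^*o *o B
        & forall z, polydisk d z ->
            F z = D + C *o op_inv (op_id X - pencil P z *o A) *o pencil P z *o B]
  ].
Proof.
tfae.
- exact: herglotz_agler_kernels.
- by move=> [k [k_pos kE]]; exact: kernels_realization k_pos kE.
- move=> [X [P [A [B [C [D [Pspec [AA _] BE [DE _] FE]]]]]]].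
  exact: transfer_herglotz_agler infK Pspec AA BE DE FE.
Qed.
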